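(* Let $\widetilde{\mathfrak g}$ be the simple regular graded Lie algebra with $\ell=3$ and rank $k+1$ $(k\ge0)$, realized as in the context. Put $e_1=1$, $e_2=\pi$, $e_3=u\pi$, and for $l\in\{1,2,3\}$ and $X=X_m+\dots+X_k$ with $X_j\in\widetilde{\mathfrak g}^{\lambda_j}\setminus\{0\}$ let $$n_l(X)=\#\{j\in\{m,\dots,k\}:\delta_j(X_j)\equiv e_l\bmod F^{*2}\}.$$ (1) Let $X=X_0+\dots+X_k$ and $X'=X'_0+\dots+X'_k$ with $X_j,X'_j\in\widetilde{\mathfrak g}^{\lambda_j}\setminus\{0\}$. The following are equivalent: (a) $X$ and $X'$ are in the same $G$-orbit; (b) $n_l(X)\equiv n_l(X')\bmod 2$ for $l=1,2,3$; (c) $X$ and $X'$ are in the same $G^0$-orbit. (2) The number of $G$-orbits in $V^+$ is $4(k+1)$; there are $3$ open orbits if $k=0$ and $4$ open orbits if $k\ge1$. (3) For $v\in\{1,\pi,u\pi\}$ fix a representative $X_0(v)\in\widetilde{\mathfrak g}^{\lambda_0}$ of $\{Y\in\widetilde{\mathfrak g}^{\lambda_0}:\delta_0(Y)\equiv v\bmod F^{*2}\}$ and, if $k\ge1$, put $X_j(v)=\gamma_{0,j}(X_0(v))$ for $j=1,\dots,k$. A set of representatives of the non-zero $G$-orbits in $V^+$ is $$X_0(1),\quad X_0(\pi),\quad X_0(u\pi),$$ and, if $k\ge1$, for $m\in\{0,\dots,k-1\}$, $$X_m(1)+\dots+X_{k-1}(1)+X_k(1),\quad X_m(1)+\dots+X_{k-1}(1)+X_k(\pi),\quad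 X_m(1)+\dots+X_{k-1}(1)+X_k(u\pi),$$ $$X_m(1)+\dots+X_{k-2}(1)+X_{k-1}(\pi)+X_k(u\pi)$$ (where for $m=k-1$ the last element is $X_{k-1}(\pi)+X_k(u\pi)$). For $k\ge1$ the $4$ open orbits are those of the preceding four elements with $m=0$; for $k=0$ the $3$ open orbits are those of $X_0(1),X_0(\pi),X_0(u\pi)$.
   Context: $F$ is a finite extension of $\mathbb Q_p$ whose residue field has characteristic $\ne 2$; $\pi$ is a uniformizer, $u$ a unit of $F$ which is not a square, so $\{1,u,\pi,u\pi\}$ represents $F^*/F^{*2}$; $E=F(\sqrt u)$ with conjugation $x\mapsto\bar x$; $\overline F$ is an algebraic closure. Realization. Let $J_\pi=\begin{pmatrix}0&\pi\\1&0\end{pmatrix}$, $J\in M(2(k+1),E)$ block diagonal with $k+1$ diagonal blocks $J_\pi$, $T=\begin{pmatrix}J&0\\0&{}^tJ\end{pmatrix}$, and $$\mathfrak{sp}(4(k+1),E)=\Big\{\begin{pmatrix}A&B\\C&-{}^tA\end{pmatrix}:A,B,C\in M(2(k+1),E),\ {}^tB=B,\ {}^tC=C\Big\}.$$ Then $\widetilde{\mathfrak g}=\{X\in\mathfrak{sp}(4(k+1),E):T\overline X=XT\}$ (a Lie algebra over $F$), graded by $H_0=\begin{pmatrix}I_{2(k+1)}&0\\0&-I_{2(k+1)}\end{pmatrix}$: $\widetilde{\mathfrak g}=V^-\oplus\mathfrak g\oplus V^+$ are the eigenspaces of $\operatorname{ad}H_0$ for $-2,0,2$; $V^+=\{\begin{pmatrix}0&B\\0&0\end{pmatrix}:{}^tB=B,\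 J\overline B=B\,{}^tJ\}$. Let $\mathbb S^+=\{M\in M(2,E):{}^tM=M,\ J_\pi\overline M=M\,{}^tJ_\pi\}=\{\begin{pmatrix}\pi\bar x&\mu\\\mu&x\end{pmatrix}:x\in E,\mu\in F\}$. For $M\in M(2,E)$ let $E_{j,j}(M)\in M(2(k+1),E)$ be the $2\times2$-block diagonal matrix whose $(k+1-j)$-th diagonal block is $M$ and whose other blocks are $0$. Then, for $j=0,\dots,k$, $\widetilde{\mathfrak g}^{\lambda_j}=\{\begin{pmatrix}0&E_{j,j}(M)\\0&0\end{pmatrix}:M\in\mathbb S^+\}\subset V^+$ (here $\ell=\dim_F\widetilde{\mathfrak g}^{\lambda_j}=3$), and $\delta_j$ is the quadratic form on $\widetilde{\mathfrak g}^{\lambda_j}$ given by $\delta_j\begin{pmatrix}0&E_{j,j}(M)\\0&0\end{pmatrix}=-\det M\in F$; on non-zero elements it takes exactly the classes of $1,\pi,u\pi$ modulo $F^{*2}$. $\gamma_{0,j}$ sends $\begin{pmatrix}0&E_{0,0}(M)\\0&0\end{pmatrix}$ to $\begin{pmatrix}0&E_{j,j}(M)\\0&0\end{pmatrix}$, $M\in\mathbb S^+$. Groups. $\mathrm{Aut}_0(\widetilde{\mathfrak g})$ is the group of automorphisms of $\widetilde{\mathfrak g}$ which become elementary (finite products of $e^{\operatorname{ad}x}$, $\operatorname{ad}x$ nilpotent) over $\overline F$; $G=\{g\in\mathrm{Aut}_0(\widetilde{\mathfrak g}):g.H_0=H_0\}$. $G^0\subset G$ is the subgroup of conjugations by the matrices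 $\begin{pmatrix}\mathbf g&0\\0&{}^t\mathbf g^{-1}\end{pmatrix}$ with $\mathbf g\in GL(2(k+1),E)$ and $J\overline{\mathbf g}=\mathbf gJ$. *)

(* Defs.v *)
From HB Require Import structures.
From mathcomp Require Import all_boot all_order all_algebra all_field.
From mathcomp Require Import boolp classical_sets functions cardinality.

Set Implicit Arguments.
Unset Strict Implicit.
Unset Printing Implicit Defensive.

Import Order.TTheory GRing.Theory Num.Theory.
Local Open Scope classical_set_scope.
Local Open Scope ring_scope.

(** * p-adic fields *)

Definition padic_norm (p : nat) (x : rat) : rat :=
  if x == 0 then 0
  else p%:Q ^ ((logn p `|denq x|%N)%:Z - (logn p `|numq x|%N)%:Z).

(* [Qp] with the absolute value [abs] is a completion of the rationals for the
   p-adic absolute value.  Such a completion is unique up to a unique isometric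
   isomorphism, and its absolute value takes the same values as [padic_norm p],
   whence the codomain [rat]. *)
Record is_Qp (p : nat) (Qp : fieldType) (abs : Qp -> rat) : Prop := IsQp {
  Qp_abs_ge0 : forall x, 0 <= abs x;
  Qp_abs_eq0 : forall x, abs x = 0 <-> x = 0;
  Qp_absM : forall x y, abs (x * y) = abs x * abs y;
  Qp_absD : forall x y, abs (x + y) <= Num.max (abs x) (abs y);
  Qp_abs_ratr : forall q : rat, abs (ratr q) = padic_norm p q;
  Qp_dense : forall x (eps : rat), 0 < eps ->
    exists q : rat, abs (x - ratr q) < eps;
  Qp_complete : forall s : nat -> Qp,
    (forall eps : rat, 0 < eps -> exists N, forall m n,
       (N <= m)%N -> (N <= n)%N -> abs (s m - s n) < eps) ->
    exists l, forall eps : rat, 0 < eps -> exists N, forall n,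
       (N <= n)%N -> abs (s n - l) < eps
}.

Section Integers.
Variables (Qp : fieldType) (abs : Qp -> rat) (F : fieldExtType Qp).

(* The ring of integers of F is the integral closure of
   Zp = {a in Qp | abs a <= 1} in F. *)
Definition integer (x : F) : Prop :=
  exists2 P : {poly Qp}, P \is monic /\ (forall i, abs P`_i <= 1) &
    root (map_poly (in_alg F) P) x.

Definition integer_unit (x : F) : Prop :=
  [/\ x != 0, integer x & integer x^-1].

Definition max_ideal (x : F) : Prop := integer x /\ ~ integer_unit x.

Definition uniformizer (pi : F) : Prop :=
  max_ideal pi /\
  forall x, max_ideal x -> exists2 y, integer y & x = pi * y.

(* [U] is an open subset of [W], for the topology carried by [W] as a
   finite-dimensional space over the valued field F: neighbourhoods are
   taken coordinatewise, the ideals pi^N O_F being a basis of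
   neighbourhoods of 0 in F. *)
Definition open_in (pi : F) (V : vectType F) (W : {vspace V}) (U : set V) :=
  U `<=` [set` W] /\
  forall X, U X -> exists N : nat, forall Y, Y \in W ->
    (forall i, exists2 y, integer y &
       coord (vbasis W) i (Y - X) = pi ^+ N * y) ->
    U Y.

End Integers.

Definition square_class (F : fieldType) (E : lalgType F) (d : E) (v : F) : Prop :=
  exists2 c : F, c != 0 & d = (v * c ^+ 2)%:A.

(** * Aut_0 of a Lie algebra *)

Section Aut0.
Variables (F : fieldType) (V : vectType F) (br : V -> V -> V) (L : {vspace V}).
Variables (K : fieldType) (iota : {rmorphism F -> K}).

(* Automorphisms of the Lie algebra (L, br) are represented by endomorphisms of
   the ambient space V; their values outside L are irrelevant. *)
Definition lie_aut (f : 'End(V)) : Prop :=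
  (f @: L)%VS = L /\ {in L &, forall x y, f (br x y) = br (f x) (f y)}.

(* The matrix, acting on row vectors, of the K-linear extension of f to the
   tensor product of L with K, in the basis deduced from [vbasis L]. *)
Definition ext_mx (f : V -> V) : 'M[K]_(\dim L) :=
  \matrix_(i, j) iota (coord (vbasis L) j (f (vbasis L)`_i)).

Definition ext_ad (x : 'rV[K]_(\dim L)) : 'M[K]_(\dim L) :=
  \sum_i x 0 i *: ext_mx (br (vbasis L)`_i).

Definition nilpotent_mx d (A : 'M[K]_d) : Prop := exists n, A ^+ n = 0.

(* The exponential of a nilpotent d x d matrix A: A ^+ d = 0. *)
Definition exp_mx d (A : 'M[K]_d) : 'M[K]_d :=
  \sum_(n < d.+1) (n`!%:R)^-1 *: A ^+ n.

Definition elementary (A : 'M[K]_(\dim L)) : Prop :=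
  exists2 s : seq 'rV[K]_(\dim L),
    (forall x, x \in s -> nilpotent_mx (ext_ad x)) &
    A = \prod_(x <- s) exp_mx (ext_ad x).

Definition Aut0 : set 'End(V) :=
  [set f | lie_aut f /\ elementary (ext_mx f)].

End Aut0.

Section Orbits.
Variables (F : fieldType) (V : vectType F) (H : set 'End(V)).

Definition orbit_of (X : V) : set V := [set f X | f in H].

Definition same_orbit (X Y : V) : Prop := orbit_of X Y.

Definition orbits (W : {vspace V}) : set (set V) :=
  [set orbit_of X | X in [set` W]].

(* The entries of the list [s] are representatives, without repetition, of the
   orbits contained in W and different from {0}. *)
Definition nonzero_orbit_reps (W : {vspace V}) (s : seq V) : Prop :=
  [/\ forall X, X \in s -> X \in W /\ X != 0,
      forall i j, (i < size s)%N -> (j < size s)%N ->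
        same_orbit s`_i s`_j -> i = j
    & forall X, X \in W -> X != 0 -> exists2 Y, Y \in s & same_orbit Y X].

End Orbits.

(** * Matrices over E as a vector space over F *)

(* 'M[E]_m is already equipped with its structure of vector space over E; the
   alias [rmx E m] carries the structure over F obtained by restriction. *)
Definition rmx (F : fieldType) (E : fieldExtType F) (m : nat) : Type := 'M[E]_m.

Section RestrictedMatrix.
Import VectorInternalTheory.
Variables (F : fieldType) (E : fieldExtType F) (m : nat).

HB.instance Definition _ := GRing.Zmodule.on (rmx E m).

Definition rmx_scale (a : F) (X : rmx E m) : rmx E m := a%:A *: (X : 'M[E]_m).

Fact rmx_scaleA a b X : rmx_scale a (rmx_scale b X) = rmx_scale (a * b) X.
Proof. by rewrite /rmx_scale scalerA mulr_algl scalerA. Qed.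
Fact rmx_scale1 : left_id 1 rmx_scale.
Proof. by move=> X; rewrite /rmx_scale scale1r scale1r. Qed.
Fact rmx_scaleDr : right_distributive rmx_scale +%R.
Proof. by move=> a X Y; rewrite /rmx_scale scalerDr. Qed.
Fact rmx_scaleDl X : {morph rmx_scale^~ X : a b / a + b}.
Proof. by move=> a b; rewrite /rmx_scale scalerDl scalerDl. Qed.

HB.instance Definition _ := GRing.Zmodule_isLmodule.Build F (rmx E m)
  rmx_scaleA rmx_scale1 rmx_scaleDr rmx_scaleDl.

Let entries : vectType F := {ffun 'I_m * 'I_m -> E}.

Fact rmx_vect : vector_axiom_def (dim entries) (rmx E m).
Proof.
pose h (X : rmx E m) : entries := [ffun ij => X ij.1 ij.2].
pose h' (f : entries) : rmx E m := \matrix_(i, j) f (i, j).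
have hK : cancel h h' by move=> X; apply/matrixP => i j; rewrite mxE ffunE.
have h'K : cancel h' h by move=> f; apply/ffunP => -[i j]; rewrite ffunE mxE.
exists (@v2r _ entries \o h).
  move=> a X Y /=; have -> : h (a *: X + Y) = a *: h X + h Y.
    by apply/ffunP => ij; rewrite !ffunE !mxE mulr_algl.
  by rewrite linearP.
exists (h' \o @r2v _ entries) => x /=.
  by rewrite v2rK hK.
by rewrite h'K r2vK.
Qed.

HB.instance Definition _ := Lmodule_hasFinDim.Build F (rmx E m) rmx_vect.

Lemma rmx_scaleE (a : F) (X : rmx E m) : a *: X = a%:A *: (X : 'M[E]_m).
Proof. by []. Qed.

Definition lie (X Y : rmx E m) : rmx E m := X *m Y - Y *m X.

Fact lie_is_linear X : linear (lie X).
Proof.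
move=> a Y Z; rewrite /lie rmx_scaleE mulmxDr mulmxDl -scalemxAr -scalemxAl.
by rewrite rmx_scaleE scalerBr opprD addrACA.
Qed.

HB.instance Definition _ X :=
  GRing.isLinear.Build F (rmx E m) (rmx E m) _ (lie X) (lie_is_linear X).

End RestrictedMatrix.

Section Realization.
Variables (F : fieldType) (E : fieldExtType F).
Variables (pi : F) (conj : {lrmorphism E -> E}) (k : nat).

(* 2(k+1), in the shape of a sum of k+1 block sizes *)
Notation n := (\sum_(i < k.+1) 2)%N.

Notation mx := (rmx E (n + n)).

Definition Jpi : 'M[E]_2 :=
  \matrix_(i, j) if (i == 0) && (j == 1) then pi%:A
                 else if (i == 1) && (j == 0) then 1 else 0.

Definition Jmx : 'M[E]_n := \mxdiag_(i < k.+1) Jpi.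

Definition Tmx : 'M[E]_(n + n) := block_mx Jmx 0 0 Jmx^T.

Definition sp_eqns (X : mx) : mx :=
  block_mx (drsubmx X + (ulsubmx X)^T) (ursubmx X - (ursubmx X)^T)
           (dlsubmx X - (dlsubmx X)^T) 0.

Definition descent_eqns (X : mx) : mx := Tmx *m map_mx conj X - X *m Tmx.

Fact sp_eqns_is_linear : linear sp_eqns.
Proof.
suff lin : linear (sp_eqns : 'M[E]_(n + n) -> 'M[E]_(n + n)).
  by move=> a X Y; apply: (lin a%:A X Y).
move=> a X Y; rewrite /sp_eqns scale_block_mx add_block_mx scaler0 addr0.
congr block_mx; apply/matrixP => i j; rewrite !mxE ?(mulrDr, mulrN) ?opprD;
  exact: addrACA.
Qed.

Fact descent_eqns_is_linear : linear descent_eqns.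
Proof.
move=> a X Y; rewrite /descent_eqns rmx_scaleE.
have -> : map_mx conj (a%:A *: (X : 'M_(n + n)) + Y)
          = a%:A *: map_mx conj X + map_mx conj Y.
  by apply/matrixP => i j; rewrite !mxE rmorphD rmorphM /= rmorph_alg.
rewrite mulmxDr mulmxDl -scalemxAr -scalemxAl opprD addrACA -scalerBr.
by rewrite rmx_scaleE.
Qed.

HB.instance Definition _ :=
  GRing.isLinear.Build F mx mx _ sp_eqns sp_eqns_is_linear.
HB.instance Definition _ :=
  GRing.isLinear.Build F mx mx _ descent_eqns descent_eqns_is_linear.

Definition sp : {vspace mx} := lker (linfun sp_eqns).

Lemma spP (X : mx) :
  reflect (exists A B C : 'M[E]_n,
             [/\ B^T = B, C^T = C & X = block_mx A B C (- A^T)]) (X \in sp).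
Proof.
rewrite memv_ker lfunE /=; apply: (iffP eqP) => [|[A [B [C [hB hC ->]]]]].
  rewrite /sp_eqns => /(@etrans _ _ _ (block_mx 0 0 0 0)).
  rewrite block_mx0 => /(_ erefl); rewrite -[RHS]block_mx0.
  case/eq_block_mx => /eqP + /eqP + /eqP + _.
  rewrite addr_eq0 !subr_eq0 => /eqP h1 /eqP h2 /eqP h3.
  exists (ulsubmx X), (ursubmx X), (dlsubmx X).
  by split; rewrite -?h1 ?submxK // -?h2 -?h3.
rewrite /sp_eqns block_mxKul block_mxKur block_mxKdl block_mxKdr hB hC !subrr.
by rewrite addNr block_mx0.
Qed.

Definition gt : {vspace mx} := (sp :&: lker (linfun descent_eqns))%VS.

Lemma gtP (X : mx) :
  reflect (X \in sp /\ Tmx *m map_mx conj X = X *m Tmx) (X \in gt).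
Proof.
rewrite memv_cap memv_ker lfunE /= /descent_eqns subr_eq0.
by apply: (iffP andP) => -[-> /eqP].
Qed.

Definition H0 : mx := block_mx 1%:M 0 0 (- 1%:M).

Definition Vplus : {vspace mx} :=
  (gt :&: passmx.leigenspace (linfun (lie H0)) 2)%VS.

Lemma VplusP (X : mx) :
  reflect (X \in gt /\ lie H0 X = 2 *: X) (X \in Vplus).
Proof.
have -> : (X \in Vplus) = (X \in gt) && (lie H0 X == 2 *: X).
  rewrite [LHS]memv_cap; congr (_ && _).
  rewrite memv_ker add_lfunE opp_lfunE scale_lfunE id_lfunE lfunE /=.
  by rewrite subr_eq0.
by apply: (iffP andP) => -[-> /eqP].
Qed.

Definition Splus : set 'M[E]_2 :=
  [set M | M^T = M /\ Jpi *m map_mx conj M = M *m Jpi^T].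

(* Counting from 0, the block of index [rev_ord j], that is k - j. *)
Definition Ediag (j : 'I_k.+1) (M : 'M[E]_2) : 'M[E]_n :=
  \mxdiag_(i < k.+1) (if i == rev_ord j then M else 0).

Definition emb (j : 'I_k.+1) (M : 'M[E]_2) : mx := block_mx 0 (Ediag j M) 0 0.

Definition coef (j : 'I_k.+1) (X : mx) : 'M[E]_2 :=
  submxblock (ursubmx X) (rev_ord j) (rev_ord j).

Lemma embK j : cancel (emb j) (coef j).
Proof. by move=> M; rewrite /coef block_mxKur submxblock_diag eqxx. Qed.

Definition glambda (j : 'I_k.+1) : set mx := [set emb j M | M in Splus].

(* The form takes its values in F, regarded here as a subfield of E. *)
Definition delta (j : 'I_k.+1) (X : mx) : E := - \det (coef j X).

Definition gamma0 (j : 'I_k.+1) (X : mx) : mx := emb j (coef ord0 X).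

Definition nl (m : nat) (v : F) (X : 'I_k.+1 -> mx) : nat :=
  #|[pred j : 'I_k.+1 | (m <= j)%N && `[< square_class (delta j (X j)) v >]]|.

Definition G (Fbar : fieldType) (iota : {rmorphism F -> Fbar}) : set 'End(mx) :=
  [set f | Aut0 (@lie F E (n + n)) gt iota f /\ f H0 = H0].

Definition G0 : set 'End(mx) :=
  [set f | exists g : 'M[E]_n,
    [/\ g \in unitmx, Jmx *m map_mx conj g = g *m Jmx
      & let P := block_mx g 0 0 (invmx g)^T in
        {in gt, forall X : mx, f X = P *m X *m invmx P :> 'M[E]_(n + n)}]].

(* The list of representatives built from X_0(1), X_0(pi), X_0(u pi), given
   as the three values of [X0]. *)
Section Representatives.
Variable X0 : 'I_3 -> mx.

Let X (j : 'I_k.+1) (l : 'I_3) : mx := gamma0 j (X0 l).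
Let l1 : 'I_3 := inord 0.
Let l2 : 'I_3 := inord 1.
Let l3 : 'I_3 := inord 2.

(* X_m(1) + ... + X_{k-1}(1) + X_k(l) *)
Definition rep_sum (m : nat) (l : 'I_3) : mx :=
  \sum_(j < k.+1 | (m <= j < k)%N) X j l1 + X ord_max l.

(* X_m(1) + ... + X_{k-2}(1) + X_{k-1}(pi) + X_k(u pi), used when k >= 1 *)
Definition rep_sum' (m : nat) : mx :=
  \sum_(j < k.+1 | (m <= j < k.-1)%N) X j l1
    + X (inord k.-1) l2 + X ord_max l3.

Definition reps_rank1 : seq mx := [:: X0 l1; X0 l2; X0 l3].

Definition reps_from (m : nat) : seq mx :=
  [:: rep_sum m l1; rep_sum m l2; rep_sum m l3; rep_sum' m].

Definition reps : seq mx :=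
  reps_rank1 ++ flatten [seq reps_from m | m <- iota 0 k].

Definition open_reps : seq mx :=
  if k == 0%N then reps_rank1 else reps_from 0.

End Representatives.

End Realization.

Arguments G {F E} pi conj k {Fbar} iota _.
Arguments G0 {F E} pi conj k _.

Definition sq_rep (F : fieldType) (pi u : F) (l : 'I_3) : F :=
  [:: 1; pi; u * pi]`_l.

(* Main.v *)
(* Write V^+ as the space of hermitian matrices B of size k + 1 with entries in a twisted form of
   the quaternion division algebra D = {g in M_2(E) : J_pi g-bar = g J_pi}; then G^0 acts by
   B |-> g B g^T with g in GL_(k+1)(D). Gram-Schmidt reduces B to a diagonal matrix with entries
   in S^+. Two non-zero elements of S^+ are conjugate under D^* if and only if their forms -det
   have the same square class, and since diag(M, -M) does not depend on M up to congruence, two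
   entries of the same class may be replaced by two entries of class 1. Hence the number of zero
   entries and the parities of n_2, n_3 determine the G^0-orbit.

   Conversely, ad-nilpotent elements of sp are nilpotent matrices, so an element of G is over
   F-bar the conjugation by a matrix diag(g, h). As it preserves the Lie algebra over F, g is
   proportional to a matrix over E, and by Hilbert 90 to an element of GL_(k+1)(D): G acts on V^+
   by B |-> e g B g^T with e in F^*. Such a transformation preserves the rank and, because the
   blocks have even size, the square class of the discriminant of the nondegenerate part, which
   gives back the parities. That G^0 is contained in G follows from the generation of GL_n by
   the elements 1 + e with e^2 = 0 and the diagonal matrices.

   An orbit is open if and only if its elements have full rank: 1 + pi O_F consists of squares, so
   the discriminant has a locally constant square class. *)
Require Import Defs.
From HB Require Import structures.
From mathcomp Require Import all_boot all_order all_algebra all_field.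
From mathcomp Require Import boolp classical_sets functions cardinality.
From mathcomp Require Import fingroup perm zify ring.

Set Implicit Arguments.
Unset Strict Implicit.
Unset Printing Implicit Defensive.

Import Order.TTheory GRing.Theory Num.Theory.

Local Open Scope ring_scope.

(** * Integers of F *)

(** The field F carries no valuation at the start: its integers are the integral closure of Zp, and
    pi generates the non-units. Finite dimension over Qp supplies the rest: a bounded ramification
    index, the form pi^z v of every nonzero element, finitely many residue classes, completeness.
    The outcome is condensed into [square_theory]; the classification uses this record and
    characteristic 0, and the topology of F returns only for the open orbits.

    On S^+ the form is m^2 - pi N(x), with N the norm of E over F. Norms have even valuation, so the
    two terms have valuations of different parity and one of them dominates: a nonzero value is a
    square or has odd valuation. This excludes the class of u and leaves 1, pi, u pi.

    An orbit is recorded by the number z of zero blocks and the parities of n_2 and n_3. For z < k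
    all four pairs of parities occur, for z = k they cannot both be odd, and z = k + 1 is the zero
    orbit: 4k + 3 + 1 orbits. *)

Section RationalPadic.
Variable p : nat.
Hypothesis hp : prime p.

Lemma padic_normE (q : rat) : q != 0 -> exists n : int, padic_norm p q = p%:Q ^ n.
Proof. by move=> q0; rewrite /padic_norm (negPf q0); eexists. Qed.

Lemma padic_norm_p : padic_norm p p%:R = p%:Q^-1.
Proof.
rewrite /padic_norm pnatr_eq0 eqn0Ngt prime_gt0 //=.
rewrite (_ : p%:R = (p%:Z)%:Q) // numq_int denq_int absz_nat logn1.
by rewrite -[p in logn p p]expn1 pfactorK // sub0r exprN1.
Qed.

Lemma padic_norm_nat_neq0 n : (0 < n)%N -> padic_norm p n%:R != 0.
Proof.
move=> n0; rewrite /padic_norm pnatr_eq0 eqn0Ngt n0 expfz_neq0 //.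
by rewrite intr_eq0 eqz_nat -lt0n prime_gt0.
Qed.

(** With q = a/b and p not dividing b, a Bezout relation c b + d p = 1 inverts b modulo p, and the
    residue is a c mod p. *)
Lemma padic_norm_residue (q : rat) : padic_norm p q <= 1 ->
  exists2 i : 'I_p, true & padic_norm p (q - (i : nat)%:R) < 1.
Proof.
have p1 : 1 < p%:Q by rewrite (_ : 1 = 1%:Q) // ltr_int ltz_nat prime_gt1.
have ple (m : int) : p%:Q ^ m <= 1 -> m <= 0.
  by rewrite -[1](expr0z p%:Q) ler_eXz2l.
have pow_lt1 (x : rat) (a b : int) : b != 0 -> x = a%:Q / b%:Q ->
    (p %| `|a|)%N -> ~~ (p %| `|b|)%N -> padic_norm p x < 1.
  move=> b0 xE pa pb; rewrite /padic_norm; case: eqP => [//|/eqP x0].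
  have nx0 : numq x != 0 by rewrite numq_eq0.
  have E : (numq x * b = a * denq x).
    apply: (@intr_inj rat); rewrite !intrM; apply: (mulIf (x:=(denq x)%:Q^-1)).
      by rewrite invr_eq0 intr_eq0 denq_neq0.
    rewrite mulfK ?intr_eq0 ?denq_neq0 // mulrAC divq_num_den xE divfK //.
    by rewrite intr_eq0.
  have := congr1 (fun z => logn p `|z|%N) E; rewrite /= !abszM.
  have a0 : a != 0.
    by apply: contra_neq x0 => a0; rewrite xE a0 mul0r.
  rewrite !lognM ?absz_gt0 ?denq_neq0 //.
  rewrite (@lognE p `|b|%N) hp absz_gt0 b0 (negPf pb) addn0 => E1.
  rewrite -(expr0z p%:Q) ltr_eXz2l // E1 subr_lt0 PoszD ltrDr ltz_nat.
  by rewrite logn_gt0 mem_primes hp absz_gt0 a0.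
move=> q1; pose a := numq q; pose b := denq q.
have b0 : b != 0 by apply: denq_neq0.
have pb : ~~ (p %| `|b|)%N.
  apply/negP => pb; have [q0|q0] := eqVneq q 0.
    by move: pb; rewrite /b q0 (denq_int 0) dvdn1 => /eqP E; move: hp; rewrite E.
  move: q1; rewrite /padic_norm (negPf q0) => /ple.
  have /coprimeP := coprime_num_den q.
  have -> : logn p `|numq q|%N = 0%N.
    apply/eqP; rewrite -leqn0 leqNgt logn_gt0 mem_primes hp absz_gt0 numq_eq0 q0 /=.
    apply/negP => pa; have : (p %| gcdn `|numq q| `|denq q|)%N by rewrite dvdn_gcd pa pb.
    rewrite (eqP (coprime_num_den q)) dvdn1 => /eqP E; move: hp; by rewrite E.
  rewrite subr0 => _; rewrite lez_nat leqn0 => /eqP E.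
  have : (0 < logn p `|b|)%N by rewrite logn_gt0 mem_primes hp pb absz_gt0 b0.
  by rewrite E.
have cop : coprimez b p.
  by rewrite /coprimez gcdzC /gcdz absz_nat; apply/eqP; congr Posz; apply/eqP;
    rewrite -/(coprime _ _) prime_coprime.
have [[c d] /= cd] := coprimezP _ _ cop.
have p0 : (p%:Z != 0) by rewrite eqz_nat -lt0n prime_gt0.
have hi : (`|(a * c) %% p|%Z < p)%N.
  by rewrite -ltz_nat gez0_abs ?modz_ge0 // ltz_mod.
exists (Ordinal hi) => //=.
pose r := ((a * c) %% p)%Z.
have -> : (`|r|%N)%:R = r%:Q :> rat.
  by rewrite -[r in RHS]gez0_abs ?modz_ge0.
apply: (@pow_lt1 _ (a - r * b) b) => //.
  by rewrite intrB intrM mulrBl divq_num_den mulfK ?intr_eq0.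
rewrite -[p]absz_nat -/(dvdz _ _).
have -> : a - r * b = a * (1 - c * b) + (a * c - r) * b by ring.
rewrite -cd; have -> : a * (c * b + d * p - c * b) = (a * d) * p by ring.
rewrite (_ : dvdz p _ = (a * d * p + (a * c - r) * b \in dvdz p)) //.
rewrite rpredD //; first exact: dvdz_mull.
by apply: dvdz_mulr; rewrite /r -eqz_mod_dvd modz_mod.
Qed.

End RationalPadic.

(** * The absolute value of Qp *)

Section Padic.
Variables (p : nat) (Qp : fieldType) (abs : Qp -> rat).
Hypotheses (hp : prime p) (hQp : is_Qp p abs).

Local Notation P := (p%:R : Qp).

Let p_gt1 : 1 < p%:Q.
Proof. by rewrite (_ : 1 = 1%:Q) // ltr_int ltz_nat prime_gt1. Qed.

Let pinv_gt0 : 0 < p%:Q^-1.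
Proof. by rewrite invr_gt0 (lt_trans ltr01). Qed.

Let pinv_lt1 : p%:Q^-1 < 1.
Proof. by rewrite invf_lt1 // (lt_trans ltr01). Qed.

Lemma Qp_abs0 : abs 0 = 0.
Proof. exact/(Qp_abs_eq0 hQp). Qed.

Lemma Qp_abs_neq0 x : x != 0 -> abs x != 0.
Proof. by apply: contra_neq => /(Qp_abs_eq0 hQp). Qed.

Lemma Qp_abs1 : abs 1 = 1.
Proof.
have := Qp_absM hQp 1 1; rewrite mulr1 -{1}[abs 1]mulr1.
by move/(mulfI (Qp_abs_neq0 (oner_neq0 _))).
Qed.

Lemma Qp_absX x n : abs (x ^+ n) = abs x ^+ n.
Proof.
by elim: n => [|n IH]; rewrite ?expr0 ?Qp_abs1 // !exprS (Qp_absM hQp) IH.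
Qed.

Lemma Qp_absN x : abs (- x) = abs x.
Proof.
have h : abs (-1) ^+ 2 = 1 by rewrite -Qp_absX sqrrN expr1n Qp_abs1.
have : abs (-1) = 1.
  by apply/eqP; rewrite -(@eqrXn2 _ 2) ?h ?expr1n // (Qp_abs_ge0 hQp).
by move=> h1; rewrite -mulN1r (Qp_absM hQp) h1 mul1r.
Qed.

Lemma Qp_absV x : abs x^-1 = (abs x)^-1.
Proof.
have [->|x0] := eqVneq x 0; first by rewrite invr0 Qp_abs0 invr0.
apply: (mulfI (Qp_abs_neq0 x0)); rewrite -(Qp_absM hQp) mulfV // Qp_abs1.
by rewrite mulfV // Qp_abs_neq0.
Qed.

Lemma Qp_abs_add_le (c : rat) x y : abs x <= c -> abs y <= c -> abs (x + y) <= c.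
Proof. by move=> hx hy; apply: le_trans (Qp_absD hQp x y) _; rewrite ge_max hx. Qed.

Lemma Qp_abs_sub_le (c : rat) x y : abs x <= c -> abs y <= c -> abs (x - y) <= c.
Proof. by move=> hx hy; apply: Qp_abs_add_le; rewrite ?Qp_absN. Qed.

Lemma Qp_abs_sum_le (c : rat) (I : Type) (r : seq I) (f : I -> Qp) :
  0 <= c -> (forall i, abs (f i) <= c) -> abs (\sum_(i <- r) f i) <= c.
Proof.
move=> c0 h; elim/big_ind: _ => [|x y|//]; first by rewrite Qp_abs0.
exact: Qp_abs_add_le.
Qed.

Lemma Qp_abs_le1_mul x y : abs x <= 1 -> abs y <= 1 -> abs (x * y) <= 1.
Proof. by move=> hx hy; rewrite (Qp_absM hQp) mulr_ile1 // (Qp_abs_ge0 hQp). Qed.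

Lemma Qp_natr_abs n : abs n%:R = padic_norm p n%:R.
Proof. by rewrite -(Qp_abs_ratr hQp) ratr_nat. Qed.

Lemma Qp_abs_p : abs P = p%:Q^-1.
Proof. by rewrite Qp_natr_abs padic_norm_p. Qed.

Lemma Qp_natr_neq0 n : (0 < n)%N -> n%:R != 0 :> Qp.
Proof.
move=> n0; apply/eqP => E; have := padic_norm_nat_neq0 hp n0.
by rewrite -Qp_natr_abs E Qp_abs0 eqxx.
Qed.

(** By the ultrametric inequality a rational closer to x than [abs x] has the same absolute value as
    x, so Qp has the value group of the rationals. *)
Lemma Qp_abs_val x : x != 0 -> exists n : int, abs x = p%:Q ^ n.
Proof.
move=> x0; have ax : 0 < abs x by rewrite lt_def Qp_abs_neq0 ?(Qp_abs_ge0 hQp).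
have [q hq] := Qp_dense hQp x ax.
have E : abs (ratr q) = abs x.
  apply/eqP; rewrite eq_le; apply/andP; split.
    have -> : ratr q = x - (x - ratr q) by rewrite subKr.
    by apply: Qp_abs_sub_le => //; apply: ltW.
  rewrite leNgt; apply/negP => h; have := lt_le_trans hq (lexx _).
  have: abs x < abs x; last by rewrite ltxx.
  rewrite -{1}(subrK (ratr q) x); apply: le_lt_trans (Qp_absD hQp _ _) _.
  by rewrite gt_max hq h.
rewrite -E (Qp_abs_ratr hQp); apply: padic_normE.
by apply: contraTneq hq => ->; rewrite (ratr_nat _ 0) subr0 ltxx.
Qed.

Lemma Qp_abs_lt1 x : abs x < 1 -> exists2 c, abs c <= 1 & x = P * c.
Proof.
have P0 : P != 0 by apply: Qp_natr_neq0; apply: prime_gt0.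
move=> hx; exists (x / P); last by rewrite mulrC divfK.
rewrite (Qp_absM hQp) Qp_absV Qp_abs_p invrK.
have [->|x0] := eqVneq x 0; first by rewrite Qp_abs0 mul0r.
have [n nE] := Qp_abs_val x0; move: hx; rewrite nE -[1 in X in X -> _](expr0z p%:Q).
have p0 : p%:Q != 0 by rewrite intr_eq0 eqz_nat -lt0n prime_gt0.
rewrite ltr_eXz2l // => n0; rewrite -{2}[p%:Q]expr1z -expfzDr // -(expr0z p%:Q).
by rewrite ler_eXz2l // -ltzD1 ltrD2r.
Qed.

(** [ratr] is a quotient of images of integers, so the identity is cleared of denominators; these
    stay nonzero in Qp because [abs] does not vanish on positive integers. *)
Lemma Qp_ratr_subn (q : rat) n : ratr (q - n%:R) = ratr q - n%:R :> Qp.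
Proof.
have d0 (x : rat) : (denq x)%:~R != 0 :> Qp.
  rewrite -[denq x]gez0_abs ?denq_ge0 //; apply: Qp_natr_neq0.
  by rewrite absz_gt0 denq_neq0.
have E : numq (q - n%:R) * denq q = (numq q - n%:R * denq q) * denq (q - n%:R).
  apply: (@intr_inj rat); rewrite !(intrM, intrB).
  have h x : (denq x)%:Q != 0 by rewrite intr_eq0 denq_neq0.
  apply: (mulIf (h q)); apply: (mulIf (invr_neq0 (h (q - n%:R)))).
  have N x : (numq x)%:Q = x * (denq x)%:Q.
    by rewrite -{2}[x]divq_num_den divfK.
  have -> : (n%:R : int)%:~R = n%:R :> rat by rewrite rmorph_nat.
  by rewrite !N; have := h (q - n%:R); move: (denq (q - _))%:Q => z z0; field.
rewrite /ratr; apply: (mulIf (d0 (q - n%:R))); apply: (mulIf (d0 q)).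
rewrite (divfK (d0 _)) -intrM E mulrAC [in RHS]mulrBl divfK // intrM intrB intrM.
by rewrite rmorph_nat.
Qed.

Lemma Qp_residue x : abs x <= 1 ->
  exists2 i : 'I_p, true & abs (x - (i : nat)%:R) < 1.
Proof.
move=> hx; have [q hq] := Qp_dense hQp x ltr01.
have aq : padic_norm p q <= 1.
  rewrite -(Qp_abs_ratr hQp); have -> : ratr q = x - (x - ratr q) by rewrite subKr.
  by apply: Qp_abs_sub_le => //; apply: ltW.
have [i _ hi] := padic_norm_residue hp aq; exists i => //.
have -> : x - (i : nat)%:R = (x - ratr q) + ratr (q - (i : nat)%:R).
  by rewrite Qp_ratr_subn addrA subrK.
apply: le_lt_trans (Qp_absD hQp _ _) _.
by rewrite gt_max hq (Qp_abs_ratr hQp).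
Qed.

Lemma Qp_small (a : Qp) (e : rat) : 0 < e -> exists N, forall n, (N <= n)%N ->
  abs (P ^+ n * a) < e.
Proof.
move=> e0.
(* Bernoulli's inequality gives p^n >= 1 + n (p - 1) >= n, and the rationals are archimedean. *)
have bern n (x : rat) : 1 <= x -> 1 + n%:R * (x - 1) <= x ^+ n.
  move=> x1; elim: n => [|n IH]; first by rewrite mul0r addr0 expr0.
  rewrite exprS; apply: le_trans (_ : x * (1 + n%:R * (x - 1)) <= _); last first.
    by rewrite ler_wpM2l // (le_trans ler01).
  rewrite -subr_ge0 (_ : _ - _ = n%:R * (x - 1) ^+ 2); last by rewrite -natr1; ring.
  by rewrite mulr_ge0 ?sqr_ge0.
have p2 : 1 <= p%:Q - 1 by rewrite lerBrDr (_ : 1 + 1 = 2%:Q) // ler_int lez_nat prime_gt1.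
have [N hN] : exists N : nat, abs a / e < N%:R.
  have h := archi_boundP (divr_ge0 (Qp_abs_ge0 hQp a) (ltW e0)).
  by eexists; exact: h.
exists N => n Nn; rewrite (Qp_absM hQp) Qp_absX Qp_abs_p exprVn mulrC.
rewrite ltr_pdivrMr ?exprn_gt0 ?(lt_trans ltr01) //.
rewrite mulrC -ltr_pdivrMr //; apply: lt_le_trans hN _.
apply: le_trans (bern n _ (ltW p_gt1)).
apply: (@le_trans _ _ (n%:R : rat)); first by rewrite ler_nat.
by rewrite ler_wpDl // ler_peMr.
Qed.

(** Convergence of p-adic series, with the remainder written as a multiple of p^n: this algebraic
    form carries over to F, which has no absolute value here. *)
Lemma Qp_p_expansion (c : nat -> Qp) : (forall m, abs (c m) <= 1) ->
  exists2 l, abs l <= 1 & forall n,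
    exists2 d, abs d <= 1 & l - \sum_(m < n) P ^+ m * c m = P ^+ n * d.
Proof.
move=> hc; pose s n := \sum_(m < n) P ^+ m * c m.
have P0 : P != 0 by apply: Qp_natr_neq0; apply: prime_gt0.
have absP n : 0 < abs (P ^+ n).
  by rewrite lt_def Qp_abs_neq0 ?expf_neq0 ?(Qp_abs_ge0 hQp).
have tail n k : abs (s (n + k)%N - s n) <= abs (P ^+ n).
  rewrite /s big_split_ord /= [X in X - _]addrC addrK; apply: Qp_abs_sum_le => [|i].
    exact: ltW.
  rewrite exprD -mulrA (Qp_absM hQp) ler_piMr ?(Qp_abs_ge0 hQp) //.
  rewrite Qp_abs_le1_mul //= Qp_absX exprn_ile1 ?(Qp_abs_ge0 hQp) //.
  by rewrite Qp_abs_p ltW.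
have [|l hl] := Qp_complete hQp (s := s).
  move=> e e0; have [N hN] := Qp_small 1 e0; exists N.
  suff H m n : (N <= m)%N -> (m <= n)%N -> abs (s n - s m) < e.
    move=> m n hm hn; case: (leqP m n) => h; last exact: H (ltnW h).
    by rewrite -Qp_absN opprB; apply: H.
  move=> hm hn; rewrite -(subnKC hn); apply: le_lt_trans (tail _ _) _.
  by have := hN m hm; rewrite mulr1.
have lim n : abs (l - s n) <= abs (P ^+ n).
  have [N hN] := hl _ (absP n); pose k := maxn n N.
  have -> : l - s n = (s k - s n) - (s k - l) by ring.
  apply: Qp_abs_sub_le; last by apply/ltW/hN; rewrite leq_maxr.
  by rewrite /k -(subnKC (leq_maxl n N)); apply: tail.
exists l; first by have := lim 0%N; rewrite /s big_ord0 subr0 expr0 Qp_abs1.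
move=> n; exists ((l - s n) / P ^+ n); last by rewrite mulrC divfK // expf_neq0.
by rewrite (Qp_absM hQp) Qp_absV ler_pdivrMr // mul1r.
Qed.

End Padic.

(** * The integral closure of Zp in F *)

Section IntegerRing.
Variables (p : nat) (Qp : fieldType) (abs : Qp -> rat).
Hypotheses (hp : prime p) (hQp : is_Qp p abs).
Variable F : fieldExtType Qp.

Definition Zp_pred : {pred Qp} := fun x => abs x <= 1.

Fact Zp_subring_closed : subring_closed Zp_pred.
Proof.
split; first by rewrite unfold_in /Zp_pred (Qp_abs1 hQp).
  by move=> x y; rewrite !unfold_in; apply: (Qp_abs_sub_le hQp).
by move=> x y; rewrite !unfold_in; apply: (Qp_abs_le1_mul hQp).
Qed.

HB.instance Definition _ :=
  GRing.isSubringClosed.Build Qp Zp_pred Zp_subring_closed.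

(** Zp as a ring type with its inclusion in Qp: the stability of integral elements under sums and
    products refers to a morphism from a ring. *)
Record padic_integer := PadicInteger {
  Zp_val : Qp; Zp_valP : Zp_val \in Zp_pred }.

HB.instance Definition _ := [isSub for Zp_val].
HB.instance Definition _ := [Choice of padic_integer by <:].
HB.instance Definition _ := [SubChoice_isSubComNzRing of padic_integer by <:].

Lemma integerE (x : F) :
  integer abs x <-> integralOver (in_alg F \o (val : padic_integer -> Qp)) x.
Proof.
have mapE (q : {poly padic_integer}) : map_poly (in_alg F \o val) q
    = map_poly (in_alg F) (map_poly (val : padic_integer -> Qp) q).
  by rewrite map_poly_comp.
split=> [[q [qm qc] qx]|[q qm qx]]; last first.
  exists (map_poly (val : padic_integer -> Qp) q); last by rewrite -mapE.
  split; first exact: monic_map.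
  by move=> i; rewrite coef_map; apply: Zp_valP.
pose r : {poly padic_integer} := \poly_(i < size q) insubd 0 q`_i.
have rq : map_poly val r = q.
  apply/polyP => i; rewrite coef_map coef_poly; case: ltnP => hi /=.
    by rewrite insubdK //; apply: qc.
  by rewrite nth_default.
exists r; last by rewrite mapE rq.
rewrite monicE; apply/eqP/val_inj; rewrite -lead_coef_map_inj ?rmorph1 //.
  by rewrite rq; apply/eqP.
Qed.

End IntegerRing.

Section Units.
Variables (Qp : fieldType) (abs : Qp -> rat) (F : fieldExtType Qp).
Implicit Type x : F.

Lemma unit_neq0 x : integer_unit abs x -> x != 0.
Proof. by case. Qed.

Lemma unit_integer x : integer_unit abs x -> integer abs x.
Proof. by case. Qed.

Lemma unitV x : integer_unit abs x -> integer_unit abs x^-1.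
Proof. by case=> x0 Ox Oxi; split; rewrite ?invr_eq0 ?invrK. Qed.

End Units.

Set Default Proof Using "All".

Section LocalField.
Variables (p : nat) (Qp : fieldType) (abs : Qp -> rat).
Hypotheses (hp : prime p) (hQp : is_Qp p abs).
Variable F : fieldExtType Qp.
Local Notation O := (@integer Qp abs F).
Local Notation unit := (@integer_unit Qp abs F).

Lemma integer_sub x y : O x -> O y -> O (x - y).
Proof. by rewrite !(integerE hQp); apply: integral_sub. Qed.

Lemma integer_add x y : O x -> O y -> O (x + y).
Proof. by rewrite !(integerE hQp); apply: integral_add. Qed.

Lemma integer_mul x y : O x -> O y -> O (x * y).
Proof. by rewrite !(integerE hQp); apply: integral_mul. Qed.

Lemma integer_opp x : O x -> O (- x).
Proof. by rewrite !(integerE hQp); apply: integral_opp. Qed.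

Lemma integer_nat n : O n%:R.
Proof. by rewrite !(integerE hQp); apply: integral_nat. Qed.

Lemma integer0 : O 0.
Proof. exact: (integer_nat 0). Qed.

Lemma integer1 : O 1.
Proof. exact: (integer_nat 1). Qed.

Lemma integerX x n : O x -> O (x ^+ n).
Proof.
move=> Ox; elim: n => [|n IH]; rewrite ?expr0 ?exprS; first exact: integer1.
exact: integer_mul.
Qed.

Lemma integer_sum (I : Type) (r : seq I) (Q : pred I) (f : I -> F) :
  (forall i, Q i -> O (f i)) -> O (\sum_(i <- r | Q i) f i).
Proof.
by move=> h; elim/big_ind: _ => //; [apply: integer0 | apply: integer_add].
Qed.

Lemma integer_scalar (a : Qp) : abs a <= 1 -> O a%:A.
Proof.
move=> ha; exists ('X - a%:P); last by rewrite rmorphB /= map_polyX map_polyC root_XsubC.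
split=> [|i]; first exact: monicXsubC.
rewrite coefB coefX coefC; apply: (Qp_abs_sub_le hQp); case: eqP => _ //=;
  by rewrite ?(Qp_abs1 hQp) ?(Qp_abs0 hQp).
Qed.

(** Zp is integrally closed in Qp: if [abs a] exceeded 1, the leading term of a monic equation would
    be larger than all the others. *)
Lemma scalar_integer (a : Qp) : O a%:A -> abs a <= 1.
Proof.
case=> q [qm qc] /rootP; rewrite -[a%:A]/(in_alg F a) horner_map.
move/eqP; rewrite fmorph_eq0 => /eqP; rewrite horner_coef.
have s0 : (0 < size q)%N by rewrite lt0n size_poly_eq0 monic_neq0.
rewrite -(prednK s0) big_ord_recr /=; move: (qm); rewrite monicE /lead_coef => /eqP ->.
rewrite mul1r => /eqP; rewrite addrC addr_eq0 => /eqP E.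
rewrite leNgt; apply/negP => a1.
have a0 : 0 < abs a by apply: lt_trans a1.
have : abs (a ^+ (size q).-1) < abs (a ^+ (size q).-1); last by rewrite ltxx.
case: (posnP (size q).-1) => [n0|n0].
  move: E; rewrite n0 big_ord0 expr0 oppr0 => /eqP; by rewrite oner_eq0.
rewrite {1}E (Qp_absN hQp) (Qp_absX hQp).
apply: (@le_lt_trans _ _ (abs a ^+ (size q).-1.-1)); last first.
  by rewrite -[in ltRHS](prednK n0) exprS ltr_pMl // exprn_gt0.
apply: (Qp_abs_sum_le hQp) => [|i]; first by rewrite exprn_ge0 // ltW.
rewrite (Qp_absM hQp) (Qp_absX hQp); apply: (@le_trans _ _ (abs a ^+ i)).
  by rewrite ler_piMl // exprn_ge0 // ltW.
by rewrite ler_weXn2l ?ltW // -ltnS prednK.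
Qed.

Lemma unitM x y : unit x -> unit y -> unit (x * y).
Proof.
case=> x0 Ox Oxi [y0 Oy Oyi]; split; first by rewrite mulf_neq0.
  exact: integer_mul.
by rewrite invfM; apply: integer_mul.
Qed.

Lemma unit1 : unit 1.
Proof. by split; rewrite ?oner_neq0 ?invr1 //; apply: integer1. Qed.

Lemma unitN x : unit x -> unit (- x).
Proof.
by case=> x0 Ox Oxi; split; rewrite ?oppr_eq0 ?invrN //; apply: integer_opp.
Qed.

Lemma unitX x n : unit x -> unit (x ^+ n).
Proof.
by move=> ux; elim: n => [|n IH]; rewrite ?expr0 ?exprS; [exact: unit1|exact: unitM].
Qed.

Lemma unit_divl x y : O x -> O y -> unit (x * y) -> unit x.
Proof.
move=> Ox Oy [xy0 _ Oi]; have [x0 y0] : x != 0 /\ y != 0.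
  by apply/andP; rewrite -negb_or -mulf_eq0.
split=> //; have -> : x^-1 = y * (x * y)^-1 by rewrite invfM mulrC -mulrA mulVf ?mulr1.
exact: integer_mul.
Qed.

Lemma scalar_unit (a : Qp) : abs a = 1 -> unit a%:A.
Proof.
move=> ha; split; last 1 first.
- rewrite -[a%:A]/(in_alg F a) -fmorphV; apply: integer_scalar.
  by rewrite (Qp_absV hQp) ha invr1.
- rewrite -[a%:A]/(in_alg F a) fmorph_eq0; apply/eqP => a0.
  by move: ha; rewrite a0 (Qp_abs0 hQp) => /eqP; rewrite eq_sym oner_eq0.
by apply: integer_scalar; rewrite ha.
Qed.

(** A linear relation over Qp is divided by its coefficient of largest absolute value. *)
Lemma integer_dependence r (a : 'I_r -> F) : (\dim {:F} < r)%N ->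
  exists c : 'I_r -> Qp, [/\ forall i, abs (c i) <= 1, exists i, c i = 1
    & \sum_i c i *: a i = 0].
Proof.
move=> hr; pose X := [tuple a i | i < r].
have /freeP nf : ~~ free X.
  apply/negP => /eqP E; have := dimvS (subvf <<X>>); rewrite E size_tuple.
  by rewrite leqNgt hr.
have [k [kE [i0 ki0]]] : exists k : 'I_r -> Qp,
    \sum_i k i *: a i = 0 /\ exists i, k i != 0.
  apply/not_existsP => H; apply: nf => k kE i; apply/eqP/negPn/negP => ki.
  apply: (H k); split; last by exists i.
  by rewrite -[RHS]kE; apply: eq_bigr => j _; rewrite -tnth_nth tnth_mktuple.
pose i1 := [arg max_(i > i0) abs (k i)]%O.
have hi1 i : abs (k i) <= abs (k i1).
  by rewrite /i1; case: arg_maxP => // j _; apply.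
have k1 : k i1 != 0.
  apply/eqP => E; have := hi1 i0; rewrite E (Qp_abs0 hQp) => h.
  have := Qp_abs_neq0 hQp ki0; have := Qp_abs_ge0 hQp (k i0).
  by rewrite le_eqVlt => /orP[/eqP <-|]; rewrite ?eqxx // ltNge h.
have ak : 0 < abs (k i1) by rewrite lt_def (Qp_abs_neq0 hQp) ?(Qp_abs_ge0 hQp).
exists (fun i => k i / k i1); split.
- by move=> i; rewrite (Qp_absM hQp) (Qp_absV hQp) ler_pdivrMr // mul1r.
- by exists i1; rewrite mulfV.
under eq_bigr => i _ do rewrite mulrC -scalerA.
by rewrite -scaler_sumr kE scaler0.
Qed.

(** If q is the minimal polynomial of x, of degree d, then p^m x is a root of the monic polynomial
    with coefficients p^(m(d-i)) q_i, which are integral for m large. *)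
Lemma integer_scale_p x : exists m, O (p%:R ^+ m * x).
Proof.
have /polyOver1P[q qE] := minPolyOver 1 x.
have qm : q \is monic.
  by have := monic_minPoly 1 x; rewrite qE map_monic.
have qx : root (map_poly (in_alg F) q) x by rewrite -qE root_minPoly.
have P0 : p%:R != 0 :> Qp by apply: (Qp_natr_neq0 hp hQp); apply: prime_gt0.
have [m hm] : exists m, forall i, (i < size q)%N -> abs (p%:R ^+ m * q`_i) <= 1.
  have H i := Qp_small hp hQp (q`_i) ltr01.
  have [N hN] := choice H.
  exists (\max_(i < size q) N i)%N => i hi; apply/ltW/hN.
  exact: (@leq_bigmax _ (fun i : 'I_(size q) => N i) (Ordinal hi)).
exists m; pose d := (size q).-1.
have sq : size q = d.+1 by rewrite /d prednK // lt0n size_poly_eq0 monic_neq0.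
pose r : {poly Qp} := \poly_(i < d.+1) (p%:R ^+ (m * (d - i)) * q`_i).
have rd : r`_d = 1.
  rewrite coef_poly ltnSn subnn muln0 expr0 mul1r.
  by move: qm; rewrite monicE /lead_coef => /eqP.
have sr : size r = d.+1.
  by apply: size_poly_eq; move: rd; rewrite coef_poly ltnSn => ->; apply: oner_neq0.
exists r.
  split; first by rewrite monicE /lead_coef sr rd.
  move=> i; rewrite coef_poly; case: ltnP => hi; last by rewrite (Qp_abs0 hQp).
  have [->|id] := eqVneq i d.
    rewrite subnn muln0 expr0 mul1r -[q`_d]/(q`_(size q).-1).
    by move: qm; rewrite monicE /lead_coef => /eqP ->; rewrite (Qp_abs1 hQp).
  have : (0 < d - i)%N by rewrite subn_gt0 ltn_neqAle id -ltnS.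
  case: (d - i)%N => // t _; rewrite mulnS addnC exprD -mulrA.
  apply: (Qp_abs_le1_mul hQp); last by apply: hm; rewrite sq.
  rewrite (Qp_absX hQp) exprn_ile1 ?(Qp_abs_ge0 hQp) // (Qp_abs_p hp hQp).
  by rewrite invf_le1 ?ltr0n ?prime_gt0 // (_ : 1 = 1%:Q) // ler_int lez_nat prime_gt0.
apply/rootP; rewrite horner_coef size_map_poly sr.
have -> : \sum_(i < d.+1) (map_poly (in_alg F) r)`_i * (p%:R ^+ m * x) ^+ i
        = p%:R ^+ (m * d) * (map_poly (in_alg F) q).[x].
  rewrite horner_coef size_map_poly sq mulr_sumr; apply: eq_bigr => i _.
  have cE (s : {poly Qp}) : (map_poly (in_alg F) s)`_i = in_alg F s`_i.
    exact: coef_map.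
  rewrite !cE coef_poly ltn_ord (rmorphM (in_alg F)) (rmorphXn (in_alg F)) (rmorph_nat (in_alg F)).
  have id : (i <= d)%N by rewrite -ltnS.
  have -> : (p%:R : F) ^+ (m * d) = p%:R ^+ (m * (d - i)) * p%:R ^+ (m * i).
    by rewrite -exprD -mulnDr subnK.
  by rewrite exprMn -exprM; ring.
by move/rootP: qx => ->; rewrite mulr0.
Qed.

End LocalField.

(** * The valuation defined by a uniformizer *)

Section Uniformizer.
Variables (p : nat) (Qp : fieldType) (abs : Qp -> rat).
Hypotheses (hp : prime p) (hQp : is_Qp p abs).
Variables (F : fieldExtType Qp) (pi : F).
Hypothesis hpi : uniformizer abs pi.
Local Notation O := (@integer Qp abs F).
Local Notation unit := (@integer_unit Qp abs F).
Local Notation pF := (p%:R : F).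

Let Oadd := @integer_add p Qp abs hp hQp F.
Let Omul := @integer_mul p Qp abs hp hQp F.
Let Oopp := @integer_opp p Qp abs hp hQp F.
Let Osub := @integer_sub p Qp abs hp hQp F.
Let Osum := @integer_sum p Qp abs hp hQp F.
Let OX := @integerX p Qp abs hp hQp F.

Lemma uniformizer_integer : O pi. Proof. by case: hpi => -[]. Qed.
Let Opi := uniformizer_integer.

Lemma uniformizer_not_unit : ~ unit pi. Proof. by case: hpi => -[]. Qed.

Lemma integer_unit_or x : O x -> unit x \/ exists2 y, O y & x = pi * y.
Proof.
move=> Ox; case: (pselect (unit x)) => [|nx]; [by left | right].
by case: hpi => _; apply.
Qed.

Lemma pi_mul_not_unit y : O y -> ~ unit (pi * y).
Proof. by move=> Oy /(unit_divl hp hQp Opi Oy)/uniformizer_not_unit. Qed.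

Lemma char0_natr_neq0 n : (0 < n)%N -> n%:R != 0 :> F.
Proof.
move=> n0; rewrite -(rmorph_nat (in_alg F)) fmorph_eq0.
exact: (Qp_natr_neq0 hp hQp).
Qed.

Let pF0 : pF != 0. Proof. exact/char0_natr_neq0/prime_gt0. Qed.

Let OpF : O pF. Proof. exact: (integer_nat hp hQp). Qed.

Lemma p_not_unit : ~ unit pF.
Proof.
case=> _ _; rewrite -(rmorph_nat (in_alg F)) -fmorphV => /(scalar_integer hp hQp).
rewrite (Qp_absV hQp) (Qp_abs_p hp hQp) invrK leNgt.
by rewrite (_ : 1 = 1%:Q) // ltr_int ltz_nat prime_gt1.
Qed.

Lemma uniformizer_neq0 : pi != 0.
Proof.
have [/p_not_unit//|[y _ E]] := integer_unit_or OpF.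
by apply: contra_neq pF0 => z; rewrite E z mul0r.
Qed.
Let pi0 := uniformizer_neq0.

Lemma small_scalar a : abs a < 1 -> exists2 y, O y & a%:A = pF * y :> F.
Proof.
move=> /(Qp_abs_lt1 hp hQp)[c hc ->]; exists c%:A; first exact: (integer_scalar hp hQp).
by rewrite -[_%:A]/(in_alg F _) rmorphM rmorph_nat.
Qed.

(** This bounds the ramification index. Take an integral relation between 1, pi, ..., pi^dim in
    which some coefficient has absolute value 1, and let i0 be the first index of that kind. Were p
    divisible by pi^(dim+1), the earlier coefficients, which are multiples of p, and the later
    powers of pi would make the unit c_i0 a multiple of pi. *)
Lemma pi_pow_ndvd_p y : O y -> pF <> pi ^+ (\dim {:F}).+1 * y.
Proof.
move=> Oy pE; set n := (\dim {:F}).+1 in pE.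
have [c [c1 [j cj] cE]] := @integer_dependence _ _ _ hp hQp F n (fun i => pi ^+ i) (ltnSn _).
have /asboolP aj : abs (c j) = 1 by rewrite cj (Qp_abs1 hQp).
case: (@arg_minnP _ j (fun i => `[< abs (c i) = 1 >]) (fun i => i : nat) aj).
move=> i0 /asboolP ci0 mini.
apply: (@pi_mul_not_unit (- pi ^- i0 * pi^-1 * \sum_(i | i != i0) c i *: pi ^+ i)).
  rewrite mulr_sumr; apply: Osum => i ii0.
  have [lt|] := ltnP i i0.
    have : abs (c i) < 1.
      rewrite lt_neqAle c1 andbT; apply/eqP => ci1.
      by have := mini i (asboolT ci1); rewrite leqNgt lt.
    move=> /small_scalar[z Oz zE]; rewrite -mulr_algl zE pE.
    have -> : - pi ^- i0 * pi^-1 * (pi ^+ n * y * z * pi ^+ i)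
        = - (pi ^+ (n - i0.+1) * y * z * pi ^+ i).
      have h : (i0.+1 <= n)%N by [].
      have -> : pi ^+ n = pi ^+ (n - i0.+1) * (pi ^+ i0 * pi).
        by rewrite -exprSr -exprD subnK.
      by field; rewrite pi0 expf_neq0.
    by apply: Oopp; do !apply: Omul => //; apply: OX.
  rewrite leq_eqVlt eq_sym [_ == _](negPf ii0) /= => lt.
  rewrite -(subnK lt) exprD exprSr -mulr_algl.
  have -> : - pi ^- i0 * pi^-1 * ((c i)%:A * (pi ^+ (i - i0.+1) * (pi ^+ i0 * pi)))
     = - ((c i)%:A * pi ^+ (i - i0.+1)).
    by field; rewrite pi0 expf_neq0.
  by apply/Oopp/Omul; [apply: (integer_scalar hp hQp) | apply: OX].
move/eqP: cE; rewrite (bigD1 i0) //= addrC addr_eq0 => /eqP ->.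
rewrite -mulr_algl.
have -> : pi * (- pi ^- i0 * pi^-1 * - ((c i0)%:A * pi ^+ i0)) = (c i0)%:A.
  by field; rewrite pi0 expf_neq0.
exact: (scalar_unit hp hQp).
Qed.

(** Division of p by pi is repeated until the quotient is a unit; [pi_pow_ndvd_p] forces this to
    happen. *)
Lemma p_ramification : exists2 e, (0 < e)%N & exists2 v, unit v & pF = pi ^+ e * v.
Proof.
have H n : (exists2 e, (0 < e)%N & exists2 v, unit v & pF = pi ^+ e * v)
    \/ exists2 y, O y & pF = pi ^+ n * y.
  elim: n => [|n [IH|[y Oy yE]]]; [right|by left|].
    by exists pF; rewrite ?expr0 ?mul1r.
  have [uy|[z Oz zE]] := integer_unit_or Oy; last first.
    by right; exists z; rewrite // yE zE exprSr mulrA.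
  left; exists n; last by exists y.
  by rewrite lt0n; apply/eqP => n0; apply: p_not_unit; rewrite yE n0 expr0 mul1r.
by have [//|[y Oy /(pi_pow_ndvd_p Oy)]] := H (\dim {:F}).+1.
Qed.

Lemma integer_dvd_pi_pow y z e v : O y -> O z -> unit v -> y * z = pi ^+ e * v ->
  exists j, exists2 w, unit w & y = pi ^+ j * w.
Proof.
elim: e y => [|e IH] y Oy Oz uv E.
  exists 0%N; exists y; last by rewrite mul1r.
  by apply: (unit_divl hp hQp Oy Oz); rewrite E mul1r.
have [uy|[y' Oy' yE]] := integer_unit_or Oy.
  by exists 0%N; exists y; rewrite ?mul1r.
have [||||j [w uw wE]] := IH y' => //.
  by apply: (mulfI pi0); rewrite mulrA -yE E exprS mulrA.
by exists j.+1; exists w; rewrite // yE wE exprS mulrA.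
Qed.

(** Suitable elements p^m x and p^m' (p^m x)^-1 are integral, and their product p^m' is a unit times
    a power of pi; an integral divisor of such an element has the same shape. *)
Lemma uniformizer_decomposition x : x != 0 ->
  exists z : int, exists2 v, unit v & x = pi ^ z * v.
Proof.
move=> x0; have [e e0 [v uv pE]] := p_ramification.
have [m Om] := integer_scale_p hp hQp x.
have [m' Om'] := integer_scale_p hp hQp (pF ^+ m * x)^-1.
have px0 : pF ^+ m * x != 0 by rewrite mulf_neq0 ?expf_neq0.
have [|j [w uw wE]] := integer_dvd_pi_pow (e := (e * m')%N) (v := v ^+ m') Om Om' (unitX hp hQp _
  uv).
  by rewrite mulrC mulfVK // pE exprMn exprM.
exists (j%:Z - (e * m)%:Z); exists (w * v ^- m).
  by apply: (unitM hp hQp uw); apply/unitV/(unitX hp hQp).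
have vm0 : v ^+ m != 0 by rewrite expf_neq0 // (unit_neq0 uv).
have pem0 : pi ^+ (e * m) != 0 by rewrite expf_neq0.
rewrite expfzDr // -invr_expz -!exprnP.
apply: (mulfI (expf_neq0 m pF0)); rewrite wE pE exprMn -exprM.
by field; rewrite vm0.
Qed.

Lemma pi_exp_unit (z : int) v : unit v -> unit (pi ^ z * v) -> z = 0.
Proof.
move=> uv uz; have {}uz : unit (pi ^ z).
  rewrite -[_ ^ _](mulfK (unit_neq0 uv)).
  by apply: (unitM hp hQp) => //; apply: unitV.
have npi n : ~ unit (pi ^+ n.+1).
  by rewrite exprS; apply: pi_mul_not_unit; apply: OX.
case: z uz => [[|n]|n] // uz; first by case: (npi n).
by case: (npi n); move/unitV: uz; rewrite NegzE -invr_expz invrK.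
Qed.

Lemma uniformizer_exp_inj (z z' : int) v v' : unit v -> unit v' ->
  pi ^ z * v = pi ^ z' * v' -> z = z'.
Proof.
move=> uv uv' E; apply/eqP; rewrite -subr_eq0; apply/eqP.
apply: (@pi_exp_unit _ (v / v')); first exact/(unitM hp hQp)/unitV.
rewrite expfzDr // -invr_expz; have pz0 : pi ^ z' != 0 by rewrite expfz_neq0.
have -> : pi ^ z / pi ^ z' * (v / v') = 1; last exact: (unit1 hp hQp).
have v0 := unit_neq0 uv'.
by rewrite mulrACA E -invfM mulfV // mulf_neq0.
Qed.

Lemma integer_pi_exp (z : int) v : unit v -> O (pi ^ z * v) -> 0 <= z.
Proof.
move=> uv; case: z => [//|n]; rewrite NegzE -invr_expz -exprnP => Oz.
case: uniformizer_not_unit.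
have v0 := unit_neq0 uv; have pn0 : pi ^+ n.+1 != 0 by rewrite expf_neq0.
apply: (unit_divl hp hQp Opi (y := pi ^+ n * (pi ^- n.+1 * v))).
  by apply: Omul => //; apply: OX.
rewrite mulrA -exprS mulrA mulfV // mul1r; exact: uv.
Qed.

Lemma integer_pi_infty y : (forall m, exists2 z, O z & y = pF ^+ m * z) -> y = 0.
Proof.
move=> H; apply/eqP/negPn/negP => y0.
have [z [v uv yE]] := uniformizer_decomposition y0.
have [e e0 [w uw pE]] := p_ramification.
(* Since p^m has valuation e m >= m, the exponent |z| + 1 exceeds the valuation z of y. *)
have [t Ot tE] := H `|z|.+1%N.
have : O (pi ^ (z - (e * `|z|.+1)%:Z) * v).
  rewrite expfzDr // mulrAC -yE tE pE exprMn -exprM -invr_expz -exprnP.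
  rewrite [X in O X](_ : _ = w ^+ `|z|.+1 * t).
    by apply: Omul => //; apply/OX/unit_integer.
  by field; rewrite expf_neq0.
move/integer_pi_exp => /(_ uv); rewrite subr_ge0 => h.
have := le_trans h (lez_abs z); rewrite lez_nat leqNgt => /negP; apply.
by rewrite leq_pmull.
Qed.

Lemma unit_add_pi v y : unit v -> O y -> unit (v + pi * y).
Proof.
move=> uv Oy; have Ov := unit_integer uv.
have [//|[z Oz E]] := integer_unit_or (Oadd Ov (Omul Opi Oy)).
case: (@pi_mul_not_unit (z - y)); first exact: Osub.
by rewrite mulrBr -E addrK.
Qed.

End Uniformizer.
(** * Completeness and Hensel's lemma *)

Section Completeness.
Variables (p : nat) (Qp : fieldType) (abs : Qp -> rat).
Hypotheses (hp : prime p) (hQp : is_Qp p abs).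
Variables (F : fieldExtType Qp) (pi : F).
Hypothesis hpi : uniformizer abs pi.
Local Notation O := (@integer Qp abs F).
Local Notation unit := (@integer_unit Qp abs F).
Local Notation pF := (p%:R : F).

Let Oadd := @integer_add p Qp abs hp hQp F.
Let Omul := @integer_mul p Qp abs hp hQp F.
Let Oopp := @integer_opp p Qp abs hp hQp F.
Let Osub := @integer_sub p Qp abs hp hQp F.
Let Osum := @integer_sum p Qp abs hp hQp F.
Let OX := @integerX p Qp abs hp hQp F.
Let Opi := uniformizer_integer hp hQp hpi.
Let OpF : O pF. Proof. exact: (integer_nat hp hQp). Qed.
Let pi0 := uniformizer_neq0 hp hQp hpi.
Let pF0 : pF != 0. Proof. exact/(char0_natr_neq0 hp hQp hpi)/prime_gt0. Qed.
Let Oscal (a : Qp) x : abs a <= 1 -> O x -> O (a *: x).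
Proof.
by move=> ha Ox; rewrite -mulr_algl; apply: Omul => //; apply: (integer_scalar hp hQp).
Qed.

Let pscale m (x : F) : (p%:R ^+ m : Qp) *: x = pF ^+ m * x.
Proof. by rewrite -mulr_algl -[_%:A]/(in_alg F _) rmorphXn rmorph_nat. Qed.

(** Linear independence over F_p of the images in O / pO, expressed with coefficients in Zp. *)
Definition indep_mod_p r (a : 'I_r -> F) := (forall i, O (a i)) /\
  forall c : 'I_r -> Qp, (forall i, abs (c i) <= 1) ->
  forall y, O y -> \sum_i c i *: a i = pF * y -> forall i, abs (c i) < 1.

Lemma indep_mod_p_dim r (a : 'I_r -> F) : indep_mod_p a -> (r <= \dim {:F})%N.
Proof.
move=> [_ ind]; rewrite leqNgt; apply/negP => /(integer_dependence hp hQp a).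
case=> c [c1 [i ci] cE]; have := ind c c1 0 (integer0 hp hQp F).
by rewrite mulr0 => /(_ cE i); rewrite ci (Qp_abs1 hQp) ltxx.
Qed.

Lemma Qp_family_expansion r (c : nat -> 'I_r -> Qp) : (forall m i, abs (c m i) <= 1) ->
  exists2 l : 'I_r -> Qp, (forall i, abs (l i) <= 1) & forall n,
    exists d : 'I_r -> Qp, forall i, abs (d i) <= 1 /\
      l i - \sum_(m < n) p%:R ^+ m * c m i = p%:R ^+ n * d i.
Proof.
move=> c1; have H i : exists li, abs li <= 1 /\ forall n, exists d, abs d <= 1 /\
    li - \sum_(m < n) p%:R ^+ m * c m i = p%:R ^+ n * d.
  have [li h1 h2] := Qp_p_expansion hp hQp (fun m => c1 m i).
  by exists li; split=> // n; have [d] := h2 n; exists d.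
have [l lE] := choice H; exists l => [i|n]; first by have [] := lE i.
have G i : exists d, abs d <= 1 /\
    l i - \sum_(m < n) p%:R ^+ m * c m i = p%:R ^+ n * d.
  by have [_] := lE i; apply.
by have [d dE] := choice G; exists d.
Qed.

(* Take a of maximal size among the families that are independent modulo p. *)
Lemma integer_span_mod_p : exists r (a : 'I_r -> F), (forall i, O (a i)) /\
  forall x, O x -> exists (c : 'I_r -> Qp) y, [/\ forall i, abs (c i) <= 1, O y
    & x = \sum_i c i *: a i + pF * y].
Proof.
pose Q r := `[< exists a : 'I_r -> F, indep_mod_p a >].
have exQ : exists r, Q r.
  by exists 0%N; apply/asboolP; exists (fun=> 0); split=> [[]//|c _ y _ _ []].
have ubQ r : Q r -> (r <= \dim {:F})%N by move=> /asboolP[a /indep_mod_p_dim].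
case: (ex_maxnP exQ ubQ) => r /asboolP[a [Oa ind]] maxr; exists r, a; split=> // x Ox.
pose a' (i : 'I_r.+1) := if unlift ord_max i is Some j then a j else x.
have a'x : a' ord_max = x by rewrite /a' unlift_none.
have a'w j : a' (widen_ord (leqnSn r) j) = a j.
  have -> : widen_ord (leqnSn r) j = lift ord_max j.
    by apply: val_inj; rewrite /= /bump leqNgt ltn_ord.
  by rewrite /a' liftK.
have nind : ~ indep_mod_p a'.
  move=> h; have : Q r.+1 by apply/asboolP; exists a'.
  by move/maxr; rewrite ltnn.
have Oa' i : O (a' i) by rewrite /a'; case: unliftP => [j _|_] //; apply: Oa.
have [c [c1 [y [Oy [cE [i ci]]]]]] : exists c : 'I_r.+1 -> Qp, (forall i, abs (c i) <= 1)
    /\ exists y, O y /\ \sum_i c i *: a' i = pF * y /\ exists i, ~ abs (c i) < 1.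
  apply: contrapT => H; apply: nind; split=> // c c1 y Oy cE i.
  by apply: contrapT => ci; apply: H; exists c; split=> //; exists y; split=> //; split=> //;
    exists i.
move: cE; rewrite big_ord_recr /= a'x; under eq_bigr => j _ do rewrite a'w.
move=> cE; have cm : abs (c ord_max) = 1.
  apply/eqP; rewrite eq_le c1 leNgt /=; apply/negP => lt.
  have [z Oz zE] := small_scalar hp hQp hpi lt.
  have h : \sum_(i < r) c (widen_ord (leqnSn r) i) *: a i = pF * (y - z * x).
    by rewrite mulrBr -cE mulrA -zE mulr_algl addrK.
  have {}h := ind _ (fun i => c1 _) _ (Osub Oy (Omul Oz Ox)) h.
  apply: ci; case: (unliftP ord_max i) => [j|] -> //.
  have := h j; have <- // : widen_ord (leqnSn r) j = lift ord_max j.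
  by apply: val_inj; rewrite /= /bump leqNgt ltn_ord.
have cm0 : c ord_max != 0.
  by apply/eqP => E; move: cm; rewrite E (Qp_abs0 hQp) => /eqP; rewrite eq_sym oner_eq0.
have cmi : abs (c ord_max)^-1 <= 1 by rewrite (Qp_absV hQp) cm invr1.
exists (fun i => - (c ord_max)^-1 * c (widen_ord (leqnSn r) i)), ((c ord_max)^-1 *: y).
split.
- by move=> j; apply: (Qp_abs_le1_mul hQp) => //; rewrite (Qp_absN hQp).
- exact: Oscal.
rewrite -scalerAr -cE scalerDr scalerA mulVf // scale1r addrA.
rewrite scaler_sumr -big_split /= big1 ?add0r // => j _.
by rewrite scalerA -scalerDl mulNr addNr scale0r.
Qed.

(** Generators modulo p generate O over Zp: the decomposition is iterated on the remainders, the
    coefficients add up to p-adic series, and the final error is divisible by every p^m. *)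
Lemma integer_span : exists r (a : 'I_r -> F), (forall i, O (a i)) /\
  forall x, O x -> exists2 c : 'I_r -> Qp, (forall i, abs (c i) <= 1) &
    x = \sum_i c i *: a i.
Proof.
have [r [a [Oa sp]]] := integer_span_mod_p; exists r, a; split=> // x Ox.
have [f fE] : exists f : F -> ('I_r -> Qp) * F, forall x, O x ->
    [/\ forall i, abs ((f x).1 i) <= 1, O (f x).2
      & x = \sum_i (f x).1 i *: a i + pF * (f x).2].
  have H z : exists cy : ('I_r -> Qp) * F, O z -> [/\ forall i, abs (cy.1 i) <= 1, O cy.2
      & z = \sum_i cy.1 i *: a i + pF * cy.2].
    case: (pselect (O z)) => [/sp[c [y h]]|nz]; first by exists (c, y).
    by exists (fun=> 0, 0).
  by have [f fE] := choice H; exists f.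
pose s := fix s m := if m is m'.+1 then (f (s m')).2 else x.
have Os m : O (s m) by elim: m => [|m IH] //=; have [] := fE _ IH.
have part m : x = \sum_i (\sum_(k < m) p%:R ^+ k * (f (s k)).1 i) *: a i + pF ^+ m * s m.
  elim: m => [|m IH].
    by rewrite mul1r big1 ?add0r // => i _; rewrite big_ord0 scale0r.
  rewrite [LHS]IH; have [_ _ {1}->] := fE _ (Os m).
  rewrite mulrDr addrA; congr (_ + _); last by rewrite exprSr mulrA.
  rewrite mulr_sumr -big_split; apply: eq_bigr => i _ /=.
  rewrite big_ord_recr /= scalerDl; congr (_ + _).
  by rewrite -scalerA pscale.
have c1 m i : abs ((f (s m)).1 i) <= 1 by have [] := fE _ (Os m).
have [l l1 lE] := Qp_family_expansion c1.
exists l => //.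
apply/eqP; rewrite -subr_eq0; apply/eqP.
apply: (integer_pi_infty hp hQp hpi) => m.
have [d dE] := lE m.
exists (s m - \sum_i d i *: a i).
  by apply: Osub => //; apply: Osum => i _; apply: Oscal; have [] := dE i.
rewrite {1}[x](part m) addrAC mulrBr addrC; congr (_ + _).
rewrite -sumrB mulr_sumr -sumrN; apply: eq_bigr => i _.
rewrite -scalerBl -[LHS]opprK -scaleNr opprB; have [_ ->] := dE i.
by rewrite -scalerA pscale.
Qed.

(** Completeness of Zp is applied to the coefficients of the terms on finitely many generators of
    O. *)
Lemma integer_complete (y : nat -> F) : (forall m, O (y m)) ->
  exists2 x, O x & forall n, exists2 z, O z & x - \sum_(m < n) pF ^+ m * y m = pF ^+ n * z.
Proof.
move=> Oy; have [r [a [Oa sp]]] := integer_span.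
have H m : exists cm : 'I_r -> Qp, (forall i, abs (cm i) <= 1) /\
    y m = \sum_i cm i *: a i.
  by have [cm h1 h2] := sp _ (Oy m); exists cm.
have [c cE] := choice H.
have [l l1 lE] := Qp_family_expansion (fun m => proj1 (cE m)).
exists (\sum_i l i *: a i).
  by apply: Osum => i _; apply: Oscal.
move=> n; have [d dE] := lE n.
exists (\sum_i d i *: a i).
  by apply: Osum => i _; apply: Oscal; have [] := dE i.
have -> : \sum_(m < n) pF ^+ m * y m = \sum_i (\sum_(m < n) p%:R ^+ m * c m i) *: a i.
  under [RHS]eq_bigr => i _ do rewrite scaler_suml.
  rewrite exchange_big; apply: eq_bigr => m _ /=; have [_ ->] := cE m.
  rewrite mulr_sumr; apply: eq_bigr => i _.
  by rewrite -scalerA pscale.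
rewrite -sumrB mulr_sumr; apply: eq_bigr => i _.
rewrite -scalerBl; have [_ ->] := dE i.
by rewrite -scalerA pscale.
Qed.

Hypothesis unit2 : unit 2.

Lemma hensel_sqrt v a y : unit a -> O y -> v = a ^+ 2 + pi * y ->
  exists c, v = c ^+ 2.
Proof.
move=> ua Oy vE; have [e e0 [w uw pE]] := p_ramification hp hQp hpi.
have w0 := unit_neq0 uw.
(* Newton's iteration for the square root of v. A linear gain of precision, b_m^2 - v in pi^(m+1) O,
   is enough below. *)
pose newton b := b - (b ^+ 2 - v) / (2 * b).
pose b := fix b m := if m is m'.+1 then newton (b m') else a.
have bP m : unit (b m) /\ exists2 t, O t & b m ^+ 2 - v = pi ^+ m.+1 * t.
  elim: m => [|m [ub [t Ot tE]]] /=.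
    by split=> //; exists (- y); rewrite ?vE; [exact: Oopp | ring].
  have u2b : unit (2 * b m) by apply: (unitM hp hQp).
  have b0 := unit_neq0 ub; have t0 := unit_neq0 unit2.
  have Oq : O (t / (2 * b m)) by apply: Omul => //; apply/unit_integer/unitV.
  split.
    have -> : newton (b m) = b m + pi * - (pi ^+ m * (t / (2 * b m))).
      by rewrite /newton tE exprS; ring.
    by apply: (unit_add_pi hp hQp hpi) => //; apply/Oopp/Omul => //; apply: OX.
  exists (pi ^+ m * (t / (2 * b m)) ^+ 2).
    by apply: Omul; apply: OX.
  have -> : newton (b m) ^+ 2 - v = ((b m ^+ 2 - v) / (2 * b m)) ^+ 2.
    by rewrite /newton; field; rewrite b0.
  by rewrite tE !exprS; ring.
have diff m k : exists2 t, O t & b (m + k)%N - b m = pi ^+ m * t.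
  elim: k => [|k [t Ot tE]].
    by exists 0; rewrite ?addn0 ?subrr ?mulr0 //; apply: (integer0 hp hQp).
  have [ub [s Os sE]] := bP (m + k)%N.
  exists (t - pi ^+ k.+1 * s / (2 * b (m + k)%N)).
    apply: Osub => //; rewrite -mulrA; apply: Omul; first exact: OX.
    by apply: Omul => //; apply/unit_integer/unitV/(unitM hp hQp).
  rewrite addnS /= /newton sE -addnS exprD mulrBr -tE.
  by ring.
(* As p is pi^e up to a unit, the terms of index e m are the partial sums of a series in powers of
   p, to which [integer_complete] applies. *)
have H m : exists dm, O dm /\ b (e * m.+1)%N - b (e * m)%N = pF ^+ m * dm.
  have [t Ot tE] := diff (e * m)%N e; exists (t / w ^+ m); split.
    by apply: Omul => //; apply/unit_integer/unitV/(unitX hp hQp).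
  rewrite mulnS addnC tE pE exprMn -exprM mulrA mulrAC; field.
  by rewrite expf_neq0.
have [d dP] := choice H.
have [x Ox xE] := integer_complete (fun m => proj1 (dP m)).
exists (a + x).
have tel n : \sum_(m < n) pF ^+ m * d m = b (e * n)%N - a.
  elim: n => [|n IH]; first by rewrite big_ord0 muln0 subrr.
  by rewrite big_ord_recr /= IH -(proj2 (dP n)) addrC addrA subrK.
apply/esym/eqP; rewrite -subr_eq0; apply/eqP.
apply: (integer_pi_infty hp hQp hpi) => n.
have [z Oz zE] := xE n; move: zE; rewrite tel => zE.
have [ub [t Ot tE]] := bP (e * n)%N.
have Oax : O (a + x) by apply: Oadd => //; apply: unit_integer.
exists (z * (a + x + b (e * n)%N) + w ^- n * pi * t).
  apply: Oadd.
    by apply: Omul => //; apply: Oadd => //; apply: unit_integer.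
  do !apply: Omul => //; exact/unit_integer/unitV/(unitX hp hQp).
have axE : a + x = b (e * n)%N + pF ^+ n * z by rewrite -zE; ring.
rewrite axE.
have -> : (b (e * n)%N + pF ^+ n * z) ^+ 2 - v
   = (b (e * n)%N ^+ 2 - v) + pF ^+ n * (z * (b (e * n)%N + pF ^+ n * z + b (e * n)%N)).
  by ring.
rewrite tE [RHS]mulrDr [RHS]addrC; congr (_ + _).
rewrite pE exprMn -exprM exprSr; field.
by rewrite expf_neq0.
Qed.

End Completeness.

(** * The finite residue field and the squares of units *)

Lemma card_fibers_le2 (T T' : finType) (f : T -> T') (A : {set T}) :
  (forall x, x \in A -> exists y, forall z, z \in A -> f z = f x -> z \in [set x; y]) ->
  (#|A| <= 2 * #|f @: A|)%N.
Proof.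
move=> H; rewrite -sum1_card (partition_big_imset f) /= mulnC -sum_nat_const.
apply: leq_sum => t /imsetP[x xA ->]; have [y hy] := H x xA.
rewrite sum1_card; apply: (@leq_trans #|[set x; y]|); last by rewrite cards2; case: eqP.
by apply/subset_leq_card/fintype.subsetP => z /andP[zA /eqP]; apply: hy.
Qed.

Section Residue.
Variables (p : nat) (Qp : fieldType) (abs : Qp -> rat).
Hypotheses (hp : prime p) (hQp : is_Qp p abs).
Variables (F : fieldExtType Qp) (pi : F).
Hypothesis hpi : uniformizer abs pi.
Local Notation O := (@integer Qp abs F).
Local Notation unit := (@integer_unit Qp abs F).
Local Notation pF := (p%:R : F).

Let Oadd := @integer_add p Qp abs hp hQp F.
Let Omul := @integer_mul p Qp abs hp hQp F.
Let Oopp := @integer_opp p Qp abs hp hQp F.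
Let Osub := @integer_sub p Qp abs hp hQp F.
Let Osum := @integer_sum p Qp abs hp hQp F.
Let OX := @integerX p Qp abs hp hQp F.
Let Opi := uniformizer_integer hp hQp hpi.
Let O0 := integer0 hp hQp F.
Let pi0 := uniformizer_neq0 hp hQp hpi.

Definition cong (x y : F) := exists2 z, O z & x - y = pi * z.

Lemma cong_refl x : cong x x.
Proof. by exists 0; rewrite ?subrr ?mulr0. Qed.

Lemma cong_sym x y : cong x y -> cong y x.
Proof.
by case=> z Oz E; exists (- z); [exact: Oopp | rewrite mulrN -E opprB].
Qed.

Lemma cong_trans y x z : cong x y -> cong y z -> cong x z.
Proof.
case=> s Os sE [t Ot tE]; exists (s + t); first exact: Oadd.
by rewrite mulrDr -sE -tE addrA subrK.
Qed.

Lemma cong_add x y x' y' : cong x y -> cong x' y' -> cong (x + x') (y + y').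
Proof.
case=> s Os sE [t Ot tE]; exists (s + t); first exact: Oadd.
by rewrite mulrDr -sE -tE; ring.
Qed.

Lemma cong_mul x y x' y' : O x -> O y' -> cong x y -> cong x' y' ->
  cong (x * x') (y * y').
Proof.
move=> Ox Oy' [s Os sE] [t Ot tE]; exists (x * t + s * y').
  by apply: Oadd; apply: Omul.
have -> : x * x' - y * y' = x * (x' - y') + (x - y) * y' by ring.
by rewrite sE tE; ring.
Qed.

Lemma unit_ncong0 x : O x -> unit x <-> ~ cong x 0.
Proof.
move=> Ox; split=> [ux [z Oz]|nx].
  rewrite subr0 => xE; apply: (pi_mul_not_unit hp hQp hpi Oz).
  by rewrite -xE.
have [//|[z Oz zE]] := integer_unit_or hp hQp hpi Ox.
by case: nx; exists z; rewrite ?subr0.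
Qed.

Lemma cong_mul0 x y : O x -> O y -> cong (x * y) 0 -> cong x 0 \/ cong y 0.
Proof.
move=> Ox Oy xy; apply: contrapT => /not_orP[nx ny].
have ux := (unit_ncong0 Ox).2 nx; have uy := (unit_ncong0 Oy).2 ny.
exact: ((unit_ncong0 (Omul Ox Oy)).1 (unitM hp hQp ux uy) xy).
Qed.

(** Finiteness of the residue field, encoded by a map to a finite type rather than by a quotient
    ring. Modulo pi every integer is a combination of the generators with digits below p; [cls]
    picks one such combination, and [None] can occur only outside O. *)
Lemma residue_classes : exists (T : finType) (cls : F -> T),
  forall x y, O x -> O y -> (cls x = cls y <-> cong x y).
Proof.
have [r [a [Oa sp]]] := integer_span hp hQp hpi.
pose T := {ffun 'I_r -> 'I_p}.
pose v (t : T) : F := \sum_i (t i : nat)%:R * a i.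
have cong_p x z : O z -> x = p%:R * z -> cong x 0.
  have [e e0 [w uw pE]] := p_ramification hp hQp hpi.
  move=> Oz ->; exists (pi ^+ e.-1 * w * z).
    by apply: Omul => //; apply: Omul; [exact: OX | exact: unit_integer].
  by rewrite subr0 pE -{1}(prednK e0) exprS; ring.
have ex x : O x -> exists t, cong x (v t).
  move=> /sp[c c1 ->]; have H i : exists t : 'I_p, abs (c i - (t : nat)%:R) < 1.
    by have [t _ ht] := Qp_residue hp hQp (c1 i); exists t.
  have [t tE] := choice H; exists (finfun t); rewrite /v.
  elim/big_ind2: _ => [|*|i _]; [exact: cong_refl | exact: cong_add|].
  have [y Oy yE] := small_scalar hp hQp hpi (tE i).
  have : cong (c i *: a i - (t i : nat)%:R * a i) 0.
    apply: (@cong_p _ (y * a i)); first exact: Omul.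
    rewrite mulrA -yE mulr_algl scalerBl; congr (_ - _).
    by rewrite -mulr_algl -[_%:A]/(in_alg F _) rmorph_nat.
  by case=> z Oz zE; exists z => //; move: zE; rewrite subr0 ffunE.
pose Q x t := `[< cong x (v t) >].
exists (option T), (fun x => [pick t | Q x t]) => x y Ox Oy; split=> [|xy].
  case: pickP => [t /asboolP ht|hx]; last first.
    by have [t ht] := ex x Ox; move: (hx t); rewrite /Q asboolT.
  case: pickP => [t' /asboolP ht' [E]|//].
  by apply: cong_trans ht _; apply: cong_sym; rewrite E.
apply: eq_pick => t; apply/asboolP/asboolP => h.
  by apply: cong_trans h; apply: cong_sym.
exact: cong_trans h.
Qed.

Hypothesis unit2 : unit 2.

Lemma hensel_cong v a : unit v -> O a -> cong v (a ^+ 2) -> exists c, v = c ^+ 2.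
Proof.
move=> uv Oa [y Oy vE]; have ua : unit a.
  apply/(unit_ncong0 Oa) => a0.
  have := (unit_ncong0 (unit_integer uv)).1 uv; apply.
  apply: (@cong_trans (a ^+ 2)); first by exists y.
  by rewrite -[X in cong _ X](mulr0 0) expr2; apply: cong_mul.
apply: (hensel_sqrt hp hQp hpi unit2 ua Oy).
by rewrite -vE addrC subrK.
Qed.

Variable u : F.
Hypotheses (hu : unit u) (hu2 : forall x, x ^+ 2 != u).

(* Squaring has fibres of order at most 2 on the unit residue classes, so that squares and
   u times squares exhaust them. *)
Lemma unit_square_or v : unit v -> exists c, v = c ^+ 2 \/ v = u * c ^+ 2.
Proof.
move=> uv; have [T [cls clsE]] := residue_classes.
pose A := [set c : T | `[< exists2 x, unit x & cls x = c >]].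
have [r rE] : exists r : T -> F, forall c, c \in A -> unit (r c) /\ cls (r c) = c.
  have H c : exists x, c \in A -> unit x /\ cls x = c.
    case: (boolP (c \in A)) => [|_]; last by exists 0.
    by rewrite inE => /asboolP[x ux xE]; exists x.
  by have [r rE] := choice H; exists r.
have rU c : c \in A -> unit (r c) by case/rE.
have rO c : c \in A -> O (r c) by move=> /rU/unit_integer.
have clsA x : unit x -> cls x \in A by move=> ux; rewrite inE; apply/asboolP; exists x.
have cls_cong x y : unit x -> unit y -> cls x = cls y -> cong x y.
  by move=> ux uy; apply: (clsE _ _ (unit_integer ux) (unit_integer uy)).1.
pose f w c := cls (w * r c ^+ 2).
have fU w c : unit w -> c \in A -> unit (w * r c ^+ 2).
  by move=> uw cA; apply: (unitM hp hQp) => //; apply: (unitX hp hQp); apply: rU.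
have card_f w : unit w -> (#|A| <= 2 * #|f w @: A|)%N.
  move=> uw; apply: card_fibers_le2 => c cA.
  exists (cls (- r c)) => c' c'A; rewrite /f => /cls_cong -/(_ (fU _ _ uw c'A) (fU _ _ uw cA)) E.
  have : cong ((r c' - r c) * (r c' + r c)) 0.
    have [z Oz zE] := E; exists (w^-1 * z).
      by apply: Omul => //; apply/unit_integer/unitV.
    have -> : (r c' - r c) * (r c' + r c) - 0 = w^-1 * (w * r c' ^+ 2 - w * r c ^+ 2).
      by field; apply: unit_neq0 uw.
    by rewrite zE mulrCA.
  have Oc := rO _ cA; have Oc' := rO _ c'A.
  move=> /cong_mul0 -/(_ (Osub Oc' Oc) (Oadd Oc' Oc)) [[z Oz]|[z Oz]]; rewrite subr0 => zE.
    have /clsE : cong (r c') (r c) by exists z.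
    move=> /(_ Oc' Oc); have [_ ->] := rE _ c'A; have [_ ->] := rE _ cA.
    by move->; rewrite !inE eqxx.
  have /clsE : cong (r c') (- r c) by exists z; rewrite ?opprK.
  move=> /(_ Oc' (Oopp Oc)); have [_ ->] := rE _ c'A => ->.
  by rewrite !inE eqxx orbT.
have fA w : unit w -> f w @: A \subset A.
  by move=> uw; apply/fintype.subsetP => _ /imsetP[c cA ->]; apply/clsA/fU.
have meet w w' : unit w -> unit w' -> ~~ [disjoint f w @: A & f w' @: A] ->
    exists c, w = w' * c ^+ 2.
  move=> uw uw' /pred0Pn[_ /andP[/= /imsetP[c cA ->] /imsetP[c' c'A]]].
  move=> /cls_cong -/(_ (fU _ _ uw cA) (fU _ _ uw' c'A)) [z Oz zE].
  have n0 := unit_neq0 (rU _ cA); have n0' := unit_neq0 uw'.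
  have [|||d dE] := @hensel_cong (w / w') (r c' / r c).
  - by apply: (unitM hp hQp) => //; apply: unitV.
  - by apply: Omul; [exact: rO | apply/unit_integer/unitV/rU].
  - exists (z / (w' * r c ^+ 2)).
      by apply: Omul => //; apply/unit_integer/unitV/fU.
    have -> : w / w' - (r c' / r c) ^+ 2
        = (w * r c ^+ 2 - w' * r c' ^+ 2) / (w' * r c ^+ 2) by field; rewrite n0.
    by rewrite zE mulrA.
  by exists d; rewrite -dE mulrC divfK.
have u1 : unit 1 := unit1 hp hQp F.
case: (boolP [disjoint f v @: A & f 1 @: A]) => [dv1|/meet]; last first.
  by move=> /(_ uv u1)[c]; rewrite mul1r => ->; exists c; left.
case: (boolP [disjoint f v @: A & f u @: A]) => [dvu|/meet]; last first.
  by move=> /(_ uv hu)[c ->]; exists c; right.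
case: (boolP [disjoint f u @: A & f 1 @: A]) => [du1|/meet]; last first.
  by move=> /(_ hu u1)[c]; rewrite mul1r => E; have := hu2 c; rewrite E eqxx.
(* Three pairwise disjoint subsets of A, each with at least half as many elements as A, cannot
   exist. *)
have : (#|f v @: A| + (#|f u @: A| + #|f 1%R @: A|) <= #|A|)%N.
  move: du1; rewrite -leq_card_setU => /eqP <-.
  have : [disjoint f v @: A & f u @: A :|: f 1 @: A].
    move: dvu dv1; rewrite -!finset.setI_eq0 => /eqP dvu /eqP dv1.
    by rewrite finset.setIUr dvu dv1 finset.setU0.
  rewrite -leq_card_setU => /eqP <-.
  by apply: subset_leq_card; rewrite !finset.subUset !fA.
have A0 : (0 < #|A|)%N by apply/card_gt0P; exists (cls 1); apply: clsA.
have := card_f _ uv; have := card_f _ hu; have := card_f _ u1.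
by move: #|A| #|f v @: A| #|f u @: A| #|f 1 @: A| A0 => x y z t; lia.
Qed.

(** Pigeonhole: among q residue classes more than (q - 1)/2 are squares, and as many have the form v
    + u b^2, so the two sets meet. Hensel's lemma then turns the congruence a^2 = v + u b^2 into an
    equality. *)
Lemma unit_norm_form v : unit v -> exists a b, v = a ^+ 2 - u * b ^+ 2.
Proof.
move=> uv; have [T [cls clsE]] := residue_classes.
pose A := [set c : T | `[< exists2 x, O x & cls x = c >]].
have [r rE] : exists r : T -> F, forall c, c \in A -> O (r c) /\ cls (r c) = c.
  have H c : exists x, c \in A -> O x /\ cls x = c.
    case: (boolP (c \in A)) => [|_]; last by exists 0.
    by rewrite inE => /asboolP[x ux xE]; exists x.
  by have [r rE] := choice H; exists r.
have rO c : c \in A -> O (r c) by case/rE.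
have clsA x : O x -> cls x \in A by move=> ux; rewrite inE; apply/asboolP; exists x.
have rcls x : O x -> cong (r (cls x)) x.
  move=> Ox; have [Or E] := rE _ (clsA _ Ox); exact/(clsE _ _ Or Ox).
pose c0 := cls 0; pose f c := cls (r c ^+ 2); pose A0 := A :\ c0.
have c0A : c0 \in A by apply: clsA.
have card_f : (#|A0| <= 2 * #|f @: A0|)%N.
  apply: card_fibers_le2 => c /setD1P[_ cA].
  exists (cls (- r c)) => c' /setD1P[_ c'A]; have Oc := rO _ cA; have Oc' := rO _ c'A.
  move=> /clsE -/(_ (OX _ Oc') (OX _ Oc)) E.
  have : cong ((r c' - r c) * (r c' + r c)) 0.
    by have [z Oz zE] := E; exists z => //; rewrite -zE; ring.
  move=> /cong_mul0 -/(_ (Osub Oc' Oc) (Oadd Oc' Oc)) [[z Oz]|[z Oz]]; rewrite subr0 => zE.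
    have /clsE : cong (r c') (r c) by exists z.
    move=> /(_ Oc' Oc); have [_ ->] := rE _ c'A; have [_ ->] := rE _ cA.
    by move->; rewrite !inE eqxx.
  have /clsE : cong (r c') (- r c) by exists z; rewrite ?opprK.
  move=> /(_ Oc' (Oopp Oc)); have [_ ->] := rE _ c'A => ->.
  by rewrite !inE eqxx orbT.
have card_S : (#|f @: A0| < #|f @: A|)%N.
  apply: proper_card; apply/properP; split; first by apply/imsetS/subD1set.
  exists c0.
    apply/imsetP; exists c0 => //; apply/clsE => //; first exact/OX/rO.
    apply: cong_sym; rewrite -[X in cong _ X](mulr0 0) expr2.
    by apply: cong_mul => //; [exact: rO| exact: rcls | exact: rcls].
  apply/imsetP => -[c /setD1P[cc0 cA]] /esym/clsE -/(_ (OX _ (rO _ cA)) O0).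
  rewrite expr2 => /cong_mul0 -/(_ (rO _ cA) (rO _ cA)) h.
  have {h} h : cong (r c) 0 by case: h.
  case/eqP: cc0; have [_ <-] := rE _ cA; rewrite /c0; apply/clsE => //; exact: rO.
pose g c := cls (v + u * r c).
have Ov := unit_integer uv; have Ou := unit_integer hu.
have SA : f @: A \subset A.
  by apply/fintype.subsetP => _ /imsetP[c cA ->]; apply/clsA/OX/rO.
have card_g : #|g @: (f @: A)| = #|f @: A|.
  apply: card_in_imset => c c' /(fintype.subsetP SA) cA /(fintype.subsetP SA) c'A.
  have Oc := rO _ cA; have Oc' := rO _ c'A.
  move=> /clsE -/(_ (Oadd Ov (Omul Ou Oc)) (Oadd Ov (Omul Ou Oc'))) [z Oz zE].
  have [_ <-] := rE _ cA; have [_ <-] := rE _ c'A; apply/clsE => //.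
  exists (u^-1 * z); first by apply: Omul => //; apply/unit_integer/unitV.
  rewrite mulrCA -zE; field; exact: unit_neq0 hu.
have gA : g @: (f @: A) \subset A.
  apply/fintype.subsetP => _ /imsetP[c /(fintype.subsetP SA) cA ->].
  by apply/clsA/Oadd => //; apply: Omul => //; apply: rO.
case: (boolP [disjoint f @: A & g @: (f @: A)]) => [dis|/pred0Pn[/= t]].
  have : (#|f @: A| + #|g @: (f @: A)| <= #|A|)%N.
    move: dis; rewrite -leq_card_setU => /eqP <-.
    by apply: subset_leq_card; rewrite finset.subUset SA.
  have := cardsD1 c0 A; rewrite c0A card_g -/A0.
  by move: card_f card_S; move: #|A| #|f @: A| #|f @: A0| #|A0| => x y z w; lia.
case/andP=> /imsetP[c cA ->] /imsetP[d /imsetP[b bA dE]].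
have Oc := rO _ cA; have Ob := rO _ bA.
have dA : d \in A by rewrite dE; apply/clsA/OX.
move=> /clsE -/(_ (OX _ Oc) (Oadd Ov (Omul Ou (rO _ dA)))) E.
have {E dE} E : cong (r c ^+ 2) (v + u * r b ^+ 2).
  apply: cong_trans E _; apply: cong_add; first exact: cong_refl.
  apply: cong_mul => //; [exact: OX | exact: cong_refl|].
  by rewrite dE; apply/rcls/OX.
(* If a is a unit it is corrected while b is kept. Otherwise v + u b^2 is congruent to 0, and one
   takes a = 0 and lifts b to a square root of -v/u. *)
have [c1|c1] := pselect (unit (r c)).
  have E' : cong (v + u * r b ^+ 2) (r c ^+ 2) by apply: cong_sym.
  have [|d' dE'] := hensel_cong _ Oc E'.
    apply/unit_ncong0; first by apply: Oadd => //; apply: Omul => //; apply: OX.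
    move=> h; apply: ((unit_ncong0 (OX 2 Oc)).1 (unitX hp hQp 2 c1)).
    exact: cong_trans E h.
  by exists d', (r b); rewrite -dE' addrK.
have c2 : cong (r c) 0.
  by apply: contrapT => h; apply: c1; apply/unit_ncong0.
have E' : cong (- v / u) (r b ^+ 2).
  have : cong (v + u * r b ^+ 2) 0.
    apply: cong_trans (cong_sym E) _.
    by rewrite -[X in cong _ X](mulr0 0) expr2; apply: cong_mul.
  case=> z Oz; rewrite subr0 => zE; exists (- (z / u)).
    by apply/Oopp/Omul => //; apply/unit_integer/unitV.
  rewrite mulrN mulrA -zE; field; exact: unit_neq0 hu.
have [|d' dE'] := hensel_cong _ Ob E'.
  by apply: (unitM hp hQp); [exact: (unitN hp hQp) | exact: unitV].
exists 0, d'; rewrite -dE'; field; exact: unit_neq0 hu.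
Qed.

End Residue.
(** The subgroup generated by u and the nonzero squares; over the local field it consists of the
    elements of even valuation. *)
Definition even_class (F : fieldType) (u x : F) :=
  exists2 c, c != 0 & x = c ^+ 2 \/ x = u * c ^+ 2.

(** * Square classes of F *)

Section EvenClass.
Variables (F : fieldType) (u : F).
Implicit Types x y c : F.

Lemma even_classM c x : c != 0 -> even_class u x -> even_class u (c ^+ 2 * x).
Proof.
move=> c0 [d d0 dE]; exists (c * d); rewrite ?mulf_neq0 //.
by case: dE => ->; [left | right]; ring.
Qed.

Lemma even_class_mul x y : u != 0 -> even_class u x -> even_class u y ->
  even_class u (x * y).
Proof.
move=> u0 [c c0 [->|->]] ey; first exact: even_classM.
have [d d0 [->|->]] := ey.
  by exists (c * d); [rewrite mulf_neq0 | right; ring].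
by exists (u * c * d); [rewrite !mulf_neq0 | left; ring].
Qed.

Lemma even_classV x : x != 0 -> even_class u x -> even_class u x^-1.
Proof.
move=> x0 ex; have -> : x^-1 = x^-1 ^+ 2 * x by field.
by apply: even_classM; rewrite ?invr_eq0.
Qed.

Lemma even_class1 : even_class u 1.
Proof. by exists 1; [rewrite oner_neq0 | left; rewrite expr1n]. Qed.

Lemma even_class_sqr c : c != 0 -> even_class u (c ^+ 2).
Proof. by exists c => //; left. Qed.

End EvenClass.

(* The properties of square classes of a local field with odd residual
   characteristic on which the classification depends. *)
Record square_theory (F : fieldType) (pi u : F) : Prop := SquareTheory {
  sqt_pi0 : pi != 0;
  sqt_2 : 2 != 0 :> F;
  sqt_u : forall x, x ^+ 2 != u;
  sqt_classes : forall x, x != 0 -> even_class u x \/ exists2 y, even_class u y & x = pi * y;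
  sqt_N1 : even_class u (-1);
  sqt_u_norm : exists a b, u = a ^+ 2 - u * b ^+ 2;
  sqt_norm : forall a b, (a != 0) || (b != 0) -> even_class u (a ^+ 2 - u * b ^+ 2);
  sqt_pi : forall y, even_class u y -> ~ even_class u (pi * y);
  sqt_dominant : forall m n, even_class u n ->
    (exists2 s, s != 0 & m ^+ 2 - pi * n = s ^+ 2) \/
    (exists2 s, s != 0 & m ^+ 2 - pi * n = - (pi * n * s ^+ 2))
}.

Section SquareClasses.
Variables (p : nat) (Qp : fieldType) (abs : Qp -> rat).
Hypotheses (hp : prime p) (hQp : is_Qp p abs).
Variables (F : fieldExtType Qp) (pi : F).
Hypothesis hpi : uniformizer abs pi.
Local Notation O := (@integer Qp abs F).
Local Notation unit := (@integer_unit Qp abs F).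
Hypothesis unit2 : unit 2.
Variable u : F.
Hypotheses (hu : unit u) (hu2 : forall x, x ^+ 2 != u).

Let Oadd := @integer_add p Qp abs hp hQp F.
Let Omul := @integer_mul p Qp abs hp hQp F.
Let Oopp := @integer_opp p Qp abs hp hQp F.
Let OX := @integerX p Qp abs hp hQp F.
Let Opi := uniformizer_integer hp hQp hpi.
Let pi0 := uniformizer_neq0 hp hQp hpi.
Let unitM := @unitM p Qp abs hp hQp F.
Let hens v a y := @hensel_sqrt p Qp abs hp hQp F pi hpi unit2 v a y.
Let u0 := unit_neq0 hu.

Lemma inv_integer_or x : x != 0 -> O x^-1 \/ exists2 y, O y & x = pi * y.
Proof.
move=> /(uniformizer_decomposition hp hQp hpi)[z [v uv ->]].
have Ov := unit_integer uv; have Ovi := unit_integer (unitV uv).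
case: z => [[|n]|n].
- by left; rewrite expr0z mul1r.
- right; exists (pi ^+ n * v); first by apply: Omul => //; apply: OX.
  by rewrite -exprnP exprS mulrA.
left; rewrite NegzE -invr_expz invfM invrK; apply: Omul => //; exact: OX.
Qed.

Lemma unit_even_class v : unit v -> even_class u v.
Proof.
move=> uv; have [c cE] := unit_square_or hp hQp hpi unit2 hu hu2 uv; exists c => //.
apply: contraTneq isT => c0; have := unit_neq0 uv.
by case: cE => ->; rewrite c0 expr0n ?mulr0 eqxx.
Qed.

Lemma even_class_exp x : even_class u x ->
  exists z : int, exists2 v, unit v & x = pi ^ (z + z) * v.
Proof.
case=> c c0 cE; have [z [v uv vE]] := uniformizer_decomposition hp hQp hpi c0.
case: cE => ->; exists z.
  by exists (v ^+ 2); [exact: (unitX hp hQp) | rewrite vE expfzDr //; ring].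
exists (u * v ^+ 2); first by apply: unitM => //; apply: (unitX hp hQp).
by rewrite vE expfzDr //; ring.
Qed.

Lemma one_pi_square y : O y -> exists2 s, s != 0 & 1 + pi * y = s ^+ 2.
Proof.
move=> Oy; have [|s sE] := hens (v := 1 + pi * y) (unit1 hp hQp F) Oy.
  by rewrite expr1n.
exists s => //; apply/eqP => s0.
have := unit_neq0 (unit_add_pi hp hQp hpi (unit1 hp hQp F) Oy).
by rewrite sE s0 expr0n eqxx.
Qed.

Lemma local_square_theory : square_theory pi u.
Proof.
split=> //.
- exact: unit_neq0 unit2.
- move=> x /(uniformizer_decomposition hp hQp hpi)[z [v uv ->]].
  have ev := unit_even_class uv; have p0 (t : int) : pi ^ t != 0 by apply: expfz_neq0.
  have [t [->|->]] : exists t : int, z = t + t \/ z = t + t + 1.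
    exists (z %/ 2)%Z; have := divz_eq z 2; have := modz_ge0 z (isT : (2 : int) != 0).
    by have := ltz_mod z (isT : (2 : int) != 0); lia.
    left; have -> : pi ^ (t + t) * v = (pi ^ t) ^+ 2 * v by rewrite expfzDr // expr2.
    exact: even_classM.
  right; exists ((pi ^ t) ^+ 2 * v); first exact: even_classM.
  by rewrite !expfzDr // expr1z; ring.
- exact/unit_even_class/(unitN hp hQp)/(unit1 hp hQp).
- exact: (unit_norm_form hp hQp hpi unit2 hu hu2).
- move=> a b ab; have [b0|b0] := eqVneq b 0.
    move: ab; rewrite b0 eqxx orbF => a0; exists a => //; left; ring.
  have [a0|a0] := eqVneq a 0.
    have -> : a ^+ 2 - u * b ^+ 2 = b ^+ 2 * (- u) by rewrite a0; ring.
    by apply: even_classM => //; apply/unit_even_class/(unitN hp hQp).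
  have w0 : b / a != 0 by rewrite mulf_neq0 ?invr_eq0.
  have [Ow|[y Oy yE]] := inv_integer_or w0; last first.
    have bE : b = a * (pi * y) by rewrite -yE mulrC divfK.
    have -> : a ^+ 2 - u * b ^+ 2 = a ^+ 2 * (1 + pi * (- u * y * (pi * y))).
      by rewrite bE; ring.
    apply: even_classM => //; apply/unit_even_class/(unit_add_pi hp hQp hpi).
      exact: (unit1 hp hQp).
    apply: Omul; last exact: Omul.
    by apply: Omul => //; apply/Oopp/unit_integer.
  (* Now a/b is integral. If (a/b)^2 - u were not a unit, u would be a square modulo pi, hence a
     square by Hensel's lemma. *)
  move: Ow; rewrite invf_div => Ow.
  have -> : a ^+ 2 - u * b ^+ 2 = b ^+ 2 * ((a / b) ^+ 2 - u) by field.
  apply: even_classM => //; apply: unit_even_class.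
  have Od : O ((a / b) ^+ 2 - u).
    by apply: Oadd; [exact: OX | apply/Oopp/unit_integer].
  apply/(unit_ncong0 hp hQp hpi Od) => -[z Oz]; rewrite subr0 => zE.
  have [|c cE] := @hensel_cong p _ _ hp hQp _ _ hpi unit2 u (a / b) hu Ow.
    by exists (- z); [exact: Oopp | rewrite mulrN -zE opprB].
  by have := hu2 c; rewrite cE eqxx.
- move=> y /even_class_exp[z [v uv vE]] /even_class_exp[t [w uw wE]].
  have : z + z + 1 = t + t.
    apply: (uniformizer_exp_inj hp hQp hpi uv uw).
    by rewrite -wE vE expfzDr // expr1z; ring.
  lia.
(* Here n = e c^2 with e equal to 1 or u, so m^2 and pi n have valuations of different parity. The
   position of m/c decides which one dominates, and the quotient by it lies in 1 + pi O, which
   consists of squares. *)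
move=> m n [c c0 cE].
have [e ue nE] : exists2 e, unit e & n = e * c ^+ 2.
  by case: cE => ->; [exists 1; [exact: (unit1 hp hQp) | rewrite mul1r] | exists u].
have e0 := unit_neq0 ue; have [m0|m0] := eqVneq m 0.
  by right; exists 1; rewrite ?oner_neq0 // m0; ring.
have w0 : m / c != 0 by rewrite mulf_neq0 ?invr_eq0.
have [Ow|[y Oy yE]] := inv_integer_or w0.
  have [|s s0 sE] := @one_pi_square (- e * (m / c)^-1 ^+ 2).
    by apply: Omul; [exact/Oopp/unit_integer | exact: OX].
  left; exists (m * s); rewrite ?mulf_neq0 // exprMn -sE nE.
  by field; rewrite ?m0 ?c0.
have [|s s0 sE] := @one_pi_square (- (y ^+ 2 / e)).
  by apply/Oopp/Omul; [exact: OX | exact/unit_integer/unitV].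
have mE : m = c * (pi * y) by rewrite -yE mulrC divfK.
by right; exists s; rewrite // -sE nE mE; field.
Qed.

End SquareClasses.
(** * The quadratic extension E *)

Section ScalarEmbedding.
Variables (F : fieldType) (E : fieldExtType F).
Implicit Types a b : F.

Lemma alg_eq0 a : (a%:A == 0 :> E) = (a == 0).
Proof. by rewrite -[a%:A]/(in_alg E a) fmorph_eq0. Qed.

Lemma alg_inj a b : a%:A = b%:A :> E -> a = b.
Proof. exact: (fmorph_inj (in_alg E)). Qed.

Lemma algD a b : (a + b)%:A = a%:A + b%:A :> E.
Proof. exact: (rmorphD (in_alg E)). Qed.

Lemma algN a : (- a)%:A = - a%:A :> E.
Proof. exact: (rmorphN (in_alg E)). Qed.

Lemma algM a b : (a * b)%:A = a%:A * b%:A :> E.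
Proof. exact: (rmorphM (in_alg E)). Qed.

Lemma algV a : (a^-1)%:A = (a%:A)^-1 :> E.
Proof. exact: (fmorphV (in_alg E)). Qed.

Lemma algX a n : (a ^+ n)%:A = a%:A ^+ n :> E.
Proof. exact: (rmorphXn (in_alg E)). Qed.

Lemma conj_alg (conj : {lrmorphism E -> E}) a : conj a%:A = a%:A.
Proof. exact: rmorph_alg. Qed.

End ScalarEmbedding.

Section QuadraticExtension.
Variables (F : fieldType) (pi u : F).
Hypothesis sqt : square_theory pi u.
Variables (E : fieldExtType F) (sqrtu : E).
Hypotheses (hsqrtu : sqrtu ^+ 2 = u%:A) (hE : <<1%AS; sqrtu>>%VS = {:E}%VS).
Variable conj : {lrmorphism E -> E}.
Hypothesis hconj : conj sqrtu = - sqrtu.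
Implicit Types (x y z w : E) (a b c : F).

Let two0 : 2 != 0 :> E.
Proof. by rewrite -(rmorph_nat (in_alg E)) fmorph_eq0 (sqt_2 sqt). Qed.

Lemma sqrtu_neq0 : sqrtu != 0.
Proof.
apply: contra_eq_neq hsqrtu => ->; rewrite expr0n /= eq_sym alg_eq0.
by apply: contraNneq (sqt_u sqt 0) => ->; rewrite expr0n.
Qed.

Lemma quad_coords x : exists a b, x = a%:A + b%:A * sqrtu.
Proof.
have /Fadjoin1_polyP[q ->] : x \in <<1%AS; sqrtu>>%VS by rewrite hE memvf.
elim/poly_ind: q => [|q c [a [b IH]]].
  by exists 0, 0; rewrite rmorph0 horner0 scale0r mul0r addr0.
exists (b * u + c), a.
rewrite rmorphD rmorphM /= map_polyX map_polyC /= hornerD hornerM hornerX hornerC IH.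
by rewrite algD algM -hsqrtu; ring.
Qed.

Lemma conj_coords a b : conj (a%:A + b%:A * sqrtu) = a%:A - b%:A * sqrtu.
Proof. by rewrite rmorphD rmorphM /= !conj_alg hconj mulrN. Qed.

Lemma conjK : involutive conj.
Proof.
move=> x; have [a [b ->]] := quad_coords x.
by rewrite conj_coords -mulNr -algN conj_coords algN mulNr opprK.
Qed.

Lemma quad_coords_inj a b a' b' :
  a%:A + b%:A * sqrtu = a'%:A + b'%:A * sqrtu -> a = a' /\ b = b'.
Proof.
move=> h; have /(congr1 conj) := h; rewrite !conj_coords => h'.
have h1 : 2 * a%:A = 2 * a'%:A :> E.
  have -> : 2 * a%:A = (a%:A + b%:A * sqrtu) + (a%:A - b%:A * sqrtu) :> E by ring.
  by rewrite h h'; ring.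
have ha := alg_inj (mulfI two0 h1); split=> //; move: h; rewrite ha.
by move/addrI/(mulIf sqrtu_neq0)/alg_inj.
Qed.

Lemma conj_fixed x : conj x = x -> exists a, x = a%:A.
Proof.
have [a [b ->]] := quad_coords x; rewrite conj_coords -mulNr -algN => /quad_coords_inj[_ h].
exists a; have : 2 * b = 0 by rewrite mulr_natl mulr2n -{1}h addNr.
move/eqP; rewrite mulf_eq0 (negPf (sqt_2 sqt)) /= => /eqP ->.
by rewrite scale0r mul0r addr0.
Qed.

Lemma norm_coords a b : (a%:A + b%:A * sqrtu) * conj (a%:A + b%:A * sqrtu)
  = (a ^+ 2 - u * b ^+ 2)%:A.
Proof. by rewrite conj_coords algD algN !algX algM !algX -hsqrtu; ring. Qed.

Lemma norm_even x : x != 0 -> exists2 n, even_class u n & x * conj x = n%:A.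
Proof.
have [a [b ->]] := quad_coords x => x0; exists (a ^+ 2 - u * b ^+ 2).
  apply: (sqt_norm sqt); apply: contraNT x0.
  rewrite negb_or !negbK => /andP[/eqP -> /eqP ->].
  by rewrite !scale0r mul0r addr0.
exact: norm_coords.
Qed.

Lemma even_class_neq0 n : even_class u n -> n != 0.
Proof.
have u0 : u != 0.
  by apply: contraNneq (sqt_u sqt 0) => ->; rewrite expr0n.
by case=> c c0 [->|->]; rewrite ?mulf_neq0 ?expf_neq0.
Qed.

Lemma even_sqrt n : even_class u n -> exists2 x : E, x != 0 & x ^+ 2 = n%:A.
Proof.
case=> c c0 cE; have c0' : c%:A != 0 :> E by rewrite alg_eq0.
case: cE => ->; first by exists c%:A; rewrite ?algX.
exists (sqrtu * c%:A); first by rewrite mulf_neq0 // sqrtu_neq0.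
by rewrite exprMn hsqrtu algM algX.
Qed.

(** A square c^2 is the norm of c, and u is a norm by [sqt_u_norm]. *)
Lemma even_is_norm n : even_class u n -> exists2 x, x != 0 & x * conj x = n%:A.
Proof.
move=> en; suff [x xE] : exists x, x * conj x = n%:A.
  exists x => //; apply: contraTneq (even_class_neq0 en) => x0.
  by move: xE; rewrite x0 mul0r negbK -(@alg_eq0 _ E) => <-.
case: en => c c0 [->|->]; first by exists c%:A; rewrite conj_alg algX.
have [a [b uE]] := sqt_u_norm sqt.
exists (c%:A * (a%:A + b%:A * sqrtu)).
by rewrite rmorphM /= mulrACA conj_alg norm_coords -uE algM algX mulrC.
Qed.

(** The explicit choice w = 1 + z satisfies z (1 + conj z) = z + 1; it vanishes only for z = -1,
    where [sqrtu] takes its place. *)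
Lemma hilbert90 z : z * conj z = 1 -> exists2 w, w != 0 & z * conj w = w.
Proof.
move=> zE; have [z1|z1] := eqVneq z (-1).
  by exists sqrtu; [exact: sqrtu_neq0 | rewrite z1 hconj mulN1r opprK].
exists (1 + z); first by rewrite addrC addr_eq0.
by rewrite rmorphD rmorph1 mulrDr mulr1 zE addrC.
Qed.

(** By Hilbert 90, z = w / conj w = w^2 / N(w), and N(w) is in the even class, hence a square in
    E. *)
Lemma norm1_square z : z * conj z = 1 -> exists2 w, w != 0 & z = w ^+ 2.
Proof.
move=> /hilbert90[w w0 wE]; have [n en nE] := norm_even w0.
have [s s0 sE] := even_sqrt en.
have c0 : conj w != 0 by rewrite fmorph_eq0.
exists (w / s); first by rewrite mulf_neq0 ?invr_eq0.
rewrite expr_div_n sE -nE; apply: (mulIf c0); rewrite wE.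
by field; rewrite c0.
Qed.

End QuadraticExtension.

Lemma mx2P (R : Type) (A B : 'M[R]_2) : A 0 0 = B 0 0 -> A 0 1 = B 0 1 ->
  A 1 0 = B 1 0 -> A 1 1 = B 1 1 -> A = B.
Proof.
move=> h00 h01 h10 h11; apply/matrixP => i j.
have ordE (k : 'I_2) : k = 0 \/ k = 1.
  by case: k => -[|[|//]] hk; [left | right]; apply: val_inj.
by case: (ordE i) => ->; case: (ordE j) => ->.
Qed.

Lemma mulmx2E (R : pzSemiRingType) (A B : 'M[R]_2) i j :
  (A *m B) i j = A i 0 * B 0 j + A i 1 * B 1 j.
Proof. by rewrite mxE !big_ord_recl big_ord0 addr0; congr (_ + A i _ * B _ j); apply: val_inj. Qed.

Lemma det_mx2 (R : comNzRingType) (A : 'M[R]_2) :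
  \det A = A 0 0 * A 1 1 - A 0 1 * A 1 0.
Proof.
rewrite (expand_det_row A 0) !big_ord_recl big_ord0 addr0 /cofactor !det_mx11 !mxE.
rewrite !expr0 !mul1r expr1 mulN1r mulrN.
by congr (_ * A _ _ - A _ _ * A _ _); apply: val_inj.
Qed.

Lemma ord3P (l : 'I_3) : [\/ l = 0, l = 1 | l = 2%:R].
Proof.
by case: l => -[|[|[|//]]] hl; [apply: Or31 | apply: Or32 | apply: Or33]; apply: val_inj.
Qed.

(** * The ternary form on S^+ *)

Section Ternary.
Variables (F : fieldType) (pi u : F).
Hypothesis sqt : square_theory pi u.
Variables (E : fieldExtType F) (sqrtu : E).
Hypotheses (hsqrtu : sqrtu ^+ 2 = u%:A) (hE : <<1%AS; sqrtu>>%VS = {:E}%VS).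
Variable conj : {lrmorphism E -> E}.
Hypothesis hconj : conj sqrtu = - sqrtu.
Implicit Types (x y z w a c : E).

Let pi0 := sqt_pi0 sqt.
Let cK := conjK sqt hsqrtu hE hconj.
Local Notation M2 := 'M[E]_2.
Local Notation J := (Jpi E pi).
Local Notation P := (pi%:A : E).
Let P0 : P != 0. Proof. by rewrite alg_eq0. Qed.
Let cP : conj P = P. Proof. exact: conj_alg. Qed.
Let u0 : u != 0.
Proof. by apply: contraNneq (sqt_u sqt 0) => ->; rewrite expr0n. Qed.

(* [quat] cuts out the quaternion algebra D, and [skew] the D-module containing S^+. *)
Definition quat (g : M2) := J *m map_mx conj g = g *m J.
Definition skew (M : M2) := J *m map_mx conj M = M *m J^T.

(** The element a + conj(c) J of the quaternion algebra E + E J, where J^2 = pi and a in E is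
    identified with diag(a, conj a). *)
Definition qmx a c : M2 := \matrix_(i < 2, j < 2)
  if i == 0 then (if j == 0 then a else P * conj c) else (if j == 0 then c else conj a).

Definition smx x (m : F) : M2 := \matrix_(i < 2, j < 2)
  if i == 0 then (if j == 0 then P * conj x else m%:A) else (if j == 0 then m%:A else x).

Let J_E : (J 0 0 = 0) * (J 0 1 = P) * (J 1 0 = 1) * (J 1 1 = 0).
Proof. by rewrite !mxE. Qed.

Let qmxE a c : (qmx a c 0 0 = a) * (qmx a c 0 1 = P * conj c) * (qmx a c 1 0 = c)
  * (qmx a c 1 1 = conj a).
Proof. by rewrite !mxE. Qed.

Let smxE x m : (smx x m 0 0 = P * conj x) * (smx x m 0 1 = m%:A) * (smx x m 1 0 = m%:A)
  * (smx x m 1 1 = x).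
Proof. by rewrite !mxE. Qed.

Let trE (A : M2) i j : A^T i j = A j i. Proof. by rewrite mxE. Qed.
Let mapE (A : M2) i j : map_mx conj A i j = conj (A i j). Proof. by rewrite mxE. Qed.

Lemma Jpi_sqr : J *m J = P%:M.
Proof. by apply: mx2P; rewrite !mulmx2E !J_E !mxE /=; ring. Qed.

Lemma conj_Jpi : map_mx conj J = J.
Proof. by apply: mx2P; rewrite !mapE !J_E ?rmorph0 ?rmorph1 ?cP. Qed.

Lemma quat_qmx a c : quat (qmx a c).
Proof.
by apply: mx2P; rewrite !mulmx2E !mapE !J_E !qmxE ?rmorphM /= ?cP ?cK; ring.
Qed.

Lemma quatP (g : M2) : quat g -> exists a c, g = qmx a c.
Proof.
move=> h; exists (g 0 0), (g 1 0); apply: mx2P; rewrite ?qmxE //.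
  by have := congr1 (fun A : M2 => A 0 0) h;
    rewrite !mulmx2E !mapE !J_E !mul0r !add0r !mulr0 !add0r mulr1 => ->.
by have := congr1 (fun A : M2 => A 1 0) h;
  rewrite !mulmx2E !mapE !J_E !mul0r !mulr0 !add0r addr0 mulr1 mul1r => ->.
Qed.

Lemma skewP (M : M2) : skew M <-> M 0 1 = conj (M 1 0) /\ M 0 0 = P * conj (M 1 1).
Proof.
split=> [h|[h1 h2]].
  have h00 := congr1 (fun A : M2 => A 0 0) h; have h01 := congr1 (fun A : M2 => A 0 1) h.
  move: h00 h01; rewrite !mulmx2E !trE !mapE !J_E !mulr0 !mul0r !add0r mulr1 addr0.
  by rewrite mulrC => /(mulIf P0) <- ->.
by apply: mx2P; rewrite !mulmx2E !trE !mapE !J_E ?h1 ?h2 ?rmorphM /= ?cP ?cK; ring.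
Qed.

Lemma skew_smx x m : skew (smx x m).
Proof. by apply/skewP; rewrite !smxE conj_alg. Qed.

Lemma tr_smx x m : (smx x m)^T = smx x m.
Proof. by apply: mx2P; rewrite trE !smxE. Qed.

Lemma Splus_smx x m : Splus pi conj (smx x m).
Proof. by split; [exact: tr_smx | exact: skew_smx]. Qed.

Lemma SplusP (M : M2) : Splus pi conj M -> exists x m, M = smx x m.
Proof.
case=> sM /skewP[h1 h2].
have sM' : M 1 0 = M 0 1 by rewrite -{1}sM trE.
have [m mE] : exists m, M 1 0 = m%:A.
  by apply: (conj_fixed sqt hsqrtu hE hconj); rewrite -h1.
exists (M 1 1), m; apply: mx2P; rewrite !smxE // -?mE //.
Qed.

Lemma det_qmx a c : \det (qmx a c) = a * conj a - P * (c * conj c).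
Proof. by rewrite det_mx2 !qmxE; ring. Qed.

Lemma norm_alg x : exists n, x * conj x = n%:A.
Proof.
have [a [b ->]] := quad_coords sqt hsqrtu hE hconj x.
by eexists; exact: (norm_coords sqt hsqrtu hE hconj).
Qed.

(** Norms have even valuation, so pi is not a norm. This makes D a division algebra and every
    nonzero skew matrix invertible. *)
Lemma norm_neq_pi_norm x y : x * conj x = P * (y * conj y) -> x = 0 /\ y = 0.
Proof.
move=> h; have cx0 z : (conj z == 0) = (z == 0) by rewrite fmorph_eq0.
have [y0|y0] := eqVneq y 0.
  split=> //; move/eqP: h; rewrite y0 mul0r mulr0 mulf_eq0 cx0 orbb; exact/eqP.
have x0 : x != 0.
  have : x * conj x != 0 by rewrite h; apply: mulf_neq0 P0 (mulf_neq0 y0 _); rewrite cx0.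
  by apply: contraNneq => ->; rewrite mul0r.
have [n en nE] := norm_even sqt hsqrtu hE hconj x0.
have [m em mE] := norm_even sqt hsqrtu hE hconj y0.
case: (sqt_pi sqt em); move: h; rewrite nE mE -algM => /alg_inj <-.
exact: en.
Qed.

Lemma qmx_unit a c : (a != 0) || (c != 0) -> qmx a c \in unitmx.
Proof.
move=> ac; rewrite unitmxE det_qmx unitfE subr_eq0; apply: contraTneq ac.
by case/norm_neq_pi_norm => -> ->; rewrite eqxx.
Qed.

Lemma det_quat (g : M2) : quat g -> exists n, \det g = n%:A.
Proof.
case/quatP => a [c ->]; have [n nE] := norm_alg a; have [m mE] := norm_alg c.
by exists (n - pi * m); rewrite det_qmx nE mE algD algN algM.
Qed.

Lemma skew_unit (M : M2) : skew M -> M != 0 -> M \in unitmx.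
Proof.
move=> /skewP[h1 h2] M0; rewrite unitmxE det_mx2 unitfE subr_eq0 h1 h2.
apply: contraNneq M0 => h.
have [h3 h4] : M 1 0 = 0 /\ M 1 1 = 0.
  by apply: norm_neq_pi_norm; rewrite mulrC -h; ring.
by apply/eqP/mx2P; rewrite !mxE ?h1 ?h2 ?h3 ?h4 ?rmorph0 ?mulr0.
Qed.

Definition qcong (M M' : M2) := exists g, [/\ quat g, g \in unitmx & g *m M *m g^T = M'].

Lemma quatM g h : quat g -> quat h -> quat (g *m h).
Proof. by move=> hg hh; rewrite /quat map_mxM mulmxA hg -!mulmxA hh. Qed.

Lemma quat1 : quat 1%:M.
Proof. by rewrite /quat map_mx1 mulmx1 mul1mx. Qed.

Lemma quat0 : quat 0.
Proof. by rewrite /quat map_mx0 mulmx0 mul0mx. Qed.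

Lemma quatD g h : quat g -> quat h -> quat (g + h).
Proof. by move=> hg hh; rewrite /quat map_mxD mulmxDr mulmxDl hg hh. Qed.

Lemma quatN g : quat g -> quat (- g).
Proof. by move=> hg; rewrite /quat map_mxN mulmxN mulNmx hg. Qed.

Lemma quatV g : quat g -> quat (invmx g).
Proof.
move=> hg; have [ug|nug] := boolP (g \in unitmx); last by rewrite /invmx (negPf nug).
have ucg : map_mx conj g \in unitmx by rewrite map_unitmx.
rewrite /quat map_invmx; apply: (can_inj (mulmxK ucg)).
by rewrite mulmxKV // -mulmxA hg mulmxA mulVmx // mul1mx.
Qed.

Lemma qcong_refl M : qcong M M.
Proof.
exists 1%:M; split; [exact: quat1 | exact: unitmx1 | ].
by rewrite trmx1 mulmx1 mul1mx.
Qed.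

Lemma qcong_trans M2 M1 M3 : qcong M1 M2 -> qcong M2 M3 -> qcong M1 M3.
Proof.
move=> [g [qg ug gE]] [h [qh uh hE']]; exists (h *m g); split.
- exact: quatM.
- by rewrite unitmx_mul uh.
by rewrite trmx_mul -hE' -gE !mulmxA.
Qed.

Lemma qcong_sym M M' : qcong M M' -> qcong M' M.
Proof.
move=> [g [qg ug gE]]; exists (invmx g); split; rewrite ?unitmx_inv //; first exact: quatV.
by rewrite -gE !mulmxA mulVmx // mul1mx -mulmxA -trmx_mul mulVmx // trmx1 mulmx1.
Qed.

Lemma qcong_det M M' : qcong M M' -> exists2 n, n != 0 & \det M' = (n ^+ 2)%:A * \det M.
Proof.
case=> g [/det_quat[n nE] ug <-]; exists n.
  by move: ug; rewrite unitmxE unitfE nE alg_eq0.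
by rewrite !det_mulmx det_tr nE algX; ring.
Qed.

Lemma quat_conj g : quat g -> map_mx conj g *m J = J *m g.
Proof.
move=> /(congr1 (map_mx conj)); rewrite !map_mxM /= !conj_Jpi => <-.
by congr (_ *m _); apply/matrixP => i j; rewrite !mxE cK.
Qed.

Lemma qmx_act a c x m m' : ((m' : F)%:A : E) = (a * conj a + P * (c * conj c)) * m%:A
    + P * (a * c * conj x + conj a * conj c * x) ->
  qmx a c *m smx x m *m (qmx a c)^T
    = smx (conj a ^+ 2 * x + 2 * conj a * c * m%:A + P * c ^+ 2 * conj x) m'.
Proof.
move=> mE; have c2 : conj 2 = 2 by rewrite rmorph_nat.
by apply: mx2P; rewrite !mulmx2E !trE !qmxE !smxE ?mE;
  rewrite ?(rmorphXn, rmorphM, rmorphD) /= ?(c2, cP, cK, conj_alg, rmorph1); ring.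
Qed.

Lemma qcong_act a c x m m' : (a != 0) || (c != 0) ->
  ((m' : F)%:A : E) = (a * conj a + P * (c * conj c)) * m%:A
    + P * (a * c * conj x + conj a * conj c * x) ->
  qcong (smx x m) (smx (conj a ^+ 2 * x + 2 * conj a * c * m%:A + P * c ^+ 2 * conj x) m').
Proof.
move=> ac mE; exists (qmx a c); split; [exact: quat_qmx | exact: qmx_unit|].
exact: qmx_act.
Qed.

Lemma qcong_diag a x m n : a != 0 -> a * conj a = n%:A ->
  qcong (smx x m) (smx (conj a ^+ 2 * x) (n * m)).
Proof.
move=> a0 nE; have := @qcong_act a 0 x m (n * m).
by rewrite a0 nE !(mul0r, mulr0, addr0, expr0n, rmorph0) algM /=; apply.
Qed.

Lemma qcong_swap x m : qcong (smx x m) (smx (P * conj x) (pi * m)).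
Proof.
have := @qcong_act 0 1 x m (pi * m).
rewrite oner_neq0 orbT rmorph0 rmorph1 !(mul0r, mulr0, add0r, mulr1, addr0).
by rewrite expr0n expr1n !(mul0r, mulr1, add0r, algM); apply.
Qed.

Lemma det_smx x m : - \det (smx x m) = (m ^+ 2)%:A - P * (x * conj x).
Proof. by rewrite det_mx2 !smxE algX; ring. Qed.

Lemma smx_eq0 x m : (smx x m == 0) = (x == 0) && (m == 0).
Proof.
apply/eqP/andP => [h|[/eqP -> /eqP ->]]; last first.
  by apply: mx2P; rewrite !smxE !mxE ?rmorph0 ?mulr0 ?scale0r.
have := congr1 (fun A : M2 => A 1 1) h; have := congr1 (fun A : M2 => A 0 1) h.
by rewrite !smxE !mxE => /eqP; rewrite alg_eq0 => -> ->.
Qed.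

Lemma qcong_shear c x (m m' : F) :
  (m'%:A : E) = (1 + P * (c * conj c)) * m%:A + P * (c * conj x + conj c * x) ->
  qcong (smx x m) (smx (x + 2 * c * m%:A + P * c ^+ 2 * conj x) m').
Proof.
have := @qcong_act 1 c x m m'.
by rewrite oner_neq0 rmorph1 !(mul1r, mulr1, expr1n) /=; apply.
Qed.

(** The shear by c = t x with t in F keeps the lower right entry on the line F x, which reduces the
    search for a normal form to one parameter. *)
Lemma qcong_shear_scalar (t n m : F) x : x * conj x = n%:A ->
  qcong (smx x m) (smx ((1 + 2 * t * m + t ^+ 2 * (pi * n))%:A * x)
                       ((1 + pi * (t ^+ 2 * n)) * m + pi * (2 * t * n))).
Proof.
move=> nE; have := @qcong_shear (t%:A * x) x m
  ((1 + pi * (t ^+ 2 * n)) * m + pi * (2 * t * n)).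
have -> : x + 2 * (t%:A * x) * m%:A + P * (t%:A * x) ^+ 2 * conj x
   = (1 + 2 * t * m + t ^+ 2 * (pi * n))%:A * x.
  rewrite !(algD, algX, algM) -nE !scale1r; ring.
by apply; rewrite rmorphM /= conj_alg !(algD, algX, algM) -nE !scale1r; ring.
Qed.

Lemma qcong_split x (m s : F) : s != 0 -> - \det (smx x m) = (s ^+ 2)%:A ->
  qcong (smx x m) (smx 0 1).
Proof.
move=> s0; rewrite det_smx => dE.
have [m1 m10 h1] : exists2 m1, m1 != 0 & qcong (smx x m) (smx 0 m1).
  have [x0|x0] := eqVneq x 0.
    exists m; last by rewrite x0; apply: qcong_refl.
    move: dE; rewrite x0 mul0r mulr0 subr0 => /alg_inj h.
    have : m ^+ 2 != 0 by rewrite h expf_neq0.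
    by rewrite sqrf_eq0.
  have [n en nE] := norm_even sqt hsqrtu hE hconj x0.
  have pinE : pi * n = (m - s) * (m + s).
    apply: (@alg_inj _ E); rewrite algM -nE -[LHS](subKr (m ^+ 2)%:A) dE -algN -algD.
    by congr (_%:A); ring.
  have : pi * n != 0 by rewrite mulf_neq0 // (even_class_neq0 sqt hsqrtu hE hconj en).
  rewrite pinE mulf_eq0 negb_or => /andP[ms0 ms1].
  (* The coefficient of x becomes 1 + 2 m t + pi n t^2 = (1 + (m + s) t) (1 + (m - s) t), and t =
     -1/(m + s) is a root. *)
  have := qcong_shear_scalar (- (m + s)^-1) m nE.
  have -> : 1 + 2 * - (m + s)^-1 * m + (- (m + s)^-1) ^+ 2 * (pi * n) = 0.
    by rewrite pinE; field.
  have -> : (1 + pi * ((- (m + s)^-1) ^+ 2 * n)) * m + pi * (2 * - (m + s)^-1 * n)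
      = (1 + (- (m + s)^-1) ^+ 2 * (pi * n)) * m + (pi * n) * (2 * - (m + s)^-1) by ring.
  rewrite pinE scale0r mul0r => h; eexists; last exact: h.
  have -> : (1 + (- (m + s)^-1) ^+ 2 * ((m - s) * (m + s))) * m
      + (m - s) * (m + s) * (2 * - (m + s)^-1) = 2 * s * s / (m + s) by field.
  by rewrite !mulf_neq0 ?invr_eq0 // (sqt_2 sqt).
apply: qcong_trans h1 _.
(* The remaining scalar may be multiplied by any norm, hence by any element of the even class, and
   by pi through the swap. *)
suff even1 m2 : even_class u m2 -> qcong (smx 0 m2) (smx 0 1).
  have [em|[y ey yE]] := sqt_classes sqt m10; first exact: even1.
  apply: qcong_trans (qcong_swap _ _) _; rewrite rmorph0 mulr0; apply: even1.
  by rewrite yE mulrA -expr2; apply: even_classM.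
move=> em; have m20 := even_class_neq0 sqt hsqrtu hE hconj em.
have [a a0 aE] := even_is_norm sqt hsqrtu hE hconj (even_classV m20 em).
by have := qcong_diag 0 m2 a0 aE; rewrite mulr0 mulVf.
Qed.

(** For t = (s - 1)/m the shear produces a coefficient m' with m m' = m^2 - pi n + pi n s^2, which
    is 0 by hypothesis. *)
Lemma qcong_kill_diag x (m n s : F) : x * conj x = n%:A -> n != 0 ->
  m ^+ 2 - pi * n = - (pi * n * s ^+ 2) -> exists x', qcong (smx x m) (smx x' 0).
Proof.
move=> nE n0 dE; have [m0|m0] := eqVneq m 0.
  by exists x; rewrite m0; apply: qcong_refl.
have := qcong_shear_scalar ((s - 1) / m) m nE.
have -> : (1 + pi * (((s - 1) / m) ^+ 2 * n)) * m + pi * (2 * ((s - 1) / m) * n) = 0.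
  have -> : (1 + pi * (((s - 1) / m) ^+ 2 * n)) * m + pi * (2 * ((s - 1) / m) * n)
     = ((m ^+ 2 - pi * n) + pi * n * s ^+ 2) / m by field.
  by rewrite dE addNr mul0r.
by move=> h; eexists; exact: h.
Qed.

Lemma scalar_square_class (f : F) : f != 0 -> exists e : E, e != 0 /\
  (f%:A = e ^+ 2 \/ f%:A = P * e ^+ 2).
Proof.
move=> f0; have [ef|[y ey fE]] := sqt_classes sqt f0.
  by have [e e0 <-] := even_sqrt sqt hsqrtu hE hconj ef; exists e; split=> //; left.
have [e e0 eE] := even_sqrt sqt hsqrtu hE hconj ey; exists e; split=> //; right.
by rewrite fE algM eE.
Qed.

Lemma qcong_diag0 a x : a != 0 -> qcong (smx x 0) (smx (a ^+ 2 * x) 0).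
Proof.
move=> a0; have [n nE] := norm_alg (conj a).
have := @qcong_diag (conj a) x 0 n; rewrite fmorph_eq0 a0 nE cK mulr0.
by apply.
Qed.

(** The quotient y f / x has norm 1, hence is a square w^2 and y = w^2 x / f. In E the scalar 1/f is
    a square or pi times a square; in the second case the swap absorbs pi, and x / conj x, again of
    norm 1, is a square too. *)
Lemma qcong_antidiag x y (f : F) : x != 0 -> f != 0 ->
  y * conj y * (f ^+ 2)%:A = x * conj x -> qcong (smx x 0) (smx y 0).
Proof.
move=> x0 f0 yE; have cx0 : conj x != 0 by rewrite fmorph_eq0.
have fA0 : f%:A != 0 :> E by rewrite alg_eq0.
have [|w w0 wE] := @norm1_square _ _ _ sqt E sqrtu hsqrtu hE conj hconj (y * f%:A / x).
  rewrite !rmorphM fmorphV /= conj_alg.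
  have -> : y * f%:A / x * (conj y * f%:A / conj x)
    = (y * conj y * (f ^+ 2)%:A) / (x * conj x) by rewrite algX; field; rewrite ?x0 ?cx0.
  by rewrite yE mulfV // mulf_neq0.
have {}wE : y = w ^+ 2 * x * (f^-1)%:A by rewrite -wE algV; field; rewrite ?x0 ?fA0.
have [|e [e0 [eE|eE]]] := @scalar_square_class f^-1; first by rewrite invr_eq0.
  have -> : y = (w * e) ^+ 2 * x by rewrite wE eE; ring.
  by apply: qcong_diag0; rewrite mulf_neq0.
apply: qcong_trans (qcong_swap _ _) _; rewrite mulr0.
have [|v v0 vE] := @norm1_square _ _ _ sqt E sqrtu hsqrtu hE conj hconj (x / conj x).
  by rewrite rmorphM fmorphV /= cK; field; rewrite ?x0 ?cx0.
have -> : y = (w * e * v) ^+ 2 * (P * conj x).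
  by rewrite wE eE !exprMn -vE; field.
by apply: qcong_diag0; rewrite !mulf_neq0.
Qed.

Lemma sq_repE : (sq_rep pi u 0 = 1) * (sq_rep pi u 1 = pi) * (sq_rep pi u 2%:R = u * pi).
Proof. by []. Qed.

Lemma sq_rep_even l : l != 0 -> exists2 y, even_class u y & sq_rep pi u l = pi * y.
Proof.
case: (ord3P l) => -> // _; rewrite sq_repE.
  by exists 1; [exact: even_class1 | rewrite mulr1].
by exists u; [exists 1; rewrite ?oner_neq0 //; right; ring | rewrite mulrC].
Qed.

Lemma square_class_inj (d : E) (l l' : 'I_3) : square_class d (sq_rep pi u l) ->
  square_class d (sq_rep pi u l') -> l = l'.
Proof.
move=> [c c0 ->] [d' d0 /alg_inj].
have H k (y b a : F) : b != 0 -> a != 0 -> even_class u y -> 1 * b ^+ 2 = pi * y * a ^+ 2 -> k.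
  rewrite mul1r => b0 a0 ey E1; case: (sqt_pi sqt (y := a ^+ 2 * y)); first exact: even_classM.
  have -> : pi * (a ^+ 2 * y) = b ^+ 2 by rewrite E1; ring.
  exact: even_class_sqr.
have H' k (b a : F) : b != 0 -> pi * b ^+ 2 = u * pi * a ^+ 2 -> k.
  move=> b0; have -> : u * pi * a ^+ 2 = pi * (u * a ^+ 2) by ring.
  move/(mulfI pi0) => E1; have a0 : a != 0.
    apply: contraTneq isT => a0; move: E1; rewrite a0 expr0n mulr0 => /eqP.
    by rewrite expf_eq0 (negPf b0).
  by have := sqt_u sqt (b / a); rewrite expr_div_n E1 mulfK ?expf_neq0 // eqxx.
have [->|l0] := eqVneq l 0; have [->|l0'] := eqVneq l' 0 => //.
- by have [y ey ->] := sq_rep_even l0' => /H; apply.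
- by have [y ey ->] := sq_rep_even l0 => /esym/H; apply.
case: (ord3P l) (ord3P l') l0 l0' => -> [] -> //; rewrite !sq_repE => _ _.
  by move/H'; apply.
by move/esym/H'; apply.
Qed.

(** In m^2 - pi N(x) one term dominates. The first gives the class 1; the second gives -pi N(x), of
    class pi or u pi because -N(x) is in the even class. *)
Lemma Splus_class (M : M2) : Splus pi conj M -> M != 0 ->
  exists l, square_class (- \det M) (sq_rep pi u l).
Proof.
case/SplusP => x [m ->] M0; rewrite det_smx.
have [x0|x0] := eqVneq x 0.
  exists 0; exists m; last by rewrite x0 mul0r mulr0 subr0 sq_repE mul1r.
  by move: M0; rewrite smx_eq0 x0 eqxx.
have [n en nE] := norm_even sqt hsqrtu hE hconj x0; rewrite nE -algM -algN -algD.
case: (sqt_dominant sqt m en) => -[s s0 ->].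
  by exists 0; exists s; rewrite // sq_repE mul1r.
have [c c0 cE] : even_class u (-1 * n).
  exact: even_class_mul u0 (sqt_N1 sqt) en.
have -> : - (pi * n * s ^+ 2) = pi * (-1 * n) * s ^+ 2 by ring.
case: cE => ->; [exists 1 | exists 2%:R]; exists (c * s);
  by rewrite ?mulf_neq0 // sq_repE; congr (_%:A); ring.
Qed.

Lemma square_class_neq0 (M : M2) l : square_class (- \det M) (sq_rep pi u l) -> M != 0.
Proof.
case=> c c0 dE; apply/eqP => M0; move/eqP: dE; rewrite M0 det_mx2 !mxE mul0r subrr oppr0.
rewrite eq_sym alg_eq0 mulf_eq0 expf_eq0 (negPf c0) orbF.
have [->|/sq_rep_even[y ey ->]] := eqVneq l 0; first by rewrite sq_repE oner_eq0.
by rewrite mulf_eq0 (negPf pi0) (negPf (even_class_neq0 sqt hsqrtu hE hconj ey)).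
Qed.

(** For the class 1 everything reduces to [smx 0 1]. For the classes pi and u pi the term -pi N(x)
    dominates, so m can be removed, and what remains depends only on N(x) modulo squares of F. *)
Lemma qcong_class (M M' : M2) l : Splus pi conj M -> Splus pi conj M' ->
  square_class (- \det M) (sq_rep pi u l) -> square_class (- \det M') (sq_rep pi u l) ->
  qcong M M'.
Proof.
move=> SM SM' cM cM'; have [l0|l0] := eqVneq l 0.
  have nf N : Splus pi conj N -> square_class (- \det N) (sq_rep pi u l) -> qcong N (smx 0 1).
    case/SplusP => x [m ->] [c c0]; rewrite l0 sq_repE mul1r; exact: qcong_split.
  by apply: qcong_trans (nf _ SM cM) _; apply/qcong_sym/nf.
have [y ey lE] := sq_rep_even l0.
have nf N : Splus pi conj N -> square_class (- \det N) (sq_rep pi u l) ->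
    exists x (c : F), [/\ c != 0, x != 0, qcong N (smx x 0)
      & - (P * (x * conj x)) = (pi * y * c ^+ 2)%:A].
  case/SplusP => x [m ->] cN; have N0 := square_class_neq0 cN; case: cN => c c0; rewrite lE => dE.
  have x0 : x != 0.
    apply/eqP => x0; case: (sqt_pi sqt (y := c ^+ 2 * y)); first exact: even_classM.
    have -> : pi * (c ^+ 2 * y) = m ^+ 2; last first.
      by apply: even_class_sqr; move: N0; rewrite smx_eq0 x0 eqxx.
    move: dE; rewrite det_smx x0 mul0r mulr0 subr0 => /alg_inj ->; ring.
  have [n en nE] := norm_even sqt hsqrtu hE hconj x0.
  have dE' : m ^+ 2 - pi * n = pi * y * c ^+ 2.
    by apply: (@alg_inj _ E); rewrite -dE det_smx nE -algM -algN -algD.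
  case: (sqt_dominant sqt m en) => -[s s0 sE].
    case: (sqt_pi sqt (y := c ^+ 2 * y)); first exact: even_classM.
    have -> : pi * (c ^+ 2 * y) = s ^+ 2 by rewrite -sE dE'; ring.
    exact: even_class_sqr.
  have [x' h] := qcong_kill_diag nE (even_class_neq0 sqt hsqrtu hE hconj en) sE.
  have [t t0] := qcong_det h; move/(congr1 -%R); rewrite -mulrN dE det_smx.
  rewrite expr0n scale0r sub0r -algM => dE2.
  exists x', (c * t); split; rewrite ?mulf_neq0 //.
    apply: contraTneq isT => x'0; move/eqP: dE2; rewrite x'0 mul0r mulr0 oppr0 eq_sym alg_eq0.
    rewrite !mulf_eq0 (negPf c0) (negPf t0) (negPf pi0).
    by rewrite (negPf (even_class_neq0 sqt hsqrtu hE hconj ey)).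
  by rewrite dE2; congr (_%:A); ring.
have [x [c [c0 x0 h hx]]] := nf _ SM cM; have [x' [c' [c0' x0' h' hx']]] := nf _ SM' cM'.
apply: qcong_trans h _; apply: qcong_trans (qcong_sym h').
apply: (@qcong_antidiag _ _ (c / c')); rewrite ?mulf_neq0 ?invr_eq0 //.
apply: (mulfI P0); apply: oppr_inj; rewrite hx mulrA -mulNr hx' -algM.
by congr (_%:A); field.
Qed.

Lemma class_exists l : exists2 M, Splus pi conj M & square_class (- \det M) (sq_rep pi u l).
Proof.
have [->|/sq_rep_even[y ey lE]] := eqVneq l 0.
  exists (smx 0 1); first exact: Splus_smx.
  by exists 1; rewrite ?oner_neq0 // det_smx mul0r mulr0 subr0 sq_repE mul1r.
have [x x0 xE] := even_is_norm sqt hsqrtu hE hconj (even_class_mul u0 (sqt_N1 sqt) ey).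
exists (smx x 0); first exact: Splus_smx.
exists 1; rewrite ?oner_neq0 // det_smx xE expr0n scale0r sub0r lE expr1n mulr1.
by rewrite -algM -algN; congr (_%:A); ring.
Qed.

End Ternary.
(** * Hermitian matrices over the quaternion algebra *)

Section BlockMatrices.
Variable E : comNzRingType.
Local Notation R := ('M[E]_2).

(* Matrices of size 2(k+1) are handled as matrices with coefficients in 'M_2; the transpose of
   the former becomes [adj]. *)
Definition adj m n (b : 'M[R]_(m, n)) : 'M[R]_(n, m) := (map_mx trmx b)^T.

Lemma adjE m n (b : 'M[R]_(m, n)) i j : adj b i j = (b j i)^T.
Proof. by rewrite !mxE. Qed.

Lemma adjK m n : cancel (@adj m n) (@adj n m).
Proof. by move=> b; apply/matrixP => i j; rewrite !adjE trmxK. Qed.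

Lemma adjM m n l (a : 'M[R]_(m, n)) (b : 'M[R]_(n, l)) : adj (a *m b) = adj b *m adj a.
Proof.
apply/matrixP => i j; rewrite adjE !mxE raddf_sum; apply: eq_bigr => k _ /=.
by rewrite !adjE; apply: trmx_mul.
Qed.

Lemma adj1 m : adj (1%:M : 'M[R]_m) = 1%:M.
Proof.
by apply/matrixP => i j; rewrite adjE !mxE eq_sym; case: eqP => _; rewrite ?trmx1 ?trmx0.
Qed.

Lemma adjN m n (b : 'M[R]_(m, n)) : adj (- b) = - adj b.
Proof. by apply/matrixP => i j; rewrite !(adjE, mxE) raddfN. Qed.

Lemma adj_block m1 m2 n1 n2 (a : 'M[R]_(m1, n1)) b c (d : 'M[R]_(m2, n2)) :
  adj (block_mx a b c d) = block_mx (adj a) (adj c) (adj b) (adj d).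
Proof. by rewrite /adj map_block_mx tr_block_mx. Qed.

Lemma adj0 m n : adj (0 : 'M[R]_(m, n)) = 0.
Proof. by apply/matrixP => i j; rewrite adjE !mxE trmx0. Qed.

Definition dg m (d : 'I_m -> R) : 'M[R]_m := \matrix_(i, j) if i == j then d i else 0.

Lemma dgE m (d : 'I_m -> R) i j : dg d i j = if i == j then d i else 0.
Proof. by rewrite mxE. Qed.

Lemma dg_split m1 m2 (d : 'I_(m1 + m2) -> R) :
  dg d = block_mx (dg (fun i => d (lshift m2 i))) 0 0 (dg (fun i => d (rshift m1 i))).
Proof.
apply/matrixP => i j; rewrite -[i]splitK -[j]splitK.
case: (fintype.split i) => k; case: (fintype.split j) => t /=;
  rewrite ?(block_mxEul, block_mxEur, block_mxEdl, block_mxEdr) !mxE.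
- by rewrite (inj_eq (@lshift_inj _ _)).
- by rewrite eq_lrshift.
- by rewrite eq_rlshift.
- by rewrite (inj_eq (@rshift_inj _ _)).
Qed.

End BlockMatrices.

Section BlockForms.
Variables (F : fieldType) (pi u : F).
Hypothesis sqt : square_theory pi u.
Variables (E : fieldExtType F) (sqrtu : E).
Hypotheses (hsqrtu : sqrtu ^+ 2 = u%:A) (hE : <<1%AS; sqrtu>>%VS = {:E}%VS).
Variable conj : {lrmorphism E -> E}.
Hypothesis hconj : conj sqrtu = - sqrtu.

Local Notation R := ('M[E]_2).
Local Notation J := (Jpi E pi).
Local Notation quat := (quat pi conj).
Local Notation skew := (skew pi conj).
Local Notation Sp := (Splus pi conj).
Local Notation qcong := (qcong pi conj).

Let quatM_ := @quatM F pi u sqt E sqrtu hsqrtu hE conj hconj.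
Let quatD_ := @quatD F pi u sqt E sqrtu hsqrtu hE conj hconj.
Let quatN_ := @quatN F pi u sqt E sqrtu hsqrtu hE conj hconj.
Let quat0_ := @quat0 F pi u sqt E sqrtu hsqrtu hE conj hconj.
Let quat1_ := @quat1 F pi u sqt E sqrtu hsqrtu hE conj hconj.
Let quatV_ := @quatV F pi u sqt E sqrtu hsqrtu hE conj hconj.
Let skew_unit_ := @skew_unit F pi u sqt E sqrtu hsqrtu hE conj hconj.

Lemma skew0 : skew 0.
Proof. by rewrite /skew map_mx0 mulmx0 mul0mx. Qed.

Lemma skewD (M N : R) : skew M -> skew N -> skew (M + N).
Proof. by move=> hM hN; rewrite /skew map_mxD mulmxDr mulmxDl hM hN. Qed.

Lemma skewN (M : R) : skew M -> skew (- M).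
Proof. by move=> hM; rewrite /skew map_mxN mulmxN mulNmx hM. Qed.

Lemma quat_mul_skew (g M : R) : quat g -> skew M -> skew (g *m M).
Proof. by move=> hg hM; rewrite /skew map_mxM mulmxA hg -!mulmxA hM. Qed.

Lemma skew_mul_quatT (g M : R) : quat g -> skew M -> skew (M *m g^T).
Proof.
move=> hg hM; rewrite /skew map_mxM mulmxA hM -!mulmxA; congr (_ *m _).
rewrite -map_trmx -!trmx_mul; congr (_^T).
exact: (quat_conj sqt hsqrtu hE hconj).
Qed.

(** Quotients of skew matrices lie in D, so invertible skew entries can serve as pivots for row
    operations over D. *)
Lemma quat_skew_div (M N : R) : skew M -> skew N -> N \in unitmx -> quat (M *m invmx N).
Proof.
move=> hM hN uN; have ucN : map_mx conj N \in unitmx by rewrite map_unitmx.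
rewrite /quat map_mxM map_invmx mulmxA hM -!mulmxA; congr (_ *m _).
apply: (can_inj (mulmxK ucN)); rewrite mulmxKV // -mulmxA.
by rewrite hN mulKmx.
Qed.

Definition qmat m n (g : 'M[R]_(m, n)) := forall i j, quat (g i j).
Definition smat m n (b : 'M[R]_(m, n)) := forall i j, skew (b i j).

Lemma quat_sum (I : Type) (r : seq I) (f : I -> R) : (forall i, quat (f i)) ->
  quat (\sum_(i <- r) f i).
Proof. by move=> h; elim/big_ind: _ => //; apply: quatD_. Qed.

Lemma skew_sum (I : Type) (r : seq I) (f : I -> R) : (forall i, skew (f i)) ->
  skew (\sum_(i <- r) f i).
Proof. by move=> h; elim/big_ind: _ => //; [exact: skew0 | exact: skewD]. Qed.

Lemma qmatM m n l (a : 'M[R]_(m, n)) (b : 'M[R]_(n, l)) : qmat a -> qmat b -> qmat (a *m b).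
Proof. by move=> ha hb i j; rewrite mxE; apply: quat_sum => k; apply: quatM_. Qed.

Lemma qmat1 m : qmat (1%:M : 'M[R]_m).
Proof. by move=> i j; rewrite mxE; case: eqP => _; [exact: quat1_ | exact: quat0_]. Qed.

Lemma qmat0 m n : qmat (0 : 'M[R]_(m, n)).
Proof. by move=> i j; rewrite mxE; exact: quat0_. Qed.

Lemma qmatN m n (g : 'M[R]_(m, n)) : qmat g -> qmat (- g).
Proof. by move=> hg i j; rewrite mxE; exact: quatN_. Qed.

Lemma qmat_block m1 m2 n1 n2 (a : 'M[R]_(m1, n1)) b c (d : 'M[R]_(m2, n2)) :
  qmat a -> qmat b -> qmat c -> qmat d -> qmat (block_mx a b c d).
Proof.
move=> ha hb hc hd i j; rewrite !mxE; case: splitP => k _; rewrite !mxE;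
  by case: splitP => t _.
Qed.

Lemma smat_act m n (g : 'M[R]_(m, n)) b : qmat g -> smat b -> smat (g *m b *m adj g).
Proof.
move=> hg hb i j; rewrite mxE; apply: skew_sum => k; rewrite adjE.
apply: skew_mul_quatT => //; rewrite mxE; apply: skew_sum => t.
exact: quat_mul_skew.
Qed.

(* Conjugacy under G^0, in terms of blocks. *)
Definition bsim m (b b' : 'M[R]_m) := exists g h,
  [/\ qmat g, qmat h, g *m h = 1%:M, h *m g = 1%:M & g *m b *m adj g = b'].

Lemma bsim_refl m (b : 'M[R]_m) : bsim b b.
Proof.
by exists 1%:M, 1%:M; split; rewrite ?adj1 ?mulmx1 ?mul1mx //; exact: qmat1.
Qed.

Lemma bsim_trans m (b2 b1 b3 : 'M[R]_m) : bsim b1 b2 -> bsim b2 b3 -> bsim b1 b3.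
Proof.
move=> [g [h [qg qh gh hg <-]]] [g' [h' [qg' qh' gh' hg' <-]]].
exists (g' *m g), (h *m h'); split; try exact: qmatM.
- by rewrite mulmxA -(mulmxA g') gh mulmx1.
- by rewrite mulmxA -(mulmxA h) hg' mulmx1.
by rewrite adjM !mulmxA.
Qed.

Lemma bsim_sym m (b b' : 'M[R]_m) : bsim b b' -> bsim b' b.
Proof.
move=> [g [h [qg qh gh hg <-]]]; exists h, g; split=> //.
by rewrite !mulmxA hg mul1mx -mulmxA -adjM hg adj1 mulmx1.
Qed.

Lemma bsim_herm m (b b' : 'M[R]_m) : bsim b b' -> adj b = b -> adj b' = b'.
Proof. by move=> [g [h [_ _ _ _ <-]]] hb; rewrite !adjM adjK hb mulmxA. Qed.

Lemma bsim_smat m (b b' : 'M[R]_m) : bsim b b' -> smat b -> smat b'.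
Proof. by move=> [g [h [qg _ _ _ <-]]]; apply: smat_act. Qed.

Lemma bsim_block m1 m2 (a a' : 'M[R]_m1) (d d' : 'M[R]_m2) : bsim a a' -> bsim d d' ->
  bsim (block_mx a 0 0 d) (block_mx a' 0 0 d').
Proof.
move=> [g [h [qg qh gh hg <-]]] [g' [h' [qg' qh' gh' hg' <-]]].
exists (block_mx g 0 0 g'), (block_mx h 0 0 h').
split; try by apply: qmat_block => //; exact: qmat0.
- by rewrite mulmx_block !(mulmx0, mul0mx, addr0, add0r) gh gh' -scalar_mx_block.
- by rewrite mulmx_block !(mulmx0, mul0mx, addr0, add0r) hg hg' -scalar_mx_block.
by rewrite adj_block !adj0 !mulmx_block !(mulmx0, mul0mx, addr0, add0r).
Qed.

Lemma bsim_perm m (b : 'M[R]_m) (s : 'S_m) : bsim b (\matrix_(i, j) b (s i) (s j)).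
Proof.
have qp (t : 'S_m) : qmat (perm_mx t : 'M[R]_m).
  by move=> i j; rewrite !mxE; case: eqP => _; [exact: quat1_ | exact: quat0_].
exists (perm_mx s), (perm_mx s^-1%g); split; rewrite -?perm_mxM ?mulgV ?mulVg ?perm_mx1 //.
have -> : adj (perm_mx s) = perm_mx s^-1%g :> 'M[R]_m.
  rewrite -tr_perm_mx; apply/matrixP => i j; rewrite adjE !mxE.
  by case: eqP => _; rewrite ?trmx1 ?trmx0.
by rewrite -row_permE -col_permE; apply/matrixP => i j; rewrite !mxE.
Qed.

Lemma bsim_dg_perm m (d : 'I_m -> R) (s : 'S_m) : bsim (dg d) (dg (fun i => d (s i))).
Proof.
have := bsim_perm (dg d) s; congr bsim.
by apply/matrixP => i j; rewrite !mxE (inj_eq perm_inj).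
Qed.

Lemma bsim_dg m (d d' : 'I_m -> R) : (forall i, qcong (d i) (d' i)) -> bsim (dg d) (dg d').
Proof.
move=> /choice[g gE].
have mulD (a b : 'I_m -> R) : dg a *m dg b = dg (fun i => a i *m b i).
  apply/matrixP => i j; rewrite mxE (bigD1 i) //= big1 => [|k ki].
    by rewrite addr0 !dgE eqxx; case: eqP => [->|_]; rewrite ?mulr0.
  by rewrite dgE eq_sym (negPf ki) mul0r.
have adjD (a : 'I_m -> R) : adj (dg a) = dg (fun i => (a i)^T).
  apply/matrixP => i j; rewrite adjE !dgE eq_sym.
  by case: eqP => [->//|_]; rewrite trmx0.
have qD (a : 'I_m -> R) : (forall i, quat (a i)) -> qmat (dg a).
  by move=> h i j; rewrite dgE; case: eqP.
have D1 (a : 'I_m -> R) : (forall i, a i = 1%:M) -> dg a = 1%:M.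
  by move=> h; apply/matrixP => i j; rewrite dgE !mxE; case: eqP; rewrite ?h.
exists (dg g), (dg (fun i => invmx (g i))); split; rewrite ?adjD ?mulD.
- by apply: qD => i; have [] := gE i.
- by apply: qD => i; have [/quatV_] := gE i.
- by apply: D1 => i; have [_ ug _] := gE i; rewrite mulmxV.
- by apply: D1 => i; have [_ ug _] := gE i; rewrite mulVmx.
by congr dg; apply/funext => i; have [] := gE i.
Qed.

Definition emx m (i j : 'I_m) (h : R) : 'M[R]_m :=
  \matrix_(s, t) if (s == i) && (t == j) then h else 0.

Lemma bsim_elementary m (b : 'M[R]_m) (i j : 'I_m) (h : R) : quat h -> i != j ->
  bsim b ((1%:M + emx i j h) *m b *m adj (1%:M + emx i j h)).
Proof.
move=> qh ij; set e := emx i j h.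
have qe : qmat e by move=> s t; rewrite mxE; case: ifP.
have e2 : e *m e = 0.
  apply/matrixP => s t; rewrite !mxE big1 // => k _; rewrite !mxE.
  have [->|kj] := eqVneq k j; last by rewrite andbF mul0r.
  by rewrite [j == i]eq_sym (negPf ij) mulr0.
exists (1%:M + e), (1%:M - e); split=> //.
- by move=> s t; rewrite mxE; apply: quatD_; [exact: qmat1 | exact: qe].
- by move=> s t; rewrite mxE; apply: quatD_; [exact: qmat1 | exact: (qmatN qe)].
- by rewrite mulmxDl !mulmxBr e2 !mulmx1 !mul1mx subr0 subrK.
- by rewrite mulmxDr !mulmxBl e2 !mulmx1 !mul1mx subr0 subrK.
Qed.

Lemma herm_diag_Splus m (b : 'M[R]_m) i : smat b -> adj b = b -> Sp (b i i).
Proof. by move=> sb hb; split; [rewrite -[in RHS]hb adjE | exact: sb]. Qed.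

(** If the diagonal vanishes but b_ji does not, h times row j is added to row i with h = N b_ji^-1
    and N a nonzero element of S^+; the new diagonal entry is h b_ji + (h b_ji)^T = 2N. *)
Lemma bsim_nonzero_corner m (b : 'M[R]_m.+1) : smat b -> adj b = b -> b != 0 ->
  exists2 b', bsim b b' & b' 0 0 != 0.
Proof.
move=> sb hb b0.
have bij (i : 'I_m.+1) b1 : bsim b b1 -> b1 i i != 0 -> exists2 b', bsim b b' & b' 0 0 != 0.
  move=> h nz; eexists; first exact: bsim_trans h (bsim_perm _ (tperm 0 i)).
  by rewrite mxE tpermL.
have [i|all0] := pselect (exists i, b i i != 0).
  by case: i => i; apply: bij; apply: bsim_refl.
have diag0 i : b i i = 0.
  by apply/eqP/negPn/negP => h; apply: all0; exists i.
have [i [j bji]] : exists i j, b j i != 0.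
  apply: contrapT => H; case/eqP: b0; apply/matrixP => j i; rewrite mxE.
  by apply/eqP/negPn/negP => h; apply: H; exists i, j.
have ij : i != j by apply: contraNneq bji => ->; rewrite diag0.
have ub : b j i \in unitmx by apply: skew_unit_.
have SN : Sp (smx pi conj 0 1) := Splus_smx sqt hsqrtu hE hconj 0 1.
set N := smx pi conj 0 1 in SN; pose h := N *m invmx (b j i).
have qh : quat h by apply: quat_skew_div => //; have [] := SN.
apply: (bij i _ (bsim_elementary b qh ij)).
have -> : ((1%:M + emx i j h) *m b *m adj (1%:M + emx i j h)) i i
   = N + N.
  have rowE (c : 'M[R]_m.+1) t : ((1%:M + emx i j h) *m c) i t = c i t + h *m c j t.
    rewrite mulmxDl mul1mx mxE; congr (_ + _).
    rewrite mxE (bigD1 j) //= big1 => [|k kj].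
      by rewrite mxE !eqxx addr0.
    by rewrite mxE (negPf kj) andbF mul0r.
  rewrite -[LHS]trmxK -adjE adjM adjK rowE !adjE !rowE !diag0.
  have bE : b i j = (b j i)^T by rewrite -[in LHS]hb adjE.
  rewrite mulmx0 add0r addr0 raddfD /= !trmxK trmx_mul trmxK bE -trmx_mul.
  by rewrite /h mulmxKV //; case: SN => ->.
have N0 : N != 0 by rewrite (smx_eq0 sqt hsqrtu hE hconj) oner_eq0 andbF.
rewrite -mulr2n -scaler_nat scaler_eq0 (negPf N0) orbF.
by rewrite -(rmorph_nat (in_alg E)) fmorph_eq0 (sqt_2 sqt).
Qed.

Lemma bsim_diag m (b : 'M[R]_m) : smat b -> adj b = b ->
  exists2 d, forall i, Sp (d i) & bsim b (dg d).
Proof.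
elim: m b => [|m IH] b sb hb.
  exists (fun=> 0); first by case.
  have -> : dg (fun=> 0) = b by apply/matrixP => -[].
  exact: bsim_refl.
have [->|b0] := eqVneq b 0.
  exists (fun=> 0); first by move=> i; split; [rewrite trmx0 | exact: skew0].
  have -> : dg (fun=> 0) = 0 :> 'M[R]_m.+1 by apply/matrixP => i j; rewrite !mxE if_same.
  exact: bsim_refl.
have [b1 bb1 nz] := bsim_nonzero_corner sb hb b0.
have sb1 := bsim_smat bb1 sb; have hb1 := bsim_herm bb1 hb.
have {nz} : b1 0 0 \in unitmx by apply: skew_unit_.
rewrite -[b1](@submxK _ 1 m 1 m) in bb1 sb1 hb1 *.
move: (ulsubmx _) (ursubmx _) (dlsubmx _) (drsubmx _) bb1 sb1 hb1 => a r c d bb1 sb1 hb1.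
have -> : block_mx a r c d 0 0 = a 0 0.
  by rewrite -(block_mxEul a r c d 0 0); congr (block_mx a r c d _ _); apply: val_inj.
move=> ua; have := etrans (esym (adj_block a r c d)) hb1.
move/eq_block_mx => [ha hc hr hd].
pose ai : 'M[R]_1 := (invmx (a 0 0))%:M.
have aE : a = (a 0 0)%:M by apply/matrixP => i j; rewrite !ord1 mxE eqxx.
have scal1 (x y : R) : (x%:M : 'M[R]_1) *m y%:M = (x *m y)%:M.
  by apply/matrixP => i j; rewrite !mxE big_ord_recl big_ord0 addr0 !mxE !ord1 !eqxx.
have aai : a *m ai = 1%:M by rewrite {1}aE /ai scal1 mulmxV.
have aia : ai *m a = 1%:M by rewrite {1}aE /ai scal1 mulVmx.
have hai : adj ai = ai.
  have a0T : (a 0 0)^T = a 0 0 by rewrite -adjE ha.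
  by apply/matrixP => i j; rewrite !ord1 adjE !mxE eqxx trmx_inv a0T.
(* The pivot a clears the first row and column and leaves its Schur complement [d']. *)
pose g := block_mx 1%:M 0 (- (c *m ai)) 1%:M : 'M[R]_(1 + m).
pose h := block_mx 1%:M 0 (c *m ai) 1%:M : 'M[R]_(1 + m).
pose d' := d - c *m ai *m r.
have qc : qmat (c *m ai).
  move=> i j; rewrite mxE big_ord_recl big_ord0 addr0 !ord1 /ai mxE eqxx.
  apply: quat_skew_div => //.
    have : skew (block_mx a r c d (rshift 1 i) (lshift m 0)) by apply: sb1.
    by rewrite block_mxEdl.
  have : skew (block_mx a r c d (lshift m 0) (lshift m 0)) by apply: sb1.
  by rewrite block_mxEul.
have qg : qmat g.
  by apply: (@qmat_block 1 m 1 m); [exact: qmat1 | exact: qmat0 | exact: qmatN | exact: qmat1].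
have qh : qmat h.
  by apply: (@qmat_block 1 m 1 m) => //; [exact: qmat1 | exact: qmat0 | exact: qmat1].
have gh : g *m h = 1%:M :> 'M[R]_(1 + m).
  rewrite mulmx_block !(mulmx0, mul0mx, addr0, add0r, mulmx1, mul1mx) addNr.
  by rewrite -scalar_mx_block.
have hg : h *m g = 1%:M :> 'M[R]_(1 + m).
  rewrite mulmx_block !(mulmx0, mul0mx, addr0, add0r, mulmx1, mul1mx) addrN.
  by rewrite -scalar_mx_block.
have gbg : g *m block_mx a r c d *m adj g = block_mx a 0 0 d' :> 'M[R]_(1 + m).
  rewrite adj_block !adj1 adj0 adjN adjM hai hc !mulmx_block.
  rewrite !(mulmx0, mul0mx, addr0, add0r, mulmx1, mul1mx) !mulNmx !mulmxN.
  rewrite -[c *m ai *m a]mulmxA aia mulmx1 addNr mul0mx oppr0 add0r mulmxA aai mul1mx addNr.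
  by rewrite addrC.
have bb2 : bsim b (block_mx a 0 0 d').
  by apply: bsim_trans bb1 _; exists g, h; split.
have sb2 := bsim_smat bb2 sb; have hb2 := bsim_herm bb2 hb.
have [||e Se de] := IH d'.
- move=> i j; have : skew (block_mx a 0 0 d' (rshift 1 i) (rshift 1 j)) by apply: sb2.
  by rewrite block_mxEdr.
- by have := etrans (esym (adj_block a 0 0 d')) hb2; move/eq_block_mx => [].
pose f (i : 'I_m.+1) := if unlift 0 i is Some j then e j else a 0 0.
have f0 : f 0 = a 0 0 by rewrite /f unlift_none.
have fS j : f (lift 0 j) = e j by rewrite /f liftK.
exists f.
  move=> i; rewrite /f; case: unliftP => [j _|_]; first exact: Se.
  have : Sp (block_mx a 0 0 d' (lshift m 0) (lshift m 0)) by apply: herm_diag_Splus.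
  by rewrite block_mxEul.
apply: bsim_trans bb2 _.
have -> : dg f = block_mx a 0 0 (dg e).
  have e1 : dg (fun i : 'I_1 => f (lshift m i)) = a.
    by apply/matrixP => i j; rewrite !ord1 dgE eqxx -f0; congr f; apply: val_inj.
  have e2 : dg (fun j : 'I_m => f (rshift 1 j)) = dg e.
    by congr dg; apply/funext => j; rewrite -fS; congr f; apply: val_inj.
  by rewrite (@dg_split _ 1 m f) e1 e2.
by apply: (@bsim_block 1 m) => //; apply: bsim_refl.
Qed.

End BlockForms.

(** * Diagonal forms and the classes of their entries *)

Lemma perm_of_fibers (T : eqType) m (f g : 'I_m -> T) :
  (forall t, \sum_i (f i == t) = \sum_i (g i == t))%N ->
  exists s : 'S_m, forall i, f (s i) = g i.
Proof.
move=> h; have /tuple_permP[s sE] : perm_eq [tuple g i | i < m] [tuple f i | i < m].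
  have C (k : 'I_m -> T) t : count_mem t [tuple k i | i < m] = (\sum_i (k i == t))%N.
    rewrite -sum1_count big_map big_mkcond big_enum /=.
    by apply: eq_bigr => i _; case: eqP.
  by apply/allP => t _; apply/eqP; rewrite /= !C h.
exists s => i; have /(congr1 (fun w => nth (f i) w i)) := sE.
by rewrite -!tnth_nth !tnth_mktuple.
Qed.

Section BlockTypes.
Variables (F : fieldType) (pi u : F).
Hypothesis sqt : square_theory pi u.
Variables (E : fieldExtType F) (sqrtu : E).
Hypotheses (hsqrtu : sqrtu ^+ 2 = u%:A) (hE : <<1%AS; sqrtu>>%VS = {:E}%VS).
Variable conj : {lrmorphism E -> E}.
Hypothesis hconj : conj sqrtu = - sqrtu.

Local Notation R := ('M[E]_2).
Local Notation quat := (quat pi conj).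
Local Notation skew := (skew pi conj).
Local Notation Sp := (Splus pi conj).
Local Notation qcong := (qcong pi conj).
Local Notation bsim := (bsim pi conj).
Local Notation class M l := (square_class (- \det (M : R)) (sq_rep pi u l)).

(* [cl M = Some l] when -det M has the class of the l-th entry of [sq_rep]. *)
Definition cl (M : R) : option 'I_3 :=
  if M == 0 then None else [pick l | `[< class M l >]].

Lemma cl_None M : Sp M -> (cl M == None) = (M == 0).
Proof.
move=> SM; rewrite /cl; have [//|M0] := eqVneq M 0.
have [l hl] := Splus_class sqt hsqrtu hE hconj SM M0.
case: pickP => // /(_ l); by rewrite asboolT.
Qed.

Lemma cl_Some M l : class M l -> cl M = Some l.
Proof.
move=> hl; have M0 := square_class_neq0 sqt hsqrtu hE hconj hl.
rewrite /cl (negPf M0); case: pickP => [l' /asboolP hl'|/(_ l)]; last by rewrite asboolT.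
by congr Some; apply: (square_class_inj sqt hsqrtu hE hconj hl' hl).
Qed.

Lemma cl_class M l : cl M = Some l -> class M l.
Proof. by rewrite /cl; case: eqP => // _; case: pickP => // l' /asboolP hl [<-]. Qed.

Lemma qcong_cl M M' : Sp M -> Sp M' -> cl M = cl M' -> qcong M M'.
Proof.
move=> SM SM' E1; case E2 : (cl M) => [l|].
  have hl := cl_class E2; rewrite E1 in E2.
  exact: (qcong_class sqt hsqrtu hE hconj SM SM' hl (cl_class E2)).
have /eqP := E2; rewrite cl_None // => /eqP ->; rewrite E1 in E2.
have /eqP := E2; rewrite cl_None // => /eqP ->.
exact: (qcong_refl sqt hsqrtu hE hconj).
Qed.

Let diag2 (M N : R) : 'M[R]_2 := dg (fun i => if i == 0 then M else N).

(** The form diag(N, -N) is the hyperbolic plane with off-diagonal blocks N, and diag(1, M' M^-1),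
    with M' M^-1 in D, carries the plane of M to that of M'. *)
Lemma bsim_hyperbolic (M M' : R) : Sp M -> Sp M' -> M != 0 -> M' != 0 ->
  bsim (diag2 M (- M)) (diag2 M' (- M')).
Proof.
move=> SM SM' M0 M0'.
pose H (p q r s : R) : 'M[R]_2 := \matrix_(i, j)
  if i == 0 then (if j == 0 then p else q) else (if j == 0 then r else s).
have HE p q r s : (H p q r s 0 0 = p) * (H p q r s 0 1 = q) * (H p q r s 1 0 = r)
  * (H p q r s 1 1 = s) by rewrite !mxE.
have dE p q : (diag2 p q 0 0 = p) * (diag2 p q 0 1 = 0) * (diag2 p q 1 0 = 0)
  * (diag2 p q 1 1 = q) by rewrite !mxE.
have I2E : ((1%:M : 'M[R]_2) 0 0 = 1) * ((1%:M : 'M[R]_2) 0 1 = 0)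
  * ((1%:M : 'M[R]_2) 1 0 = 0) * ((1%:M : 'M[R]_2) 1 1 = 1) by rewrite !mxE.
pose w : R := (2^-1)%:M.
have two0 : 2 != 0 :> E.
  by rewrite -(rmorph_nat (in_alg E)) fmorph_eq0 (sqt_2 sqt).
have ww : w + w = 1.
  by rewrite /w -raddfD /= (_ : _ + _ = 1) //; field.
have qw : quat w.
  rewrite /quat /w map_scalar_mx /= fmorphV rmorph_nat.
  by rewrite mul_mx_scalar mul_scalar_mx.
have qH p q r s : quat p -> quat q -> quat r -> quat s -> qmat pi conj (H p q r s).
  by move=> *; move=> i j; rewrite mxE; case: ifP => _; case: ifP.
have q1 := quat1 sqt hsqrtu hE hconj; have q0 := quat0 sqt hsqrtu hE hconj.
have qN := quatN sqt hsqrtu hE hconj.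
have wM (A : R) : w * A = A * w by rewrite -!mulmxE /w mul_mx_scalar mul_scalar_mx.
have wT : w^T = w by rewrite /w tr_scalar_mx.
have h1 N : Sp N -> bsim (diag2 N (- N)) (H 0 N N 0).
  (* The rows e_1 + e_2 and (e_1 - e_2)/2 are isotropic for diag(N, -N) and pair to N. *)
  move=> SN; exists (H 1 1 w (- w)), (H w 1 w (- 1)); split.
  - by apply: qH => //; apply: qN.
  - by apply: qH => //; apply: qN.
  - apply: mx2P; rewrite !mulmx2E !HE !I2E ?mul1r ?mulr1 ?ww ?subrr //.
      by rewrite mulNr subrr.
    by rewrite mulrN mulNr mulr1 opprK ww.
  - apply: mx2P; rewrite !mulmx2E !HE !I2E ?mul1r ?mulr1 ?ww ?subrr //.
      by rewrite mulN1r subrr.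
    by rewrite mulN1r opprK ww.
  have tr1 : (1 : R)^T = 1 by apply: trmx1.
  have trN (A : R) : (- A)^T = - A^T by rewrite raddfN.
  apply: mx2P; rewrite !mulmx2E !adjE !HE !dE ?wT ?trN ?wT ?tr1 !(mulr0, mul0r, addr0, add0r,
    mul1r, mulr1).
  - by rewrite subrr.
  - by rewrite mulrN mulNr opprK -mulrDr ww mulr1.
  - by rewrite mulrN mulNr opprK -mulrDl ww mul1r.
  by rewrite mulrNN mulrN subrr.
have SpN (N : R) : Sp N -> N != 0 -> N \in unitmx.
  by case=> _ kN; apply: (skew_unit sqt hsqrtu hE hconj).
have h2 : bsim (H 0 M M 0) (H 0 M' M' 0).
  pose q : R := M' *m invmx M; pose q' : R := M *m invmx M'.
  have uM := SpN _ SM M0; have uM' := SpN _ SM' M0'.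
  exists (H 1 0 0 q), (H 1 0 0 q'); split.
  - by apply: qH => //; apply: (quat_skew_div sqt hsqrtu hE hconj) => //; case: SM' SM => _ ? [].
  - by apply: qH => //; apply: (quat_skew_div sqt hsqrtu hE hconj) => //; case: SM' SM => _ ? [].
  - apply: mx2P; rewrite !mulmx2E !HE !I2E ?(mulr0, mul0r, addr0, add0r, mul1r) //.
    by rewrite -mulmxE /q /q' mulmxA mulmxKV // mulmxV.
  - apply: mx2P; rewrite !mulmx2E !HE !I2E ?(mulr0, mul0r, addr0, add0r, mul1r) //.
    by rewrite -mulmxE /q /q' mulmxA mulmxKV // mulmxV.
  have tr1 : (1 : R)^T = 1 by apply: trmx1.
  have tr0 : (0 : R)^T = 0 by apply: trmx0.
  have qM : q * M = M' by rewrite -mulmxE /q mulmxKV.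
  have Mq : M * q^T = M'.
    by case: SM SM' => sM _ [sM' _]; rewrite -mulmxE -{1}sM -trmx_mul /q mulmxKV.
  by apply: mx2P; rewrite !mulmx2E !adjE !HE ?tr1 ?tr0
    !(mulr0, mul0r, addr0, add0r, mul1r, mulr1) ?qM ?Mq ?mulr0 ?mul0r.
apply: (bsim_trans sqt hsqrtu hE hconj) (h1 _ SM) _.
apply: (bsim_trans sqt hsqrtu hE hconj) h2 _.
exact/(bsim_sym sqt hsqrtu hE hconj)/h1.
Qed.

Definition ntype m (d : 'I_m -> R) t := (\sum_i (cl (d i) == t))%N.

Lemma bsim_same_types m (d d' : 'I_m -> R) : (forall i, Sp (d i)) -> (forall i, Sp (d' i)) ->
  (forall t, ntype d t = ntype d' t) -> bsim (dg d) (dg d').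
Proof.
move=> Sd Sd' h; have [s sE] := perm_of_fibers h.
apply: (bsim_trans sqt hsqrtu hE hconj) (bsim_dg_perm sqt hsqrtu hE hconj d s) _.
apply: (bsim_dg sqt hsqrtu hE hconj) => i.
exact: qcong_cl.
Qed.

Lemma ntype_sum m (d : 'I_m -> R) :
  (ntype d None + ntype d (Some 0%R) + ntype d (Some 1%R) + ntype d (Some 2%:R))%N = m.
Proof.
rewrite /ntype -!big_split /= -[RHS]card_ord -sum1_card; apply: eq_bigr => i _.
by case: (cl _) => [l|] //; case: (ord3P l) => ->.
Qed.

(** For matrices of size 2, det (-M) = det M. Hence of two blocks of class l the second may be
    replaced by the opposite of the first, and the resulting pair by M1, -M1, both of class 1. *)
Lemma bsim_reduce m (d : 'I_m -> R) l : l != 0 -> (forall i, Sp (d i)) ->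
  (1 < ntype d (Some l))%N -> exists d', [/\ forall i, Sp (d' i), bsim (dg d) (dg d')
    & forall t, ntype d' t = if t == Some l then (ntype d t - 2)%N
                             else if t == Some 0 then (ntype d t + 2)%N else ntype d t].
Proof.
move=> l0 Sd nl.
have [i [j [ij ci cj]]] : exists i j, [/\ i != j, cl (d i) = Some l & cl (d j) = Some l].
  move: nl; rewrite /ntype (_ : (\sum_i _)%N = #|[pred i | cl (d i) == Some l]|); last first.
    by rewrite -sum1_card [RHS]big_mkcond; apply: eq_bigr => i _; rewrite inE; case: eqP.
  by case/card_gt1P => i [j [/eqP ci /eqP cj ij]]; exists i, j.
case: m d Sd nl i j ij ci cj => [|[|m]] d Sd nl i j ij ci cj.
- by case: (i).
- by move: ij; rewrite !ord1 eqxx.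
pose o1 : 'I_m.+2 := lift 0 0.
(* A permutation sending the first two indices to i and j; the second transposition accounts for the
   displacement of index 1 by the first. *)
pose s : 'S_m.+2 := (tperm 0 i * tperm (tperm 0 i o1) j)%g.
have [t tE] : exists s : 'S_m.+2, s 0 = i /\ s o1 = j.
  have ne : tperm 0 i o1 != i by rewrite -{2}(tpermL 0 i) (inj_eq perm_inj).
  exists s; rewrite /s !permM tpermL tpermL; split=> //.
  by apply: tpermD => //; rewrite eq_sym.
case: tE => t0 t1; pose d1 k := d (t k).
have [M1 S1 c1] := class_exists sqt hsqrtu hE hconj 0.
have SN (M : R) : Sp M -> Sp (- M).
  by case=> sM kM; split; [rewrite raddfN /= sM | exact: (skewN sqt hsqrtu hE hconj)].
have detN (M : R) : \det (- M) = \det M by rewrite -scaleN1r detZ sqrrN expr1n mul1r.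
have M10 := square_class_neq0 sqt hsqrtu hE hconj c1.
have hl := cl_class ci.
have di0 := square_class_neq0 sqt hsqrtu hE hconj hl.
pose d2 (k : 'I_m.+2) := if k == 0 then M1 else if k == o1 then - M1 else d1 k.
have S2 k : Sp (d2 k).
  by rewrite /d2; case: ifP => _ //; case: ifP => _; [exact: SN | exact: Sd].
exists d2; split=> //.
  apply: (bsim_trans sqt hsqrtu hE hconj) (bsim_dg_perm sqt hsqrtu hE hconj d t) _.
  pose d1' (k : 'I_m.+2) := if k == o1 then - d i else d1 k.
  apply: (@bsim_trans _ _ _ sqt _ _ hsqrtu hE _ hconj _ (dg d1')).
    apply: (bsim_dg sqt hsqrtu hE hconj) => k; rewrite /d1'; case: eqP => [->|_].
      apply: qcong_cl; [exact: Sd | exact/SN/Sd |].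
      by rewrite t1 cj; apply/esym/cl_Some; rewrite detN.
    exact: (qcong_refl sqt hsqrtu hE hconj).
  rewrite (@dg_split _ 2 m d1') (@dg_split _ 2 m d2).
  have -> : dg (fun k => d2 (rshift 2 k)) = dg (fun k => d1' (rshift 2 k)).
    by congr dg; apply/funext => k; rewrite /d2 /d1'; case: eqP.
  apply: (@bsim_block _ _ _ sqt _ _ hsqrtu hE _ hconj 2 m);
    last exact: (bsim_refl sqt hsqrtu hE hconj).
  have dE (f : 'I_m.+2 -> R) p q : f (lshift m (0 : 'I_2)) = p -> f (lshift m (1 : 'I_2)) = q ->
      dg (fun k : 'I_2 => f (lshift m k)) = diag2 p q.
    move=> fp fq; congr dg; apply/funext => -[[|[|//]] hk] /=.
      by rewrite -fp; congr f; apply: val_inj.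
    by rewrite -fq; congr f; apply: val_inj.
  have e0 : lshift m (0 : 'I_2) = 0 :> 'I_m.+2 by apply: val_inj.
  have e1 : lshift m (1 : 'I_2) = o1 :> 'I_m.+2 by apply: val_inj.
  rewrite (dE d1' (d i) (- d i)); last 2 first.
  - by rewrite e0 /d1' /d1 /= t0.
  - by rewrite e1 /d1' eqxx.
  rewrite (dE d2 M1 (- M1)); last 2 first.
  - by rewrite e0 /d2.
  - by rewrite e1 /d2 eqxx.
  exact: bsim_hyperbolic.
move=> c; have E1 : ntype d c = ((Some l == c) + (Some l == c) + \sum_(k < m) (cl (d1 (lift ord0
  (lift ord0 k))) == c))%N.
  rewrite /ntype (reindex_inj (@perm_inj _ t)) /= big_ord_recl big_ord_recl addnA.
  by rewrite t0 ci -/o1 t1 cj.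
have E2 : ntype d2 c = ((Some (0%R : 'I_3) == c) + (Some (0%R : 'I_3) == c) + \sum_(k < m) (cl (d1
  (lift ord0 (lift ord0 k))) == c))%N.
  rewrite /ntype big_ord_recl big_ord_recl addnA -/o1 /d2 eqxx /=.
  rewrite (cl_Some c1) (cl_Some (_ : class (- M1) 0)) ?detN //.
rewrite E1 E2 !(eq_sym c).
have [<-|nlc] := eqVneq (Some l) c.
  by rewrite (inj_eq (@Some_inj _)) eq_sym (negPf l0) add0n addnC addnK.
by have [<-|n0c] := eqVneq (Some 0%R) c; rewrite ?add0n // addnC.
Qed.

Lemma bsim_canonical m (d : 'I_m -> R) : (forall i, Sp (d i)) -> exists d',
  [/\ forall i, Sp (d' i), bsim (dg d) (dg d'), ntype d' None = ntype d None
    & forall l, l != 0 -> ntype d' (Some l) = odd (ntype d (Some l))].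
Proof.
have [N hN] := ubnP (ntype d (Some 1%R) + ntype d (Some 2%:R))%N.
elim: N d hN => // N IH d hN Sd.
have [h|nh0] := pselect (exists l, l != 0 /\ (1 < ntype d (Some l))%N); last first.
  have nh l : ~ (l != 0 /\ (1 < ntype d (Some l))%N) by move=> h; apply: nh0; exists l.
  exists d; split=> //; first exact: (bsim_refl sqt hsqrtu hE hconj).
  move=> l l0; have := nh l; case: (ntype d (Some l)) => [|[|k]] // H.
  by case: H.
case: h => l [l0 nl]; have [d1 [S1 b1 n1]] := bsim_reduce l0 Sd nl.
have [||d2 [S2 b2 nN n2]] := IH d1 => //.
  rewrite !n1 /=; move: nl hN.
  by case: (ord3P l) l0 => -> // _ /=; move: (ntype _ _) (ntype _ _) => x y; lia.
exists d2; split=> //; first exact: (bsim_trans sqt hsqrtu hE hconj) b1 b2.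
  by rewrite nN n1.
move=> l' l0'; rewrite (n2 _ l0') n1; case: eqP => [->|_].
  by rewrite oddB // addbF.
by rewrite (inj_eq (@Some_inj _)) (negPf l0').
Qed.

(** In canonical form the numbers of blocks of classes pi and u pi are 0 or 1; the number of blocks
    of class 1 then follows from the total m. *)
Lemma bsim_types m (d d' : 'I_m -> R) : (forall i, Sp (d i)) -> (forall i, Sp (d' i)) ->
  ntype d None = ntype d' None ->
  (forall l, l != 0 -> odd (ntype d (Some l)) = odd (ntype d' (Some l))) ->
  bsim (dg d) (dg d').
Proof.
move=> Sd Sd' hN ho; have [e [Se be eN eo]] := bsim_canonical Sd.
have [e' [Se' be' eN' eo']] := bsim_canonical Sd'.
apply: (bsim_trans sqt hsqrtu hE hconj) be _.
apply: (bsim_trans sqt hsqrtu hE hconj) _ (bsim_sym sqt hsqrtu hE hconj be').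
apply: bsim_same_types => //.
have H1 : ntype e (Some 1%R) = ntype e' (Some 1%R) by rewrite eo // eo' // ho.
have H2 : ntype e (Some 2%:R) = ntype e' (Some 2%:R) by rewrite eo // eo' // ho.
have H0 : ntype e None = ntype e' None by rewrite eN eN'.
case=> [l|] //; case: (ord3P l) => -> //.
by have := etrans (ntype_sum e) (esym (ntype_sum e')); rewrite H0 H1 H2 => /addIn/addIn/addnI.
Qed.

End BlockTypes.
(** * Nilpotent matrices and generators of GL_n *)

Section NilpotentMatrices.
Variable K : fieldType.

Lemma nilpotent_dim d (A : 'M[K]_d) n : A ^+ n = 0 -> A ^+ d = 0.
Proof.
case: d A => [|d] A An; first by apply/matrixP => -[].
have : mxminpoly A %| ('X - 0%:P) ^+ n.
  by apply: mxminpoly_min; rewrite subr0 rmorphXn /= horner_mx_X.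
case/dvdp_exp_XsubCP => k kn; rewrite subr0 => Ek.
have E : mxminpoly A = 'X^k.
  by apply/eqP; rewrite -eqp_monic ?mxminpoly_monic ?monicXn.
have Ak : A ^+ k = 0.
  by have := mx_root_minpoly A; rewrite E rmorphXn /= horner_mx_X.
have kd : (k <= d.+1)%N.
  have := dvdp_leq _ (mxminpoly_dvd_char A).
  by rewrite E size_polyXn size_char_poly ltnS monic_neq0 ?char_poly_monic //; apply.
have -> : A ^+ d.+1 = A ^+ (d.+1 - k) * A ^+ k by rewrite -exprD subnK.
by rewrite Ak mulr0.
Qed.

Lemma nilpotent_ge d (A : 'M[K]_d) m : nilpotent_mx A -> (d <= m)%N -> A ^+ m = 0.
Proof. by move=> [n /nilpotent_dim Ad] dm; rewrite -(subnK dm) exprD Ad mulr0. Qed.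

Lemma nilpotentN d (A : 'M[K]_d) : nilpotent_mx A -> nilpotent_mx (- A).
Proof. by case=> n An; exists n; rewrite exprNn An mulr0. Qed.

End NilpotentMatrices.

Lemma triangular_sum (V : nmodType) (t : nat -> nat -> V) M :
  \sum_(0 <= m < M) \sum_(0 <= i < m.+1) t (m - i)%N i
  = \sum_(0 <= i < M) \sum_(0 <= j < M - i) t j i.
Proof.
elim: M => [|M IH]; first by rewrite !big_geq.
rewrite big_nat_recr //= IH [RHS]big_nat_recr //= subSnn big_nat1.
rewrite [X in _ + X]big_nat_recr //= subnn addrA; congr (_ + _).
rewrite -big_split /= big_nat [RHS]big_nat; apply: eq_bigr => i /andP[_ iM].
by rewrite subSn ?big_nat_recr //= ltnW.
Qed.

Section NilpotentExponential.
Variable K : fieldType.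
Hypothesis natr0 : forall n, (0 < n)%N -> n%:R != 0 :> K.

Let factr0 n : (n`!)%:R != 0 :> K.
Proof. exact/natr0/fact_gt0. Qed.

(** The order M of truncation is free, so that exponentials of matrices of different sizes can be
    cut at the same order. *)
Definition exp_sum d (A : 'M[K]_d) M := \sum_(0 <= n < M) (n`!%:R)^-1 *: A ^+ n.

(** The product of the two sums runs over a square of exponents, the binomial expansion over the
    triangle i + j < r + s; outside the triangle either a^j or b^i vanishes. *)
Lemma exp_sum_comm d (a b : 'M[K]_d) r s : a *m b = b *m a -> a ^+ r = 0 -> b ^+ s = 0 ->
  exp_sum (a + b) (r + s) = exp_sum a (r + s) *m exp_sum b (r + s).
Proof.
move=> ab ar bs; pose t i j := ((i`!%:R)^-1 * (j`!%:R)^-1) *: (a ^+ i *m b ^+ j).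
rewrite /exp_sum mulmx_sumr.
have -> : \sum_(0 <= m < r + s) (m`!%:R)^-1 *: (a + b) ^+ m
   = \sum_(0 <= m < r + s) \sum_(0 <= i < m.+1) t (m - i)%N i.
  apply: eq_bigr => m _; rewrite exprDn_comm // scaler_sumr big_mkord.
  apply: eq_bigr => i _; rewrite -scaler_nat scalerA /t; congr (_ *: _).
  have im : (i <= m)%N by rewrite -ltnS.
  rewrite -(bin_fact im) !natrM; field.
  by rewrite !factr0 natr0 // bin_gt0.
rewrite triangular_sum big_nat [RHS]big_nat; apply: eq_bigr => i /andP[_ iM].
rewrite mulmx_suml [RHS](@big_cat_nat _ _ _ (r + s - i)%N) ?leq_subr //=.
rewrite -[LHS]addr0; congr (_ + _).
  by apply: eq_bigr => j _; rewrite /t -scalemxAr -scalemxAl scalerA mulrC.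
rewrite big_nat big1 // => j /andP[jM _].
have [ir|ir] := leqP s i.
  by rewrite -(subnK ir) exprD bs mulr0 scaler0 mulmx0.
have rj : (r <= j)%N by lia.
by rewrite -(subnK rj) exprD ar mulr0 scaler0 mul0mx.
Qed.

Lemma exp_sum_ge d (A : 'M[K]_d) M : nilpotent_mx A -> (d < M)%N -> exp_sum A M = exp_mx A.
Proof.
move=> nA dM; rewrite /exp_mx -(big_mkord xpredT (fun n => (n`!%:R)^-1 *: A ^+ n)).
rewrite /exp_sum (@big_cat_nat _ _ _ d.+1) //= -[RHS]addr0; congr (_ + _).
by rewrite big_nat big1 // => i /andP[di _]; rewrite (nilpotent_ge nA) ?scaler0 // ltnW.
Qed.

Lemma exp_mxN d (A : 'M[K]_d) : nilpotent_mx A -> exp_mx A *m exp_mx (- A) = 1%:M.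
Proof.
move=> nA; have nN := nilpotentN nA; have Ad := nilpotent_ge nA (leqnn d).
have Nd := nilpotent_ge nN (leqnn d).
have cAN : A *m - A = - A *m A by rewrite mulmxN mulNmx.
have A1 := nilpotent_ge nA (leqnSn d); have N1 := nilpotent_ge nN (leqnSn d).
have := exp_sum_comm cAN A1 N1.
rewrite (exp_sum_ge nA) ?(exp_sum_ge nN) ?addSn ?ltnS ?leq_addr // => <-.
rewrite addrN /exp_sum big_nat_recl // fact0 invr1 expr0 scale1r big1 ?addr0 // => i _.
by rewrite expr0n scaler0.
Qed.

(* [Ad (exp Y) = exp (ad Y)]: left and right multiplication by Y commute. *)
Lemma exp_sum_ad d (Y Z : 'M[K]_d) M : nilpotent_mx Y -> (d.+1 + d.+1 <= M)%N ->
  \sum_(0 <= n < M) (n`!%:R)^-1 *: iter n (fun Z => Y *m Z - Z *m Y) Z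
  = exp_mx Y *m Z *m exp_mx (- Y).
Proof.
move=> nY dM; have nN := nilpotentN nY.
pose a := lin_mulmx Y : 'M[K]_(d * d); pose b := lin_mulmxr (- Y) : 'M[K]_(d * d).
have aE n T : mxvec T *m a ^+ n = mxvec (Y ^+ n *m T).
  elim: n T => [|n IH] T; first by rewrite expr0 mulmx1 mul1mx.
  by rewrite exprS -mulmxE mulmxA mul_vec_lin IH /= exprSr -mulmxE -mulmxA.
have bE n T : mxvec T *m b ^+ n = mxvec (T *m (- Y) ^+ n).
  elim: n T => [|n IH] T; first by rewrite expr0 !mulmx1.
  by rewrite exprS -mulmxE mulmxA mul_vec_lin IH /= exprS -mulmxE -mulmxA.
have a1 T : mxvec T *m a = mxvec (Y *m T) by have := aE 1%N T; rewrite !expr1.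
have b1 T : mxvec T *m b = mxvec (T *m - Y) by have := bE 1%N T; rewrite !expr1.
have ext (A B : 'M[K]_(d * d)) : (forall T, mxvec T *m A = mxvec T *m B) -> A = B.
  by move=> h; apply/row_matrixP => i; rewrite !rowE -[delta_mx _ _]vec_mxK h.
have ab : a *m b = b *m a.
  by apply: ext => T; rewrite !mulmxA a1 b1 b1 a1 mulmxA.
have nil n (A : 'M[K]_d) : nilpotent_mx A -> (d <= n)%N -> A ^+ n = 0 by apply: nilpotent_ge.
have ME : M = (M - d.+1 + d.+1)%N by rewrite subnK //; lia.
have ar : a ^+ (M - d.+1) = 0.
  by apply: ext => T; rewrite aE (nil _ _ nY) ?mul0mx ?mulmx0 ?linear0 //; lia.
have bs : b ^+ d.+1 = 0.
  by apply: ext => T; rewrite bE (nil _ _ nN) ?mulmx0 ?linear0.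
have iterE n : mxvec (iter n (fun Z => Y *m Z - Z *m Y) Z) = mxvec Z *m (a + b) ^+ n.
  elim: n => [|n IH]; first by rewrite expr0 mulmx1.
  by rewrite exprSr -mulmxE mulmxA -IH mulmxDr iterS a1 b1 mulmxN -raddfD.
have expE (c : 'M[K]_(d * d)) T : mxvec T *m exp_sum c M
    = \sum_(0 <= n < M) (n`!%:R)^-1 *: (mxvec T *m c ^+ n).
  by rewrite mulmx_sumr; apply: eq_bigr => n _; rewrite scalemxAr.
apply: (can_inj mxvecK).
transitivity (mxvec Z *m exp_sum (a + b) M).
  rewrite expE raddf_sum; apply: eq_bigr => n _ /=.
  by rewrite linearZ /= iterE.
rewrite ME (exp_sum_comm ab ar bs) -ME mulmxA expE.
have -> : \sum_(0 <= n < M) (n`!%:R)^-1 *: (mxvec Z *m a ^+ n) = mxvec (exp_mx Y *m Z).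
  rewrite -(exp_sum_ge (M := M) nY); last by lia.
  rewrite mulmx_suml raddf_sum; apply: eq_bigr => n _ /=.
  by rewrite aE -scalemxAl linearZ.
rewrite expE -(exp_sum_ge (M := M) nN); last by lia.
rewrite mulmx_sumr raddf_sum; apply: eq_bigr => n _ /=.
by rewrite bE -scalemxAr linearZ.
Qed.

End NilpotentExponential.

Section Generation.
Variable K : fieldType.

Lemma mx_center n (M : 'M[K]_n) : (forall i j, M *m delta_mx i j = delta_mx i j *m M) ->
  exists c, M = c%:M.
Proof.
case: n M => [|n] M H; first by exists 0; rewrite flatmx0; apply/esym/flatmx0.
exists (M 0 0); apply/matrixP => a b.
have E i j c d : (M c i) *+ (d == j) = (M j d) *+ (c == i).
  have := congr1 (fun A : 'M_n.+1 => A c d) (H i j).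
  rewrite !mxE (bigD1 i) //= big1 ?addr0 => [|k ki]; last by rewrite mxE (negPf ki) mulr0.
  rewrite (bigD1 j) //= big1 ?addr0 => [|k kj]; last by rewrite mxE (negPf kj) andbF mul0r.
  rewrite !mxE !eqxx andbT /= mulr_natr mulr_natl; exact.
rewrite mxE; have [->|ab] := eqVneq a b.
  by have := E b 0 b 0; rewrite !eqxx.
by have := E b b a b; rewrite eqxx (negPf ab).
Qed.

(* Gaussian elimination; a nonzero pivot is created by a transvection if necessary. *)
Lemma unitmx_generated n (S : 'M[K]_n -> Prop) :
  (forall a b, S a -> S b -> S (a *m b)) ->
  (forall e, e *m e = 0 -> S (1%:M + e)) ->
  (forall d : 'rV_n, diag_mx d \in unitmx -> S (diag_mx d)) ->
  forall g, g \in unitmx -> S g.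
Proof.
elim: n S => [|n IH] S SM S1 Sd g ug.
  have -> : g = 1%:M + 0 by rewrite addr0; apply/matrixP => -[].
  by apply: S1; rewrite mulmx0.
have Sblock (d : 'M[K]_n) : d \in unitmx -> S (block_mx 1%:M 0 0 d : 'M_(1 + n)).
  pose S' (d : 'M[K]_n) := S (block_mx 1%:M 0 0 d : 'M_(1 + n)).
  apply: (IH S').
  - move=> a b Sa Sb; rewrite /S'.
    have -> : block_mx 1%:M 0 0 (a *m b)
        = block_mx 1%:M 0 0 a *m block_mx 1%:M 0 0 b :> 'M[K]_(1 + n).
      by rewrite mulmx_block !(mulmx0, mul0mx, addr0, add0r, mulmx1).
    exact: SM.
  - move=> e e2; rewrite /S'.
    have -> : block_mx 1%:M 0 0 (1%:M + e) = 1%:M + block_mx 0 0 0 e :> 'M[K]_(1 + n).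
      by rewrite scalar_mx_block add_block_mx !addr0.
    have E2 : block_mx (0 : 'M_1) 0 0 e *m block_mx 0 0 0 e = 0 :> 'M[K]_(1 + n).
      by rewrite mulmx_block !(mulmx0, mul0mx, addr0, add0r) e2 block_mx0.
    exact: S1 E2.
  move=> v uv; rewrite /S'.
  have E : block_mx 1%:M 0 0 (diag_mx v) = diag_mx (row_mx 1%:M v) :> 'M[K]_(1 + n).
    rewrite diag_mx_row (_ : diag_mx 1%:M = 1%:M) //.
    by apply/matrixP => i j; rewrite !ord1 !mxE eqxx.
  have U : diag_mx (row_mx 1%:M v) \in unitmx :> bool.
    by rewrite -E unitmxE det_ublock det1 mul1r -unitmxE.
  by rewrite E; apply: Sd U.
have Spivot (h : 'M[K]_(1 + n)) : h \in unitmx -> h 0 0 != 0 -> S h.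
  rewrite -[h](@submxK _ 1 n 1 n); move: (ulsubmx h) (ursubmx h) (dlsubmx h) (drsubmx h).
  move=> a b c d uh; have -> : block_mx a b c d 0 0 = a 0 0.
    by rewrite -(block_mxEul a b c d 0 0); congr (block_mx a b c d _ _); apply: val_inj.
  move=> a0; have ua : a \in unitmx by rewrite unitmxE det_mx11 unitfE.
  pose l := block_mx 1%:M 0 (c *m invmx a) 1%:M : 'M[K]_(1 + n).
  pose r := block_mx 1%:M (invmx a *m b) 0 1%:M : 'M[K]_(1 + n).
  pose v := row_mx a (const_mx 1) : 'rV[K]_(1 + n).
  have hE : block_mx a b c d = l *m (diag_mx v *m block_mx 1%:M 0 0 (d - c *m invmx a *m b)) *m r.
    rewrite /v diag_mx_row diag_const_mx (_ : diag_mx a = a); last first.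
      by apply/matrixP => i j; rewrite !ord1 !mxE eqxx.
    rewrite /l /r !mulmx_block !(mulmx0, mul0mx, addr0, add0r, mulmx1, mul1mx).
    by rewrite mulKVmx // mulmxKV // mulmxA addrC subrK.
  rewrite hE in uh *; move: uh; rewrite !unitmx_mul => /andP[/andP[ul /andP[uv ud]] ur].
  have Sl : S l.
    have -> : l = 1%:M + block_mx 0 0 (c *m invmx a) 0 :> 'M[K]_(1 + n).
      by rewrite scalar_mx_block add_block_mx !addr0 !add0r.
    have E2 : block_mx (0 : 'M_1) 0 (c *m invmx a) 0 *m block_mx 0 0 (c *m invmx a) 0
        = 0 :> 'M[K]_(1 + n).
      by rewrite mulmx_block !(mulmx0, mul0mx, addr0, add0r) block_mx0.
    exact: S1 E2.
  have Sr : S r.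
    have -> : r = 1%:M + block_mx 0 (invmx a *m b) 0 0 :> 'M[K]_(1 + n).
      by rewrite scalar_mx_block add_block_mx !addr0 !add0r.
    have E2 : block_mx (0 : 'M_1) (invmx a *m b) 0 0 *m block_mx 0 (invmx a *m b) 0 (0 : 'M_n)
        = 0 :> 'M[K]_(1 + n).
      by rewrite mulmx_block !(mulmx0, mul0mx, addr0, add0r) block_mx0.
    exact: S1 E2.
  have Sv : S (diag_mx v) := Sd _ uv.
  have Sd' : S (block_mx (1%:M : 'M_1) 0 0 (d - c *m invmx a *m b) : 'M_(1 + n)).
    by apply: Sblock; move: ud; rewrite !unitmxE det_ublock det1 mul1r.
  exact: SM (SM _ _ Sl (SM _ _ Sv Sd')) Sr.
have [g00|] := eqVneq (g 0 0) 0; last exact: Spivot.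
have [i gi] : exists i, g i 0 != 0.
  apply: contrapT => H; have : \det g = 0.
    rewrite (expand_det_col _ 0) big1 // => i _.
    have -> : g i 0 = 0 by apply/eqP/negPn/negP => h; apply: H; exists i.
    by rewrite mul0r.
  by move: ug; rewrite unitmxE => /[swap] ->; rewrite unitr0.
have i0 : i != 0 by apply: contraNneq gi => ->; rewrite g00.
pose e : 'M[K]_n.+1 := delta_mx 0 i.
have ee : e *m e = 0 by apply: mul_delta_mx_0.
have inv : (1%:M - e) *m ((1%:M + e) *m g) = g.
  by rewrite mulmxA mulmxDr !mulmxBl !mulmx1 !mul1mx ee subr0 subrK mul1mx.
rewrite -inv; apply: SM.
  by apply: S1; rewrite mulNmx mulmxN ee !oppr0.
apply: Spivot.
  have : (1%:M - e) *m ((1%:M + e) *m g) \in unitmx by rewrite inv.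
  by rewrite unitmx_mul => /andP[].
rewrite mulmxDl mul1mx mxE g00 add0r mxE (bigD1 i) //= big1 ?addr0 => [|k ki].
  by rewrite mxE !eqxx mul1r.
by rewrite mxE (negPf ki) andbF mul0r.
Qed.

End Generation.
(** * The graded Lie algebra *)

Section BlockIsomorphism.
Variables (E : comNzRingType) (m : nat).
Local Notation R := ('M[E]_2).
Local Notation dim := (\sum_(i < m) 2)%N.

Definition flat (b : 'M[R]_m) : 'M[E]_dim :=
  @mxblock E m m (fun _ => 2%N) (fun _ => 2%N) (fun i j => b i j).
Definition unflat (A : 'M[E]_dim) : 'M[R]_m :=
  \matrix_(i, j) @submxblock E m m (fun _ => 2%N) (fun _ => 2%N) A i j.

Lemma flatK : cancel flat unflat.
Proof. by move=> b; apply/matrixP => i j; rewrite mxE mxblockK. Qed.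

Lemma unflatK : cancel unflat flat.
Proof.
by move=> A; rewrite -[RHS]submxblockK; apply: eq_mxblock => i j; rewrite mxE.
Qed.

Lemma flat_inj : injective flat.
Proof. exact: can_inj flatK. Qed.

Lemma flatM a b : flat (a *m b) = flat a *m flat b.
Proof. by rewrite mul_mxblock; apply: eq_mxblock => i j; rewrite mxE. Qed.

Lemma flat_adj b : flat (adj b) = (flat b)^T.
Proof. by rewrite tr_mxblock; apply: eq_mxblock => i j; rewrite adjE. Qed.

Lemma flat_dg d : flat (dg d) = \mxdiag_(i < m) d i.
Proof.
apply: eq_mxblock => i j; rewrite dgE; case: eqP => // e.
by case: j / e; rewrite conform_mx_id.
Qed.

Lemma flat1 : flat 1%:M = 1%:M.
Proof.
rewrite -(mxdiagZ 1) -flat_dg; congr flat.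
by apply/matrixP => i j; rewrite !mxE; case: eqP.
Qed.

Lemma flat0 : flat 0 = 0.
Proof. by apply/matrixP => i j; rewrite !mxE. Qed.

Lemma flat_map (f : E -> E) b : map_mx f (flat b) = flat (map_mx (map_mx f) b).
Proof. by apply/matrixP => i j; rewrite !mxE. Qed.

Lemma mul_dgE d (b : 'M[R]_m) i j : (dg d *m b) i j = d i *m b i j.
Proof.
rewrite mxE (bigD1 i) //= big1 => [|t ti]; first by rewrite addr0 dgE eqxx.
by rewrite dgE eq_sym (negPf ti) mul0r.
Qed.

Lemma mulmx_dgE d (b : 'M[R]_m) i j : (b *m dg d) i j = b i j *m d j.
Proof.
rewrite mxE (bigD1 j) //= big1 => [|t tj]; first by rewrite addr0 dgE eqxx.
by rewrite dgE (negPf tj) mulr0.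
Qed.

Lemma adj_dg d : adj (dg d) = dg (fun i => (d i)^T) :> 'M[R]_m.
Proof.
apply/matrixP => i j; rewrite adjE !dgE eq_sym.
by case: eqP => [->|_] //; rewrite trmx0.
Qed.

End BlockIsomorphism.

Lemma Jmx_flat (F : fieldType) (E : fieldExtType F) (pi : F) k :
  Jmx E pi k = flat (dg (fun _ : 'I_k.+1 => Jpi E pi)).
Proof. by rewrite flat_dg. Qed.

Lemma block_diag_inv (K : fieldType) m (g : 'M[K]_m) : g \in unitmx ->
  let P := block_mx g 0 0 (invmx g)^T in
  P \in unitmx /\ invmx P = block_mx (invmx g) 0 0 g^T.
Proof.
move=> ug P; have PQ : P *m block_mx (invmx g) 0 0 g^T = 1%:M.
  rewrite mulmx_block !(mulmx0, mul0mx, addr0, add0r) mulmxV // -trmx_mul mulmxV //.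
  by rewrite trmx1 -scalar_mx_block.
have [uP _] := mulmx1_unit PQ; split=> //.
by rewrite -[LHS]mulmx1 -PQ mulKmx.
Qed.

Section Realization.
Variables (F : fieldType) (pi u : F).
Hypothesis sqt : square_theory pi u.
Variables (E : fieldExtType F) (sqrtu : E).
Hypotheses (hsqrtu : sqrtu ^+ 2 = u%:A) (hE : <<1%AS; sqrtu>>%VS = {:E}%VS).
Variable conj : {lrmorphism E -> E}.
Hypothesis hconj : conj sqrtu = - sqrtu.
Variable k : nat.

Local Notation R := ('M[E]_2).
Local Notation J := (Jmx E pi k).
Local Notation n := (\sum_(i < k.+1) 2)%N.
Local Notation mx := (rmx E (n + n)).
Local Notation qmat := (qmat pi conj).
Local Notation smat := (smat pi conj).
Local Notation bsim := (bsim pi conj).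
Local Notation gt := (gt pi conj k).
Local Notation Vplus := (Vplus pi conj k).

Definition up (B : 'M[E]_n) : mx := block_mx 0 B 0 0.

Lemma up_inj : injective up.
Proof. by move=> A B /(congr1 ursubmx); rewrite !block_mxKur. Qed.

Lemma quat_flat g : J *m map_mx conj (flat g) = flat g *m J <-> qmat g.
Proof.
rewrite Jmx_flat flat_map -!flatM; split=> [/flat_inj H i j|H].
  by move/matrixP/(_ i j): H; rewrite mul_dgE mulmx_dgE mxE.
by congr flat; apply/matrixP => i j; rewrite mul_dgE mulmx_dgE mxE; apply: H.
Qed.

Lemma skew_flat b : J *m map_mx conj (flat b) = flat b *m J^T <-> smat b.
Proof.
rewrite Jmx_flat flat_map -flat_adj adj_dg -!flatM; split=> [/flat_inj H i j|H].
  by move/matrixP/(_ i j): H; rewrite mul_dgE mulmx_dgE mxE.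
by congr flat; apply/matrixP => i j; rewrite mul_dgE mulmx_dgE mxE; apply: H.
Qed.

Lemma up_gt B : up B \in gt <-> B^T = B /\ J *m map_mx conj B = B *m J^T.
Proof.
have TE : Tmx E pi k *m map_mx conj (up B) = up (J *m map_mx conj B).
  by rewrite /Tmx /up map_block_mx !map_mx0 mulmx_block !(mulmx0, mul0mx, addr0).
have TE' : up B *m Tmx E pi k = up (B *m J^T).
  by rewrite /Tmx /up mulmx_block !(mulmx0, mul0mx, addr0, add0r).
split=> [/gtP[/spP[A' [B' [C' [hB hC E']]]]]|[hB hJ]].
  rewrite TE TE' => /up_inj ->; split=> //.
  by move: E' => /(congr1 ursubmx); rewrite !block_mxKur => ->.
apply/gtP; split; last by rewrite TE TE' hJ.
by apply/spP; exists 0, B, 0; rewrite !trmx0 oppr0.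
Qed.

Lemma lie_H0_block A B C D : lie (H0 E k) (block_mx A B C D : mx)
  = block_mx 0 (B *+ 2) (- (C *+ 2)) 0.
Proof.
rewrite /lie /H0 !mulmx_block !(mulmx0, mul0mx, addr0, add0r, mul1mx, mulmx1).
by rewrite !(mulNmx, mulmxN) !mul1mx !mulmx1 opp_block_mx add_block_mx
  !opprK subrr addNr !mulr2n opprD.
Qed.

Lemma two_neq0 : (2 : F)%:A != 0 :> E.
Proof. by rewrite alg_eq0 (sqt_2 sqt). Qed.

Lemma up_Vplus B : up B \in Vplus <-> up B \in gt.
Proof.
split=> [/VplusP[]//|hB]; apply/VplusP; split=> //.
rewrite rmx_scaleE /up lie_H0_block mul0rn oppr0 scale_block_mx !scaler0.
by congr block_mx; rewrite -scaler_nat; congr (_ *: _); rewrite scaler_nat.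
Qed.

Lemma VplusE X : X \in Vplus <-> exists b, [/\ smat b, adj b = b & X = up (flat b)].
Proof.
split=> [/[dup] hX /VplusP[_]|[b [hb bb ->]]]; last first.
  by apply/up_Vplus/up_gt; rewrite -flat_adj bb; split=> //; apply/skew_flat.
have [A [B [C [D XE]]]] : exists A B C D, X = block_mx A B C D.
  by exists (ulsubmx X), (ursubmx X), (dlsubmx X), (drsubmx X); rewrite submxK.
rewrite {1 2}XE lie_H0_block rmx_scaleE scale_block_mx => /eq_block_mx[hA _ hC hD].
have n0 := two_neq0.
have A0 : A = 0 by apply/eqP; move/esym/eqP: hA; rewrite scaler_eq0 (negPf n0).
have D0 : D = 0 by apply/eqP; move/esym/eqP: hD; rewrite scaler_eq0 (negPf n0).
have C0 : C = 0.
  apply/eqP; move/eqP: hC; rewrite eq_sym -subr_eq0 opprK -scaler_nat.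
  have -> : (2%:R : E) = 2%:A by rewrite scaler_nat.
  by rewrite -scalerDl scaler_eq0 -algD alg_eq0 -natrD (natrM _ 2 2) mulf_eq0
    orbb (negPf (sqt_2 sqt)).
rewrite A0 C0 D0 -/(up B) -(unflatK B) in XE.
move: hX; rewrite XE => /up_Vplus/up_gt[]; rewrite -flat_adj => /flat_inj hb /skew_flat.
by exists (unflat B).
Qed.

Lemma block_diag_up (g B : 'M[E]_n) : g \in unitmx ->
  let P := block_mx g 0 0 (invmx g)^T in P *m up B *m invmx P = up (g *m B *m g^T).
Proof.
move=> ug P; have [_ ->] := block_diag_inv ug.
by rewrite /P /up !mulmx_block !(mulmx0, mul0mx, addr0, add0r).
Qed.

Definition conjug (P : 'M[E]_(n + n)) (X : mx) : mx := P *m X *m invmx P.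

Fact conjug_is_linear P : linear (conjug P).
Proof.
move=> a X Y; rewrite /conjug !rmx_scaleE mulmxDr mulmxDl.
by rewrite -scalemxAr -scalemxAl.
Qed.

HB.instance Definition _ P :=
  GRing.isLinear.Build F mx mx _ (conjug P) (conjug_is_linear P).

Lemma quat_flat_inv g : g \in unitmx -> J *m map_mx conj g = g *m J ->
  J *m map_mx conj (invmx g) = invmx g *m J.
Proof.
move=> ug hg; have ucg : map_mx conj g \in unitmx by rewrite map_unitmx.
rewrite map_invmx; apply: (can_inj (mulmxK ucg)); rewrite mulmxKV //.
by rewrite -mulmxA hg mulmxA mulVmx // mul1mx.
Qed.

Lemma G0_orbit b b' : smat b -> adj b = b ->
  same_orbit (G0 pi conj k) (up (flat b)) (up (flat b')) <-> bsim b b'.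
Proof.
move=> hb bb; have bgt : up (flat b) \in gt.
  by apply/up_gt; rewrite -flat_adj bb; split=> //; apply/skew_flat.
split=> [[f [g [ug hg fE]]]|[g [h [qg qh gh hg <-]]]].
  rewrite fE // block_diag_up // => /up_inj; rewrite -(unflatK g) -flat_adj -!flatM.
  move=> /flat_inj bE; exists (unflat g), (unflat (invmx g)); split=> //.
  - by apply/quat_flat; rewrite unflatK.
  - by apply/quat_flat; rewrite unflatK; apply: quat_flat_inv.
  - by apply: flat_inj; rewrite flatM !unflatK flat1 mulmxV.
  - by apply: flat_inj; rewrite flatM !unflatK flat1 mulVmx.
have [ug _] : flat g \in unitmx /\ flat h \in unitmx.
  by apply: mulmx1_unit; rewrite -flatM gh flat1.
exists (linfun (conjug (block_mx (flat g) 0 0 (invmx (flat g))^T))).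
  exists (flat g); split=> //; first exact/quat_flat.
  by move=> P X _; rewrite lfunE.
by rewrite lfunE /= /conjug block_diag_up // -flat_adj -!flatM.
Qed.

End Realization.

(** * The symplectic algebra and descent from E to F *)

Section Symplectic.
Variables (R : comNzRingType) (n : nat).
Implicit Types X Y Z P : 'M[R]_(n + n).

Definition Om : 'M[R]_(n + n) := block_mx 0 1%:M (- 1%:M) 0.
(** The condition Z^T Om + Om Z = 0. Unlike the equations on blocks, it behaves well under
    conjugation by symplectic matrices and reads the same over E and over K. *)
Definition spm Z := Om *m Z = - (Z^T *m Om).

Lemma Om_sqr : Om *m Om = - 1%:M.
Proof.
rewrite /Om mulmx_block !(mulmx0, mul0mx, addr0, add0r) mulNmx mulmxN !mulmx1.
by rewrite -[RHS]/(- (1%:M : 'M_(n + n))) (scalar_mx_block n n 1) opp_block_mx !oppr0.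
Qed.

Lemma trOm : Om^T = - Om.
Proof.
rewrite /Om tr_block_mx opp_block_mx !trmx0 !oppr0 opprK trmx1.
by rewrite raddfN /= trmx1.
Qed.

Lemma spm_block (A B C D : 'M[R]_n) :
  spm (block_mx A B C D) <-> [/\ B^T = B, C^T = C & D = - A^T].
Proof.
rewrite /spm /Om tr_block_mx !mulmx_block !(mulmx0, mul0mx, addr0, add0r).
rewrite !(mulmxN, mulNmx) !mulmx1 !mul1mx opp_block_mx !opprK.
split=> [/eq_block_mx[hC -> hA /oppr_inj hB]|[-> -> ->]].
  by rewrite -hB -hC; split.
by rewrite raddfN /= trmxK.
Qed.

Lemma spmD X Y : spm X -> spm Y -> spm (X + Y).
Proof. by move=> hX hY; rewrite /spm mulmxDr hX hY raddfD /= mulmxDl opprD. Qed.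

Lemma spmZ a X : spm X -> spm (a *: X).
Proof. by move=> hX; rewrite /spm -scalemxAr hX linearZ /= -scalemxAl scalerN. Qed.

Lemma spmN X : spm X -> spm (- X).
Proof. by move=> hX; rewrite -scaleN1r; apply: spmZ. Qed.

Lemma spm0 : spm 0.
Proof. by rewrite /spm trmx0 mulmx0 mul0mx oppr0. Qed.

Lemma spm_lie X Y : spm X -> spm Y -> spm (X *m Y - Y *m X).
Proof.
move=> hX hY; rewrite /spm [(_ - _)^T]raddfB /= !trmx_mul mulmxBr mulmxBl opprB !mulmxA hX hY.
by rewrite !mulNmx -!mulmxA hX hY !mulmxN !opprK.
Qed.

(** The map X -> Om X^T Om is an involution of gl that is the identity on sp, so this is twice the
    projection onto sp. *)
Lemma spm_sym X : spm (X + Om *m X^T *m Om).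
Proof.
rewrite /spm mulmxDr !mulmxA Om_sqr !mulNmx mul1mx [(_ + _)^T]raddfD /= !trmx_mul.
rewrite trmxK trOm mulmxDl !(mulNmx, mulmxN) opprK -!mulmxA Om_sqr !mulmxN mulmx1.
by rewrite opprD opprK addrC.
Qed.

Lemma spm_rank1 (v : 'rV[R]_(n + n)) : spm (Om *m (v^T *m v)).
Proof.
rewrite /spm mulmxA Om_sqr mulNmx mul1mx trmx_mul [(v^T *m v)^T]trmx_mul trmxK trOm.
by rewrite mulmxN mulNmx -mulmxA Om_sqr mulmxN opprK mulmx1.
Qed.

Lemma spm_mul_Om Y : spm Y -> Y *m Om = - (Om *m Y^T).
Proof.
move=> hY; have := congr1 (fun Z => Om *m Z *m Om) hY.
rewrite mulmxA Om_sqr !mulmxN mulNmx mul1mx !mulNmx => /oppr_inj ->.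
by rewrite -!mulmxA Om_sqr !mulmxN mulmx1.
Qed.

End Symplectic.

Lemma map_Om (R S : comNzRingType) n (f : {rmorphism R -> S}) : map_mx f (Om R n) = Om S n.
Proof. by rewrite /Om map_block_mx !map_mx0 map_mxN map_mx1. Qed.

Lemma spm_map (R S : comNzRingType) n (f : {rmorphism R -> S}) (X : 'M[R]_(n + n)) :
  spm X -> spm (map_mx f X).
Proof. by move=> hX; rewrite /spm -(map_Om _ f) -map_mxM hX map_mxN map_mxM map_trmx. Qed.

Section Descent.
Variables (F : fieldType) (pi u : F).
Hypothesis sqt : square_theory pi u.
Variables (E : fieldExtType F) (sqrtu : E).
Hypotheses (hsqrtu : sqrtu ^+ 2 = u%:A) (hE : <<1%AS; sqrtu>>%VS = {:E}%VS).
Variable conj : {lrmorphism E -> E}.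
Hypothesis hconj : conj sqrtu = - sqrtu.
Variables (d : nat) (S : 'M[E]_d).
Hypotheses (SS : S *m S = (pi%:A)%:M) (cS : map_mx conj S = S).
Implicit Types X Y : 'M[E]_d.

Local Notation P := (pi%:A : E).

Let P0 : P != 0.
Proof. by rewrite alg_eq0 (sqt_pi0 sqt). Qed.

(** The semilinear involution X -> S conj(X) S^-1, since S^-1 = S / pi; its fixed points form the
    algebra over F. *)
Definition tau X : 'M[E]_d := P^-1 *: (S *m map_mx conj X *m S).

Lemma tauK : involutive tau.
Proof.
move=> X; rewrite /tau map_mxZ !map_mxM cS.
have -> : map_mx conj (map_mx conj X) = X.
  by apply/matrixP => i j; rewrite !mxE (conjK sqt hsqrtu hE hconj).
rewrite -!scalemxAr -!scalemxAl scalerA !mulmxA SS -!mulmxA SS.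
rewrite mul_scalar_mx mul_mx_scalar !scalerA fmorphV /= conj_alg.
by rewrite divfK // mulVf // scale1r.
Qed.

Lemma tau_fixed X : S *m map_mx conj X = X *m S <-> tau X = X.
Proof.
split=> [h|h]; rewrite /tau in h *.
  by rewrite h -mulmxA SS mul_mx_scalar scalerA mulVf // scale1r.
rewrite -[in RHS]h -scalemxAl -[_ *m S *m S]mulmxA SS mul_mx_scalar scalerA.
by rewrite mulVf // scale1r.
Qed.

Lemma tauD X Y : tau (X + Y) = tau X + tau Y.
Proof. by rewrite /tau map_mxD mulmxDr mulmxDl scalerDr. Qed.

Lemma tauN X : tau (- X) = - tau X.
Proof. by rewrite /tau map_mxN mulmxN mulNmx scalerN. Qed.

Lemma tauZ a X : tau (a *: X) = conj a *: tau X.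
Proof. by rewrite /tau map_mxZ -scalemxAr -scalemxAl scalerA mulrC -scalerA. Qed.

Lemma tauM X Y : tau (X *m Y) = tau X *m tau Y.
Proof.
rewrite /tau map_mxM -scalemxAr -scalemxAl; congr (_ *: _).
rewrite -!mulmxA (mulmxA S S) SS mul_scalar_mx -!scalemxAr scalerA.
by rewrite mulVf // scale1r.
Qed.

(** Galois descent for E over F: Y and Z are the components of X on the basis 1, [sqrtu], relative
    to the F-structure fixed by [tau]. *)
Lemma tau_decomp X : let h := (2%:A : E)^-1 in
  let Y := h *: (X + tau X) in let Z := (h * sqrtu^-1) *: (X - tau X) in
  [/\ tau Y = Y, tau Z = Z & X = Y + sqrtu *: Z].
Proof.
move=> h Y Z; have s0 := sqrtu_neq0 sqt hsqrtu hE hconj.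
have two0 : (2%:A : E) != 0 by rewrite alg_eq0 (sqt_2 sqt).
have ch : conj h = h by rewrite fmorphV /= conj_alg.
have cs : conj (h * sqrtu^-1) = - (h * sqrtu^-1).
  by rewrite rmorphM /= ch fmorphV /= hconj invrN mulrN.
split; first by rewrite /Y tauZ tauD tauK ch addrC.
  by rewrite /Z tauZ tauD tauN tauK cs scaleNr -scalerN opprD opprK addrC.
rewrite /Y /Z scalerA mulrCA mulfV // mulr1 -scalerDr addrACA subrr addr0 -mulr2n.
rewrite -scaler_nat scalerA; have -> : (2%:R : E) = 2%:A by rewrite scaler_nat.
by rewrite mulVf ?scale1r.
Qed.

End Descent.

Section GradedAlgebra.
Variables (F : fieldType) (pi u : F).
Hypothesis sqt : square_theory pi u.
Variables (E : fieldExtType F) (sqrtu : E).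
Hypotheses (hsqrtu : sqrtu ^+ 2 = u%:A) (hE : <<1%AS; sqrtu>>%VS = {:E}%VS).
Variable conj : {lrmorphism E -> E}.
Hypothesis hconj : conj sqrtu = - sqrtu.
Variable k : nat.

Local Notation J := (Jmx E pi k).
Local Notation T := (Tmx E pi k).
Local Notation n := (\sum_(i < k.+1) 2)%N.
Local Notation mx := (rmx E (n + n)).
Local Notation gt := (gt pi conj k).
Local Notation P := (pi%:A : E).

Let P0 : P != 0.
Proof. by rewrite alg_eq0 (sqt_pi0 sqt). Qed.

Lemma sp_spm (X : mx) : X \in sp E k <-> spm X.
Proof.
split=> [/spP[A [B [C [hB hC ->]]]]|]; first by apply/spm_block; split.
rewrite -{1}[X]submxK => /spm_block[hB hC hD]; apply/spP.
by exists (ulsubmx X), (ursubmx X), (dlsubmx X); split; rewrite -?hD ?submxK.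
Qed.

Lemma gt_spm (X : mx) : X \in gt <-> spm X /\ T *m map_mx conj X = X *m T.
Proof.
split=> [/gtP[/sp_spm hX hT] //|[hX hT]].
by apply/gtP; split=> //; apply/sp_spm.
Qed.

Lemma Jmx_sqr : J *m J = P%:M.
Proof.
rewrite Jmx_flat -flatM -(mxdiagZ P) -flat_dg; congr flat.
apply/matrixP => i j; rewrite mul_dgE !dgE; case: eqP => _; last by rewrite mulmx0.
exact: (Jpi_sqr sqt hsqrtu hE hconj).
Qed.

Lemma conj_Jmx : map_mx conj J = J.
Proof.
rewrite Jmx_flat flat_map; congr flat; apply/matrixP => i j; rewrite mxE !dgE.
by case: eqP => _; rewrite ?map_mx0 // (conj_Jpi sqt hsqrtu hE hconj).
Qed.

Lemma Tmx_sqr : T *m T = P%:M.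
Proof.
rewrite /Tmx mulmx_block !(mulmx0, mul0mx, addr0, add0r) -trmx_mul Jmx_sqr.
by rewrite tr_scalar_mx -scalar_mx_block.
Qed.

Lemma conj_Tmx : map_mx conj T = T.
Proof. by rewrite /Tmx map_block_mx !map_mx0 -map_trmx conj_Jmx. Qed.

Lemma Om_Tmx : Om E n *m T = T^T *m Om E n.
Proof.
rewrite /Tmx /Om tr_block_mx !mulmx_block !(mulmx0, mul0mx, addr0, add0r) trmxK.
by rewrite !trmx0 !(mulmx0, mul0mx, addr0, add0r, oppr0) mulNmx mulmxN !mulmx1 !mul1mx.
Qed.

Lemma gt_lie (X Y : mx) : X \in gt -> Y \in gt -> lie X Y \in gt.
Proof.
move=> /gt_spm[sX tX] /gt_spm[sY tY]; apply/gt_spm; split; first exact: spm_lie.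
rewrite /lie map_mxB !map_mxM mulmxBr mulmxBl !mulmxA tX tY -!mulmxA tX tY.
by rewrite !mulmxA.
Qed.

Local Notation tauT := (tau pi conj T).

Lemma tau_sp X : spm X -> spm (tauT X).
Proof.
move=> hX; apply: spmZ; rewrite /spm !mulmxA Om_Tmx.
rewrite -(mulmxA T^T) (spm_map conj hX) !trmx_mul mulmxN mulNmx.
by congr (- _); rewrite -!mulmxA Om_Tmx.
Qed.

Lemma gt_tau X : X \in gt <-> spm X /\ tauT X = X.
Proof.
have fx := tau_fixed sqt hsqrtu hE hconj Tmx_sqr conj_Tmx X.
by split=> [/gt_spm[hX /fx]//|[hX /fx hT]]; apply/gt_spm.
Qed.

Let s0 := sqrtu_neq0 sqt hsqrtu hE hconj.
Let two0 := two_neq0 sqt hsqrtu hE hconj k.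

(** With [gt_indep] below, this identifies sp over E with the scalar extension of the Lie algebra
    over F. *)
Lemma sp_decomp (X : 'M[E]_(n + n)) : spm X ->
  exists Y Z : mx, [/\ Y \in gt, Z \in gt & X = Y + sqrtu *: (Z : 'M[E]_(n + n)) :> 'M[E]_(n + n)].
Proof.
move=> hX; have [] := tau_decomp sqt hsqrtu hE hconj Tmx_sqr conj_Tmx X.
set Y := _ *: (_ + _); set Z := _ *: (_ - _) => hY hZ XE; exists Y, Z; split=> //.
  by apply/gt_tau; split=> //; apply/spmZ/spmD/tau_sp.
by apply/gt_tau; split=> //; apply/spmZ/spmD/spmN/tau_sp.
Qed.

Lemma gt_indep (X Y : mx) : X \in gt -> Y \in gt ->
  X + sqrtu *: (Y : 'M[E]_(n + n)) = 0 -> X = 0 /\ Y = 0.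
Proof.
move=> /gt_tau[_ tX] /gt_tau[_ tY] XY.
have := congr1 tauT XY.
rewrite (tauD sqt hsqrtu hE hconj Tmx_sqr conj_Tmx) (tauZ sqt hsqrtu hE hconj Tmx_sqr conj_Tmx) tX
  tY hconj scaleNr => h.
have : tauT 0 = 0 by rewrite /tau map_mx0 mulmx0 mul0mx scaler0.
move=> t0; rewrite t0 in h; have X0 : X = 0.
  apply/eqP; have : X + X = 0 :> 'M[E]_(n + n).
    by rewrite -[RHS]addr0 -{1}XY -h addrACA subrr addr0.
  move/eqP; rewrite -mulr2n -scaler_nat scaler_eq0.
  by rewrite (negPf two0).
split=> //; have /eqP : sqrtu *: (Y : 'M[E]_(n + n)) = 0 by rewrite -XY X0 add0r.
by rewrite scaler_eq0 (negPf s0) => /eqP.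
Qed.

End GradedAlgebra.
(** * The groups G^0 and G *)

Section ScalarExtension.
Variables (F : fieldType) (pi u : F).
Hypothesis sqt : square_theory pi u.
Variables (E : fieldExtType F) (sqrtu : E).
Hypotheses (hsqrtu : sqrtu ^+ 2 = u%:A) (hE : <<1%AS; sqrtu>>%VS = {:E}%VS).
Variable conj : {lrmorphism E -> E}.
Hypothesis hconj : conj sqrtu = - sqrtu.

(** It is enough to choose in K a square root of the image of u. *)
Lemma extend_embedding (K : closedFieldType) (iota : {rmorphism F -> K}) :
  exists iE : {rmorphism E -> K}, forall a, iE a%:A = iota a.
Proof.
have [s s2] : exists s, s ^+ 2 = iota u.
  have [|s /rootP] := closed_rootP ('X^2 - (iota u)%:P) _.
    by rewrite size_XnsubC.
  by rewrite !hornerE => /eqP; rewrite subr_eq0 => /eqP; exists s.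
have [c1 H] := choice (quad_coords sqt hsqrtu hE hconj).
have {H}[c2 cE] := choice H.
pose f x := iota (c1 x) + iota (c2 x) * s.
have fE a b : f (a%:A + b%:A * sqrtu) = iota a + iota b * s.
  by have /(quad_coords_inj sqt hsqrtu hE hconj)[{3}-> {3}->] := cE (a%:A + b%:A * sqrtu).
have fB : zmod_morphism f.
  move=> x y; rewrite [x]cE [y]cE.
  have -> : forall a b a' b' : F, a%:A + b%:A * sqrtu - (a'%:A + b'%:A * sqrtu)
     = (a - a')%:A + (b - b')%:A * sqrtu by move=> *; rewrite !(algD, algN); ring.
  by rewrite !fE !rmorphB; ring.
have fM : monoid_morphism f.
  split=> [|x y].
    by have := fE 1 0; rewrite scale0r mul0r addr0 scale1r => ->;
      rewrite rmorph1 rmorph0 mul0r addr0.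
  rewrite [x]cE [y]cE.
  have -> : forall a b a' b' : F, (a%:A + b%:A * sqrtu) * (a'%:A + b'%:A * sqrtu)
     = (a * a' + u * (b * b'))%:A + (a * b' + b * a')%:A * sqrtu.
    by move=> *; rewrite !(algD, algM) -hsqrtu; ring.
  by rewrite !fE !(rmorphD, rmorphM) /= -s2; ring.
pose m1 := GRing.isZmodMorphism.Build E K f fB.
pose m2 := GRing.isMonoidMorphism.Build E K f fM.
pose g : {rmorphism E -> K} := HB.pack f m1 m2.
exists g => a; change (f a%:A = iota a).
have := fE a 0; rewrite scale0r mul0r addr0 => ->.
by rewrite rmorph0 mul0r addr0.
Qed.

Variables (K : fieldType) (iota : {rmorphism F -> K}) (iE : {rmorphism E -> K}).
Hypothesis hiE : forall a, iE a%:A = iota a.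
Variable k : nat.

Local Notation n := (\sum_(i < k.+1) 2)%N.
Local Notation mx := (rmx E (n + n)).
Local Notation gt := (gt pi conj k).
Local Notation bv := (vbasis gt).
Local Notation ad := (ext_ad (L := gt) (@lie F E (n + n)) iota).

(** Identifies the scalar extension to K, in the coordinates used by [ext_mx], with the matrix
    algebra sp over K; [Phi_inj] and [Phi_sp_surj] make it bijective onto sp. *)
Definition realize (x : 'rV[K]_(\dim gt)) : 'M[K]_(n + n) :=
  \sum_i x 0 i *: map_mx iE (bv`_i : mx).

Fact Phi_is_linear : linear realize.
Proof using Type.
move=> a x y; rewrite /realize scaler_sumr -[RHS]big_split; apply: eq_bigr => i _ /=.
by rewrite !mxE scalerDl scalerA.
Qed.

HB.instance Definition _ := GRing.isLinear.Build K _ _ _ realize Phi_is_linear.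

Let bv_gt i : (i < \dim gt)%N -> bv`_i \in gt.
Proof. by move=> hi; apply/vbasis_mem/mem_nth; rewrite size_tuple. Qed.

Let map_scale a (X : mx) : map_mx iE (a *: X) = iota a *: map_mx iE (X : 'M[E]_(n + n)).
Proof. by rewrite rmx_scaleE map_mxZ hiE. Qed.

Lemma Phi_coord (X : mx) : X \in gt -> realize (\row_j iota (coord bv j X)) = map_mx iE X.
Proof.
move=> hX; rewrite [in RHS](coord_vbasis hX) /realize.
transitivity (\sum_j map_mx iE (coord bv j X *: (bv`_j : mx))).
  by apply: eq_bigr => j _; rewrite mxE map_scale.
apply: (big_rec2 (fun (A : 'M[K]_(n + n)) (B : mx) => A = map_mx iE B)) => [|i A B _ ->].
  by rewrite map_mx0.
by rewrite map_mxD.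
Qed.

(** By [gt_indep] an F-basis of the Lie algebra stays free over E as a family of matrices, and the
    rank of a matrix does not change under extension from E to K. *)
Lemma Phi_inj : injective realize.
Proof.
pose M : 'M[E]_(\dim gt, (n + n) * (n + n)) := \matrix_i mxvec (bv`_i : 'M[E]_(n + n)).
have MP x : mxvec (realize x) = x *m map_mx iE M.
  rewrite mulmx_sum_row /realize raddf_sum; apply: eq_bigr => i _ /=.
  by rewrite linearZ /= -map_row rowK map_mxvec.
have fM : row_free (map_mx iE M).
  rewrite row_free_map; apply: inj_row_free => v vM.
  have [a H] := choice (fun i => quad_coords sqt hsqrtu hE hconj (v 0 i)).
  have {H}[c vE] := choice H.
  pose A : mx := \sum_i a i *: bv`_i; pose C : mx := \sum_i c i *: bv`_i.
  have gA : A \in gt by apply: memv_suml => i _; apply/memvZ/bv_gt.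
  have gC : C \in gt by apply: memv_suml => i _; apply/memvZ/bv_gt.
  have AC : A + sqrtu *: (C : 'M[E]_(n + n)) = 0 :> 'M[E]_(n + n).
    transitivity (vec_mx (v *m M) : 'M[E]_(n + n)); last by rewrite vM linear0.
    have gen (b : 'I_(\dim gt) -> 'M[E]_(n + n)) :
      \sum_i (a i)%:A *: b i + sqrtu *: \sum_i (c i)%:A *: b i = \sum_i v 0 i *: b i.
      rewrite scaler_sumr -[LHS]big_split; apply: eq_bigr => i _ /=.
      by rewrite vE scalerDl [_ * sqrtu]mulrC scalerA.
    transitivity (\sum_i v 0 i *: (bv`_i : 'M[E]_(n + n))); first exact: gen.
    rewrite mulmx_sum_row raddf_sum; apply: eq_bigr => i _ /=.
    by rewrite linearZ /= rowK mxvecK.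
  have [A0 C0] := gt_indep sqt hsqrtu hE hconj gA gC AC.
  have /freeP fr := basis_free (vbasisP gt).
  apply/rowP => i; rewrite mxE vE (fr _ A0 i) (fr _ C0 i).
  by rewrite scale0r mul0r addr0.
move=> x y /(congr1 (fun A => mxvec A)); rewrite !MP.
exact: row_free_inj.
Qed.

Lemma Phi_mul_ext (f : mx -> mx) x : (forall X, X \in gt -> f X \in gt) ->
  realize (x *m ext_mx gt iota f) = \sum_i x 0 i *: map_mx iE (f bv`_i : mx).
Proof.
move=> hf; rewrite mulmx_sum_row linear_sum; apply: eq_bigr => i _ /=.
rewrite linearZ /= -(Phi_coord (hf _ (bv_gt (ltn_ord i)))); congr (_ *: realize _).
by apply/rowP => j; rewrite !mxE.
Qed.

Lemma Phi_ad x y : realize (x *m ad y) = realize y *m realize x - realize x *m realize y.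
Proof.
have gl X Y := @gt_lie F pi u sqt E sqrtu hsqrtu hE conj hconj k X Y.
rewrite /ext_ad mulmx_sumr linear_sum {2 4}/realize mulmx_suml mulmx_sumr -sumrB.
apply: eq_bigr => j _; rewrite -scalemxAr linearZ /= Phi_mul_ext; last first.
  by move=> X hX; apply: gl => //; apply: bv_gt.
rewrite -scalemxAr -scalemxAl -scalerBr; congr (_ *: _).
rewrite /realize mulmx_suml mulmx_sumr -sumrB; apply: eq_bigr => i _.
by rewrite -scalemxAr -scalemxAl -scalerBr /lie map_mxB !map_mxM.
Qed.

Lemma Phi_spm x : spm (realize x).
Proof.
apply: (big_ind (fun A => spm A)) => [||i _]; [exact: spm0 | exact: spmD |].
apply/spmZ/spm_map; have := bv_gt (ltn_ord i).
by move=> /(gt_spm sqt hsqrtu hE hconj)[].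
Qed.

(** An element Z of sp is half of [sym Z], hence a K-combination of the symmetrized elementary
    matrices; these are defined over E, where [sp_decomp] applies. *)
Lemma Phi_sp_surj (Z : 'M[K]_(n + n)) : spm Z -> exists x, realize x = Z.
Proof.
move=> hZ; have two0 : 2%:R != 0 :> K.
  by rewrite -(rmorph_nat iota) fmorph_eq0 (sqt_2 sqt).
have surjE X : spm X -> exists x, realize x = map_mx iE X.
  move=> /(sp_decomp sqt hsqrtu hE hconj)[A [B [hA hB ->]]].
  exists (\row_j iota (coord bv j A) + iE sqrtu *: \row_j iota (coord bv j B)).
  by rewrite linearD linearZ /= !Phi_coord // map_mxD map_mxZ.
pose sym (A : 'M[K]_(n + n)) := A + Om K n *m A^T *m Om K n.
have ZE : Z = 2%:R^-1 *: sym Z.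
  rewrite /sym -mulmxA; have -> : Z^T *m Om K n = - (Om K n *m Z) by rewrite hZ opprK.
  rewrite mulmxN mulmxA Om_sqr mulNmx mul1mx opprK -mulr2n -scaler_nat scalerA.
  by rewrite mulVf ?scale1r.
suff [x xE] : exists x, realize x = sym Z.
  by exists (2%:R^-1 *: x); rewrite linearZ /= xE -ZE.
rewrite [Z]matrix_sum_delta.
have H0 : exists x, realize x = sym 0.
  by exists 0; rewrite linear0 /sym trmx0 mulmx0 mul0mx addr0.
have HD A B : (exists x, realize x = sym A) -> (exists x, realize x = sym B) ->
    exists x, realize x = sym (A + B).
  move=> [x xE] [y yE]; exists (x + y); rewrite linearD /= xE yE /sym.
  by rewrite [(A + B)^T]raddfD /= mulmxDr mulmxDl addrACA.
apply: (big_ind (fun A => exists x, realize x = sym A)) => // i _.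
apply: (big_ind (fun A => exists x, realize x = sym A)) => // j _.
have [x xE] := surjE _ (spm_sym (delta_mx i j : 'M[E]_(n + n))).
exists (Z i j *: x); rewrite linearZ /= xE /sym map_mxD !map_mxM map_Om -map_trmx.
rewrite map_delta_mx linearZ /= scalerDr -scalemxAr -scalemxAl.
by [].
Qed.

End ScalarExtension.
Lemma exp_mx_sqr0 (K : fieldType) d (e : 'M[K]_d) : e *m e = 0 -> exp_mx e = 1%:M + e.
Proof.
case: d e => [|d] e ee; first by apply/matrixP => -[].
rewrite /exp_mx !big_ord_recl big1 => [|i _].
  by rewrite addr0 /= fact0 invr1 expr0 expr1 !scale1r.
by rewrite -[X in e ^+ X]/(2 + i)%N exprD expr2 -mulmxE ee mul0mx scaler0.
Qed.

Lemma spm_conj (R : comUnitRingType) n (P X : 'M[R]_(n + n)) : P \in unitmx ->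
  P^T *m Om R n *m P = Om R n -> spm X -> spm (P *m X *m invmx P).
Proof.
move=> uP hP hX; have uPT : P^T \in unitmx by rewrite unitmx_tr.
have h1 : Om R n *m P = invmx P^T *m Om R n by rewrite -{2}hP -mulmxA mulKmx.
have h2 : Om R n *m invmx P = P^T *m Om R n by rewrite -{1}hP mulmxK.
rewrite /spm !trmx_mul trmx_inv !mulmxA h1 -(mulmxA _ _ X) hX mulmxN mulNmx.
by rewrite -!mulmxA h2.
Qed.

Section Elementary.
Variables (F : fieldType) (pi u : F).
Hypothesis sqt : square_theory pi u.
Variables (E : fieldExtType F) (sqrtu : E).
Hypotheses (hsqrtu : sqrtu ^+ 2 = u%:A) (hE : <<1%AS; sqrtu>>%VS = {:E}%VS).
Variable conj : {lrmorphism E -> E}.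
Hypothesis hconj : conj sqrtu = - sqrtu.
Variables (K : fieldType) (iota : {rmorphism F -> K}) (iE : {rmorphism E -> K}).
Hypothesis hiE : forall a, iE a%:A = iota a.
Hypothesis natr0 : forall m, (0 < m)%N -> m%:R != 0 :> K.
Variable k : nat.

Local Notation n := (\sum_(i < k.+1) 2)%N.
Local Notation mx := (rmx E (n + n)).
Local Notation gt := (gt pi conj k).
Local Notation bv := (vbasis gt).
Local Notation ad := (ext_ad (L := gt) (@lie F E (n + n)) iota).
Local Notation Phi := (@realize F pi E conj K iE k).
Local Notation J := (Jmx E pi k).
Local Notation T := (Tmx E pi k).

Let Phi_ad_ := @Phi_ad F pi u sqt E sqrtu hsqrtu hE conj hconj K iota iE hiE k.
Let Phi_inj_ := @Phi_inj F pi u sqt E sqrtu hsqrtu hE conj hconj K iota iE hiE k.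
Let Phi_sp_surj_ := @Phi_sp_surj F pi u sqt E sqrtu hsqrtu hE conj hconj K iota iE hiE k.

Lemma Phi_ad_iter y z m :
  Phi (z *m ad y ^+ m) = iter m (fun Z => Phi y *m Z - Z *m Phi y) (Phi z).
Proof.
elim: m => [|m IH]; first by rewrite expr0 mulmx1.
by rewrite exprSr -mulmxE mulmxA Phi_ad_ IH.
Qed.

Lemma Phi_exp y z : nilpotent_mx (ad y) -> nilpotent_mx (Phi y) ->
  Phi (z *m exp_mx (ad y)) = exp_mx (Phi y) *m Phi z *m exp_mx (- Phi y).
Proof.
(* An order that exceeds the truncations for [ad y] and for both factors exp (Y) and exp (-Y). *)
move=> ny nY; pose M := ((\dim gt).+1 + ((n + n).+1 + (n + n).+1))%N.
rewrite -(exp_sum_ge natr0 (M := M) ny); last by rewrite /M addSn ltnS leq_addr.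
rewrite -(exp_sum_ad natr0 (M := M) _ nY); last exact: leq_addl.
rewrite mulmx_sumr linear_sum; apply: eq_bigr => m _ /=.
by rewrite -scalemxAr linearZ /= Phi_ad_iter.
Qed.

(** The condition [elementary], transported to matrices by [realize]: conjugation by Q on sp is a
    product of exponentials. *)
Definition elementary_conj (Q : 'M[K]_(n + n)) : Prop := Q \in unitmx /\
  exists s, (forall x, x \in s -> nilpotent_mx (ad x)) /\
    forall z, Phi (z *m \prod_(x <- s) exp_mx (ad x)) = Q *m Phi z *m invmx Q.

Lemma elementary_conjM A B : elementary_conj A -> elementary_conj B ->
  elementary_conj (A *m B).
Proof.
move=> [uA [s [ns hs]]] [uB [t [nt ht]]]; have uAB : A *m B \in unitmx.
  by rewrite unitmx_mul uA.
(* Operators act on row vectors from the right, so the factors belonging to B come first. *)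
split=> //; exists (t ++ s); split=> [x|z].
  by rewrite mem_cat => /orP[]; [apply: nt | apply: ns].
rewrite big_cat /= -mulmxE mulmxA hs ht !mulmxA -[RHS]mulmxA -!mulmxA.
do 3!congr (_ *m _); apply: (can_inj (mulKmx uAB)); rewrite mulmxV //.
by rewrite -mulmxA mulKVmx // mulmxV.
Qed.

Lemma elementary_conj_unipotent e : e *m e = 0 -> spm e -> elementary_conj (1%:M + e).
Proof.
move=> ee se; have [y ye] := Phi_sp_surj_ se.
have inv : (1%:M + e) *m (1%:M - e) = 1%:M.
  by rewrite mulmxDl !mulmxBr !mulmx1 !mul1mx ee subr0 subrK.
have [u1 _] := mulmx1_unit inv.
have invE : invmx (1%:M + e) = 1%:M - e by rewrite -[RHS](mulKmx u1) inv mulmx1.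
have ny : nilpotent_mx (ad y).
  (* Every term e^i Z e^j of the third power of ad e has i >= 2 or j >= 2. *)
  exists 3%N; apply/row_matrixP => i; rewrite row0 rowE; apply: Phi_inj_.
  rewrite Phi_ad_iter ye linear0 /=.
  have Ze A : A *m e *m e = 0 by rewrite -mulmxA ee mulmx0.
  rewrite !(mulmxBl, mulmxBr) !mulmxA !(ee, Ze, mul0mx).
  by rewrite !(subr0, sub0r, opprK, mulmxN, mulNmx, Ze, oppr0, mul0mx, addr0).
split=> //; exists [:: y]; split=> [x|z]; first by rewrite inE => /eqP->.
rewrite big_seq1 Phi_exp //; last by exists 2%N; rewrite ye expr2 -mulmxE.
by rewrite ye !exp_mx_sqr0 // ?mulNmx ?mulmxN ?ee ?oppr0 // invE.
Qed.

(* As in SL_2: diag(g, g^-1) = w(g) w(-1), where w(b) = U(b) L(-b^-1) U(b). *)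
Lemma elementary_conj_sym (g : 'M[K]_n) : g \in unitmx -> g^T = g ->
  elementary_conj (block_mx g 0 0 (invmx g)^T).
Proof.
move=> ug gT; have gTi : (invmx g)^T = invmx g by rewrite trmx_inv gT.
pose U (b : 'M[K]_n) : 'M[K]_(n + n) := block_mx 1%:M b 0 1%:M.
pose L (c : 'M[K]_n) : 'M[K]_(n + n) := block_mx 1%:M 0 c 1%:M.
have hU b : b^T = b -> elementary_conj (U b).
  move=> bT; have -> : U b = 1%:M + block_mx 0 b 0 0.
    by rewrite (scalar_mx_block n n) add_block_mx !addr0 add0r.
  apply: elementary_conj_unipotent; last by apply/spm_block; rewrite !trmx0 oppr0.
  by rewrite mulmx_block !(mulmx0, mul0mx, addr0) block_mx0.
have hL c : c^T = c -> elementary_conj (L c).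
  move=> cT; have -> : L c = 1%:M + block_mx 0 0 c 0.
    by rewrite (scalar_mx_block n n) add_block_mx !addr0 add0r.
  apply: elementary_conj_unipotent; last by apply/spm_block; rewrite !trmx0 oppr0.
  by rewrite mulmx_block !(mulmx0, mul0mx, addr0, add0r) block_mx0.
pose w (b c : 'M[K]_n) := U b *m L (- c) *m U b.
have wE b c : b *m c = 1%:M -> c *m b = 1%:M -> w b c = block_mx 0 b (- c) 0.
  move=> bc cb; rewrite /w !mulmx_block !(mulmx0, mul0mx, addr0, add0r, mulmx1, mul1mx).
  by rewrite mulmxN bc subrr mul0mx add0r mulNmx cb addNr.
have hw b c : b^T = b -> c^T = c -> elementary_conj (w b c).
  move=> bT cT; apply: elementary_conjM (hU _ bT).
  by apply: elementary_conjM (hU _ bT) (hL _ _); rewrite raddfN /= cT.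
have -> : block_mx g 0 0 (invmx g)^T = w g (invmx g) *m w (- 1%:M) (- 1%:M).
  rewrite !wE ?mulmxV ?mulVmx // ?mulmxN ?mulNmx ?mulmx1 ?opprK //.
  rewrite mulmx_block !(mulmx0, mul0mx, addr0, add0r, mulmxN, mulNmx, opprK, mulmx1).
  by rewrite gTi.
by apply: elementary_conjM; apply: hw; rewrite // raddfN /= trmx1.
Qed.

Lemma elementary_conj_diag (g : 'M[K]_n) : g \in unitmx ->
  elementary_conj (block_mx g 0 0 (invmx g)^T).
Proof.
pose S (g : 'M[K]_n) := g \in unitmx /\ elementary_conj (block_mx g 0 0 (invmx g)^T).
suff : g \in unitmx -> S g by move=> h /h[].
apply: unitmx_generated => [a b [ua ha] [ub hb]|e ee|d ud].
- have uab : a *m b \in unitmx by rewrite unitmx_mul ua.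
  split=> //; have -> : block_mx (a *m b) 0 0 (invmx (a *m b))^T
    = block_mx a 0 0 (invmx a)^T *m block_mx b 0 0 (invmx b)^T.
    rewrite mulmx_block !(mulmx0, mul0mx, addr0, add0r) -trmx_mul.
    congr (block_mx _ _ _ (_^T)); apply: (can_inj (mulKmx uab)); rewrite mulmxV //.
    by rewrite -mulmxA mulKVmx // mulmxV.
  exact: elementary_conjM.
- have inv : (1%:M + e) *m (1%:M - e) = 1%:M.
    by rewrite mulmxDl !mulmxBr !mulmx1 !mul1mx ee subr0 subrK.
  have [u1 _] := mulmx1_unit inv.
  have invE : invmx (1%:M + e) = 1%:M - e by rewrite -[RHS](mulKmx u1) inv mulmx1.
  split=> //; rewrite invE.
  have -> : block_mx (1%:M + e) 0 0 (1%:M - e)^T = 1%:M + block_mx e 0 0 (- e^T).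
    by rewrite (scalar_mx_block n n) add_block_mx !addr0 [(_ - _)^T]raddfB /= trmx1.
  apply: elementary_conj_unipotent; last by apply/spm_block; rewrite !trmx0.
  rewrite mulmx_block !(mulmx0, mul0mx, addr0, add0r) ee mulmxN mulNmx opprK -trmx_mul.
  by rewrite ee trmx0 block_mx0.
by split=> //; apply: elementary_conj_sym => //; apply: tr_diag_mx.
Qed.

Lemma quat_conj_Jmx (g : 'M[E]_n) : J *m map_mx conj g = g *m J ->
  map_mx conj g *m J = J *m g.
Proof.
move=> hg; have P0 : pi%:A != 0 :> E by rewrite alg_eq0 (sqt_pi0 sqt).
have JJ := Jmx_sqr sqt hsqrtu hE hconj k.
apply: (can_inj (scalerK P0)); rewrite -!mul_scalar_mx -JJ -!mulmxA (mulmxA J _ J) hg.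
by rewrite -(mulmxA g) JJ mul_mx_scalar -scalemxAr (mulmxA J J) JJ mul_scalar_mx.
Qed.

Lemma Tmx_block_diag (g : 'M[E]_n) : g \in unitmx -> J *m map_mx conj g = g *m J ->
  let P := block_mx g 0 0 (invmx g)^T in T *m map_mx conj P = P *m T.
Proof.
move=> ug hg P; rewrite /P /Tmx map_block_mx !map_mx0 !mulmx_block.
rewrite !(mulmx0, mul0mx, addr0, add0r) hg -map_trmx -!trmx_mul.
congr (block_mx _ _ _ (_^T)); apply: quat_conj_Jmx.
exact: (quat_flat_inv sqt hsqrtu hE hconj).
Qed.

Lemma block_diag_symplectic (R : fieldType) (g : 'M[R]_n) : g \in unitmx ->
  let P := block_mx g 0 0 (invmx g)^T in P^T *m Om R n *m P = Om R n.
Proof.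
move=> ug P; rewrite /P /Om tr_block_mx !trmx0 trmxK !mulmx_block.
rewrite !(mulmx0, mul0mx, addr0, add0r, mulmxN, mulNmx, mulmx1) -trmx_mul mulVmx //.
by rewrite trmx1.
Qed.

Lemma gt_conjug (g : 'M[E]_n) X : g \in unitmx -> J *m map_mx conj g = g *m J ->
  X \in gt -> conjug (block_mx g 0 0 (invmx g)^T) X \in gt.
Proof.
move=> ug hg /(gt_spm sqt hsqrtu hE hconj)[sX tX].
have [uP _] := block_diag_inv ug; have tP := Tmx_block_diag ug hg.
apply/(gt_spm sqt hsqrtu hE hconj); split.
  exact: spm_conj (block_diag_symplectic ug) sX.
set P := block_mx _ _ _ _ in uP tP *.
have ucP : map_mx conj P \in unitmx by rewrite map_unitmx.
rewrite /conjug !map_mxM map_invmx !mulmxA tP -(mulmxA P) tX !mulmxA.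
apply: (can_inj (mulmxK ucP)); rewrite mulmxKV // -[RHS]mulmxA tP.
by rewrite -!mulmxA mulKmx.
Qed.

Lemma H0_gt : H0 E k \in gt.
Proof.
apply/(gt_spm sqt hsqrtu hE hconj); split.
  by apply/spm_block; rewrite !trmx0 trmx1.
rewrite /H0 /Tmx map_block_mx !map_mx0 map_mxN map_mx1 !mulmx_block.
by rewrite !(mulmx0, mul0mx, addr0, add0r, mulmxN, mulNmx, mulmx1, mul1mx).
Qed.

(** Over K the block matrix of g is an [elementary_conj]. As [realize] is injective, the
    factorization of [ext_mx f] can be checked on matrices of sp. *)
Lemma G0_sub_G (f : 'End(mx)) : G0 pi conj k f -> G pi conj k iota f.
Proof.
move=> [g [ug hg fE]]; set P := block_mx g 0 0 (invmx g)^T in fE.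
have {}fE X : X \in gt -> f X = conjug P X by move=> hX; rewrite fE.
have fgt X : X \in gt -> f X \in gt by move=> hX; rewrite fE //; apply: gt_conjug.
have [uP invP] := block_diag_inv ug; rewrite -/P in uP invP.
split; last first.
  rewrite fE ?H0_gt // /conjug invP /P /H0 !mulmx_block.
  rewrite !(mulmx0, mul0mx, addr0, add0r, mulmxN, mulNmx, mulmx1) mulmxV //.
  by rewrite -trmx_mul mulmxV // trmx1.
split; first split.
- apply/eqP; rewrite eqEsubv; apply/andP; split; apply/subvP => Y.
    by move=> /memv_imgP[X hX ->]; apply: fgt.
  move=> hY; have ugi : invmx g \in unitmx by rewrite unitmx_inv.
  have hgi := quat_flat_inv sqt hsqrtu hE hconj ug hg.
  have := gt_conjug ugi hgi hY; rewrite invmxK -invP => hX.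
  apply/memv_imgP; exists (conjug (invmx P) Y) => //.
  by rewrite fE // /conjug invmxK !mulmxA mulmxV // mul1mx mulmxK.
- move=> X Y hX hY; have gXY : lie X Y \in gt by exact: (gt_lie sqt hsqrtu hE hconj).
  rewrite !fE // /conjug /lie mulmxBr mulmxBl !mulmxA.
  by rewrite !(mulmxKV uP).
have uiP : map_mx iE P = block_mx (map_mx iE g) 0 0 (invmx (map_mx iE g))^T.
  by rewrite map_block_mx !map_mx0 -map_invmx map_trmx.
have [_ [s [ns hs]]] : elementary_conj (map_mx iE P).
  by rewrite uiP; apply: elementary_conj_diag; rewrite map_unitmx.
exists s => //; apply/row_matrixP => i; rewrite !rowE; apply: Phi_inj_.
rewrite hs (Phi_mul_ext sqt hsqrtu hE hconj hiE) // /realize mulmx_sumr mulmx_suml.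
apply: eq_bigr => j _; rewrite -scalemxAr -scalemxAl fE; last first.
  by apply/vbasis_mem/mem_nth; rewrite size_tuple.
by rewrite /conjug !map_mxM map_invmx.
Qed.

End Elementary.

(** * From automorphisms in G to similitudes of V^+ *)

Lemma nilpotent_eigenvalues (K : closedFieldType) d (A : 'M[K]_d) :
  (forall a, eigenvalue A a -> a = 0) -> nilpotent_mx A.
Proof.
case: d A => [|d] A eig; first by exists 0%N; apply/matrixP => -[].
have [r cE] := closed_field_poly_normal (char_poly A).
rewrite (monicP (char_poly_monic A)) scale1r in cE.
have r0 z : z \in r -> z = 0.
  by move=> zr; apply: eig; rewrite eigenvalue_root_char cE root_prod_XsubC.
exists (size r); have := Cayley_Hamilton A; rewrite cE.
have -> : \prod_(z <- r) ('X - z%:P) = 'X^(size r) :> {poly K}.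
  rewrite big_seq (eq_bigr (fun _ => 'X)) => [|z /r0->]; last by rewrite subr0.
  by rewrite -big_seq big_const_seq count_predT iter_mulr_1.
by rewrite rmorphXn /= horner_mx_X.
Qed.

Lemma mul_delta_entry (R : pzSemiRingType) a b c d (A : 'M[R]_(a, b)) (B : 'M[R]_(c, d)) i j s t :
  (A *m delta_mx i j *m B) s t = A s i * B j t.
Proof.
rewrite -(mul_delta_mx (0 : 'I_1)) !mulmxA -colE -mulmxA -rowE.
by rewrite !mxE big_ord1 !mxE.
Qed.

Section OrbitsOfG.
Variables (F : fieldType) (pi u : F).
Hypothesis sqt : square_theory pi u.
Variables (E : fieldExtType F) (sqrtu : E).
Hypotheses (hsqrtu : sqrtu ^+ 2 = u%:A) (hE : <<1%AS; sqrtu>>%VS = {:E}%VS).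
Variable conj : {lrmorphism E -> E}.
Hypothesis hconj : conj sqrtu = - sqrtu.
Variables (K : closedFieldType) (iota : {rmorphism F -> K}) (iE : {rmorphism E -> K}).
Hypothesis hiE : forall a, iE a%:A = iota a.
Hypothesis natr0 : forall m, (0 < m)%N -> m%:R != 0 :> K.
Variable k : nat.

Local Notation n := (\sum_(i < k.+1) 2)%N.
Local Notation mx := (rmx E (n + n)).
Local Notation gt := (gt pi conj k).
Local Notation bv := (vbasis gt).
Local Notation ad := (ext_ad (L := gt) (@lie F E (n + n)) iota).
Local Notation Phi := (@realize F pi E conj K iE k).
Local Notation J := (Jmx E pi k).
Local Notation T := (Tmx E pi k).
Local Notation Om := (Om K n).
Local Notation up := (@up F E k).

Let Phi_inj_ := @Phi_inj F pi u sqt E sqrtu hsqrtu hE conj hconj K iota iE hiE k.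
Let Phi_sp_surj_ := @Phi_sp_surj F pi u sqt E sqrtu hsqrtu hE conj hconj K iota iE hiE k.
Let Phi_spm_ := @Phi_spm F pi u sqt E sqrtu hsqrtu hE conj hconj K iota iE hiE k.
Let JJ := Jmx_sqr sqt hsqrtu hE hconj k.
Let cJ := conj_Jmx sqt hsqrtu hE hconj k.
Local Notation tauJ := (tau pi conj J).
Let fixJ := tau_fixed sqt hsqrtu hE hconj JJ cJ.
Let quat_conj_ := @quat_conj_Jmx F pi u sqt E sqrtu hsqrtu hE conj hconj K iota iE hiE natr0 k.

(* An eigenvector v of [Phi y] for the eigenvalue a gives the rank one element
   Om v^T v of sp, an eigenvector of [ad y] for the eigenvalue -2a. *)
Lemma nilpotent_Phi y : nilpotent_mx (ad y) -> nilpotent_mx (Phi y).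
Proof.
move=> [m ym]; apply: nilpotent_eigenvalues => a /eigenvalueP[v vY v0].
have sY := Phi_spm_ y; set Y := Phi y in vY sY.
have [z zE] := Phi_sp_surj_ (spm_rank1 v).
have YZ : Y *m Phi z - Phi z *m Y = (- (2%:R * a)) *: Phi z.
  rewrite zE; have -> : Y *m (Om *m (v^T *m v)) = - (a *: (Om *m (v^T *m v))).
    rewrite mulmxA (spm_mul_Om sY) mulNmx -mulmxA (mulmxA Y^T) -trmx_mul vY.
    by rewrite linearZ /= -scalemxAl -scalemxAr.
  have -> : Om *m (v^T *m v) *m Y = a *: (Om *m (v^T *m v)).
    by rewrite -!mulmxA vY -!scalemxAr.
  by rewrite mulr_natl mulr2n scaleNr scalerDl opprD.
have zm : z *m ad y ^+ m = (- (2%:R * a)) ^+ m *: z.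
  apply: Phi_inj_; rewrite linearZ /= (Phi_ad_iter sqt hsqrtu hE hconj hiE natr0).
  elim: m {ym} => [|m IH]; first by rewrite expr0 scale1r.
  rewrite iterS IH -scalemxAr -scalemxAl -scalerBr YZ scalerA.
  by rewrite exprSr.
have z0 : z != 0.
  apply: contraNneq v0 => z0; move: zE; rewrite z0 linear0 => zE.
  have vv : v^T *m v = 0.
    have : Om *m (Om *m (v^T *m v)) = 0 by rewrite -zE mulmx0.
    by rewrite mulmxA Om_sqr mulNmx mul1mx => /eqP; rewrite oppr_eq0 => /eqP.
  apply/eqP/rowP => j; have := congr1 (fun A : 'M_(n + n) => A j j) vv.
  rewrite !mxE big_ord1 !mxE => /eqP.
  by rewrite mulf_eq0 orbb => /eqP.
move: zm; rewrite ym mulmx0 => /esym/eqP; rewrite scaler_eq0 (negPf z0) orbF.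
by rewrite expf_eq0 oppr_eq0 mulf_eq0 (negPf (natr0 _)) //= => /andP[_ /eqP].
Qed.

(** The identity Ad (exp Y) = exp (ad Y) is applied to each factor; [nilpotent_Phi] guarantees that
    Y is nilpotent as a matrix. *)
Lemma elementary_is_conj (s : seq 'rV[K]_(\dim gt)) :
  (forall x, x \in s -> nilpotent_mx (ad x)) -> exists2 p, p \in unitmx &
    forall z, Phi (z *m \prod_(x <- s) exp_mx (ad x)) = p *m Phi z *m invmx p.
Proof.
elim: s => [|x s IH] ns.
  exists 1%:M; first exact: unitmx1.
  by move=> z; rewrite big_nil mulmx1 invmx1 mulmx1 mul1mx.
have [|p up hp] := IH; first by move=> y ys; apply: ns; rewrite inE ys orbT.
have nx : nilpotent_mx (ad x) by apply: ns; rewrite inE eqxx.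
have nX := nilpotent_Phi nx; have eN := exp_mxN natr0 nX.
have [ue _] := mulmx1_unit eN.
have ei : exp_mx (- Phi x) = invmx (exp_mx (Phi x)) by rewrite -[RHS]mulmx1 -eN mulKmx.
have upe : p *m exp_mx (Phi x) \in unitmx by rewrite unitmx_mul up.
exists (p *m exp_mx (Phi x)) => // z.
rewrite big_cons -mulmxE mulmxA hp (Phi_exp sqt hsqrtu hE hconj hiE natr0) // ei.
rewrite -!mulmxA; do 3!congr (_ *m _); apply: (can_inj (mulKmx upe)).
by rewrite mulmxV // -mulmxA mulKVmx // mulmxV.
Qed.

Lemma G_is_conj (f : 'End(mx)) : G pi conj k iota f -> exists2 p : 'M[K]_(n + n),
  p \in unitmx & forall X : mx, X \in gt -> f X \in gt /\
    map_mx iE (f X) = p *m map_mx iE X *m invmx p.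
Proof.
case=> -[[fL _] [s ns fE]] _; have [p up hp] := elementary_is_conj ns.
have fgt X : X \in gt -> f X \in gt by move=> hX; rewrite -fL memv_img.
exists p => // X hX; split; first exact: fgt.
rewrite -(Phi_coord sqt hsqrtu hE hconj hiE hX) -hp -fE (Phi_mul_ext sqt hsqrtu hE hconj hiE) //.
rewrite [in LHS](coord_vbasis hX) linear_sum.
apply: (big_rec2 (fun (A : mx) (B : 'M[K]_(n + n)) => map_mx iE A = B)) => [|i A B _ <-].
  by rewrite map_mx0.
by rewrite map_mxD linearZ /= rmx_scaleE map_mxZ hiE mxE.
Qed.

(* Conjugacy under G: the scalar e is all that distinguishes G from G^0 on V^+. *)
Definition gsim (B B' : 'M[E]_n) := exists e g, [/\ e != 0, g \in unitmx,
  J *m map_mx conj g = g *m J & B' = (e : F)%:A *: (g *m B *m g^T)].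

Section Conjugation.
Variable p : 'M[K]_(n + n).
Hypothesis uni : p \in unitmx.
Hypothesis p_gt : forall X : mx, X \in gt ->
  exists2 Y : mx, Y \in gt & map_mx iE Y = p *m map_mx iE X *m invmx p.
Hypothesis p_H0 : p *m map_mx iE (H0 E k) = map_mx iE (H0 E k) *m p.

Lemma block_form : exists g h, [/\ g \in unitmx, h \in unitmx,
  p = block_mx g 0 0 h & invmx p = block_mx (invmx g) 0 0 (invmx h)].
Proof.
have two0 : 2%:R != 0 :> K by apply: natr0.
have zero (A : 'M[K]_n) : - A = A -> A = 0.
  move/eqP; rewrite eq_sym -subr_eq0 opprK -mulr2n -scaler_nat scaler_eq0 (negPf two0).
  by move/eqP.
have [a [b [c [d pE]]]] : exists a b c d, p = block_mx a b c d.
  by exists (ulsubmx p), (ursubmx p), (dlsubmx p), (drsubmx p); rewrite submxK.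
move: p_H0 uni; rewrite pE /H0 map_block_mx !map_mx0 map_mxN map_mx1 !mulmx_block.
rewrite !(mulmx0, mul0mx, addr0, add0r, mulmxN, mulNmx, mulmx1, mul1mx).
case/eq_block_mx => _ /zero-> /esym/zero-> _; rewrite unitmxE det_ublock unitrM.
rewrite -!unitmxE => /andP[ua ud]; exists a, d; split=> //.
have PQ : block_mx a 0 0 d *m block_mx (invmx a) 0 0 (invmx d) = 1%:M.
  rewrite mulmx_block !(mulmx0, mul0mx, addr0, add0r) !mulmxV //.
  by rewrite -scalar_mx_block.
have [uP _] := mulmx1_unit PQ.
by rewrite -[LHS]mulmx1 -PQ mulKmx.
Qed.

Variables g h : 'M[K]_n.
Hypotheses (ug : g \in unitmx) (uh : h \in unitmx).
Hypotheses (pE : p = block_mx g 0 0 h) (piE : invmx p = block_mx (invmx g) 0 0 (invmx h)).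

(** The hypothesis on p is applied to diag(M, -M^T), which lies in the Lie algebra over F exactly
    because [tau] fixes M; the two diagonal blocks of the image give the two formulas. *)
Lemma conj_fixed_block M : tauJ M = M -> exists A, [/\ tauJ A = A,
  map_mx iE A = g *m map_mx iE M *m invmx g &
  (map_mx iE A)^T = h *m (map_mx iE M)^T *m invmx h].
Proof.
move=> /fixJ hM; pose X : mx := block_mx M 0 0 (- M^T).
have hX : X \in gt.
  apply/(gt_spm sqt hsqrtu hE hconj); split; first by apply/spm_block; rewrite !trmx0.
  rewrite /X /Tmx map_block_mx !map_mx0 !mulmx_block !(mulmx0, mul0mx, addr0, add0r).
  by rewrite hM map_mxN mulmxN mulNmx -map_trmx -!trmx_mul quat_conj_.
have [Y /(gt_spm sqt hsqrtu hE hconj)[sY tY]] := p_gt hX.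
have [a [b [c [d YE]]]] : exists a b c d, Y = block_mx a b c d.
  by exists (ulsubmx Y), (ursubmx Y), (dlsubmx Y), (drsubmx Y); rewrite submxK.
rewrite YE in sY tY *; have /spm_block[_ _ dE] := sY.
rewrite piE pE /X !map_block_mx !map_mx0 !mulmx_block.
rewrite !(mulmx0, mul0mx, addr0, add0r) => /eq_block_mx[aE _ _]; rewrite dE !map_mxN.
rewrite mulmxN mulNmx => /oppr_inj; rewrite -!map_trmx => aT.
exists a; split=> //; apply/fixJ; move: tY; rewrite /Tmx map_block_mx !mulmx_block.
by rewrite !(mulmx0, mul0mx, addr0, add0r) => /eq_block_mx[].
Qed.

(** Both formulas are linear over E, so [tau_decomp] extends them from the fixed matrices to all
    M. *)
Lemma conj_block M : exists A,
  map_mx iE A = g *m map_mx iE M *m invmx g /\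
  (map_mx iE A)^T = h *m (map_mx iE M)^T *m invmx h.
Proof.
have [] := tau_decomp sqt hsqrtu hE hconj JJ cJ M.
set Y := _ *: (_ + _); set Z := _ *: (_ - _); clearbody Y Z.
move=> /conj_fixed_block[A [_ A1 A2]] /conj_fixed_block[B [_ B1 B2]] ->.
exists (A + sqrtu *: B); rewrite !map_mxD !map_mxZ; split.
  by rewrite A1 B1 mulmxDr mulmxDl -scalemxAr -scalemxAl.
rewrite ![(_ + _)^T]raddfD /= ![(_ *: _)^T]linearZ /= A2 B2.
by rewrite mulmxDr mulmxDl -scalemxAr -scalemxAl.
Qed.

(** The matrix g and the inverse transpose of h induce the same conjugation, so h^T g is central. *)
Lemma block_scalar : exists s, h^T *m g = s%:M.
Proof.
have uhT : h^T \in unitmx by rewrite unitmx_tr.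
apply: mx_center => i j; have [A [A1 A2]] := conj_block (delta_mx i j).
have := congr1 trmx A2; rewrite trmxK !trmx_mul trmxK trmx_inv A1 map_delta_mx => E1.
have := congr1 (fun Z => h^T *m Z *m g) E1.
by rewrite !mulmxA mulmxKV // mulmxV // mul1mx -mulmxA.
Qed.

(* The entries of g delta_ij g^-1, which lie in E, are the products g_ai (g^-1)_jb; fix a nonzero
   (g^-1)_jb. *)
Lemma conj_descends (i0 : 'I_n) : exists c g1, c != 0 /\ c *: g = map_mx iE g1.
Proof.
have [j hj] : exists j, invmx g j i0 != 0.
  apply: contrapT => H; have := congr1 (fun A : 'M_n => A i0 i0) (mulmxV ug).
  rewrite !mxE eqxx big1 => [/eqP|j _]; first by rewrite eq_sym oner_eq0.
  have -> : invmx g j i0 = 0 by apply/eqP/negPn/negP => hj; apply: H; exists j.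
  by rewrite mulr0.
have H (ai : 'I_n * 'I_n) : exists x, iE x = invmx g j i0 * g ai.1 ai.2.
  have [A [+ _]] := conj_block (delta_mx ai.2 j).
  move/(congr1 (fun B : 'M_n => B ai.1 i0)); rewrite map_delta_mx mxE mul_delta_entry => hA.
  by exists (A ai.1 i0); rewrite hA mulrC.
have {H}[f fE] := choice H.
exists (invmx g j i0), (\matrix_(a, i) f (a, i)); split=> //.
by apply/matrixP => a i; rewrite !mxE fE.
Qed.

(* The descents [tau g1] and g1 induce the same conjugation, so they differ by a scalar z of
   norm 1, and Hilbert 90 applies to z. *)
Lemma conj_quat (i0 : 'I_n) : exists c g0, [/\ c != 0, g0 \in unitmx, tauJ g0 = g0 &
  c *: g = map_mx iE g0].
Proof.
have [c [g1 [c0 cg]]] := conj_descends i0.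
have ug1 : g1 \in unitmx by rewrite -(map_unitmx iE) -cg unitmxZ ?unitfE.
have cgi : invmx (map_mx iE g1) = c^-1 *: invmx g by rewrite -cg invmxZ ?unitmxZ ?unitfE.
have tM := tauM sqt hsqrtu hE hconj JJ cJ.
have tZ := tauZ sqt hsqrtu hE hconj JJ cJ.
have [z zE] : exists z, invmx g1 *m tauJ g1 = z%:M.
  have comm M : tauJ M = M -> invmx g1 *m tauJ g1 *m M = M *m (invmx g1 *m tauJ g1).
    move=> hM; have [A [tA A1 _]] := conj_fixed_block hM.
    have AE : A = g1 *m M *m invmx g1.
      apply: (@map_mx_inj _ _ iE); rewrite A1 !map_mxM map_invmx cgi -cg.
      by rewrite -scalemxAr -!scalemxAl scalerA mulVf // scale1r.
    have : A *m g1 = g1 *m M by rewrite AE mulmxKV.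
    move/(congr1 tauJ); rewrite !tM tA hM AE -!mulmxA => <-.
    by rewrite mulKmx.
  move: (invmx g1 *m tauJ g1) comm => U comm; apply: mx_center => i j.
  have [] := tau_decomp sqt hsqrtu hE hconj JJ cJ (delta_mx i j).
  set Y := _ *: (_ + _); set Z := _ *: (_ - _); clearbody Y Z => hY hZ ->.
  by rewrite mulmxDr mulmxDl -scalemxAr -scalemxAl !comm.
have tg : tauJ g1 = z *: g1 by rewrite -mul_mx_scalar -zE mulKVmx.
have zz : z * conj z = 1.
  have := tauK sqt hsqrtu hE hconj JJ cJ g1; rewrite tg tZ tg scalerA => H.
  apply/eqP; rewrite -subr_eq0; have : (z * conj z - 1) *: g1 = 0.
    by rewrite scalerBl mulrC H scale1r subrr.
  move/(congr1 (fun Z => Z *m invmx g1)); rewrite -scalemxAl mulmxV // mul0mx.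
  by move/(congr1 (fun A : 'M_n => A i0 i0)); rewrite !mxE eqxx mulr1 => ->.
have [w w0 wE] := hilbert90 sqt hsqrtu hE hconj zz.
exists (iE w * c), (w *: g1); split.
- by rewrite mulf_neq0 // fmorph_eq0.
- by rewrite unitmxZ ?unitfE.
- by rewrite tZ tg scalerA mulrC wE.
by rewrite map_mxZ -cg scalerA.
Qed.

(** With c g = g0 defined over E and h^T g = s, the matrix C = g0 B g0^T equals c^2 s B' over K. A
    nonzero entry shows that this factor is the image of some t in E; C and B' satisfy the same
    semilinear equation, which forces conj t = t, so t is in F. *)
Lemma conj_up B B' : up B \in gt -> up B' \in gt ->
  map_mx iE (up B') = p *m map_mx iE (up B) *m invmx p -> gsim B B'.
Proof.
move=> /(up_gt sqt hsqrtu hE hconj)[BT hB] /(up_gt sqt hsqrtu hE hconj)[BT' hB'].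
rewrite piE pE /up !map_block_mx !map_mx0 !mulmx_block !(mulmx0, mul0mx, addr0, add0r).
case/eq_block_mx => _ BE _ _.
have [B0|B0] := eqVneq B 0.
  have -> : B' = 0.
    by apply: (@map_mx_inj _ _ iE); rewrite BE B0 !map_mx0 mulmx0 mul0mx.
  exists 1, 1%:M; split; rewrite ?oner_eq0 ?unitmx1 ?map_mx1 ?mulmx1 ?mul1mx //.
  by rewrite B0 mul0mx scaler0.
have [i0] : exists i0 : 'I_n, True.
  apply: contrapT => H; case/eqP: B0; apply/matrixP => i j.
  by case: H; exists i.
move=> _; have [c [g0 [c0 ug0 tg0 cg]]] := conj_quat i0.
have [s sE] := block_scalar; have qg0 := iffRL (fixJ g0) tg0.
pose C := g0 *m B *m g0^T.
have hC : J *m map_mx conj C = C *m J^T.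
  rewrite /C !map_mxM !mulmxA qg0 -(mulmxA g0 J) hB -!mulmxA; do 2!congr (_ *m _).
  by rewrite -map_trmx -!trmx_mul quat_conj_.
have C0 : C != 0.
  apply: contraNneq B0 => C0; apply/eqP.
  have ug0T : g0^T \in unitmx by rewrite unitmx_tr.
  by apply: (can_inj (mulKmx ug0)); apply: (can_inj (mulmxK ug0T)); rewrite -/C C0 mulmx0 mul0mx.
have CE : map_mx iE C = (c ^+ 2 * s) *: map_mx iE B'.
  rewrite /C !map_mxM -map_trmx -cg linearZ /= BE.
  have gT : g^T = s *: invmx h.
    have := congr1 trmx sE; rewrite trmx_mul trmxK tr_scalar_mx => gh.
    by rewrite -mul_scalar_mx -gh mulmxK.
  by rewrite gT -!scalemxAl -!scalemxAr !scalerA expr2 mulrA.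
have [[i j] /= Cij] : exists ij : 'I_n * 'I_n, C ij.1 ij.2 != 0.
  apply: contrapT => H; case/eqP: C0; apply/matrixP => i j; rewrite [RHS]mxE.
  by apply/eqP/negPn/negP => hij; apply: H; exists (i, j).
have CEij : iE (C i j) = c ^+ 2 * s * iE (B' i j).
  by have := congr1 (fun A : 'M_n => A i j) CE; rewrite !mxE.
have B'0 : B' i j != 0.
  by apply: contraNneq Cij => b0; rewrite -(fmorph_eq0 iE) CEij b0 rmorph0 mulr0.
pose t := C i j / B' i j; have tE : C = t *: B'.
  apply: (@map_mx_inj _ _ iE); rewrite CE map_mxZ; congr (_ *: _).
  by rewrite fmorph_div CEij mulfK // fmorph_eq0.
have t0 : t != 0 by rewrite mulf_neq0 ?invr_eq0.
have [e eE] : exists e, t = e%:A.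
  apply: (conj_fixed sqt hsqrtu hE hconj).
  have := hC; rewrite tE map_mxZ -scalemxAr -scalemxAl hB' => /eqP.
  rewrite -subr_eq0 -scalerBl scaler_eq0 subr_eq0 => /orP[/eqP //|/eqP BJ].
  have : B' *m (J^T *m J^T) = 0 by rewrite mulmxA BJ mul0mx.
  rewrite -trmx_mul JJ tr_scalar_mx mul_mx_scalar => /eqP.
  rewrite scaler_eq0 alg_eq0 (negPf (sqt_pi0 sqt)) /= => /eqP B'z.
  by rewrite B'z mxE eqxx in B'0.
have e0 : e != 0 by rewrite -(alg_eq0 E) -eE.
exists e^-1, g0; split=> //; first by rewrite invr_eq0.
by rewrite -/C tE eE scalerA -algM mulVf // !scale1r.
Qed.

End Conjugation.

Lemma G_orbit_gsim B Y : up B \in gt -> same_orbit (G pi conj k iota) (up B) Y ->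
  exists B', [/\ Y = up B', up B' \in gt & gsim B B'].
Proof.
move=> hB [f fG fY]; have [p unip pE] := G_is_conj fG.
have [[[_ fbr] _] fH0] := fG.
have p_gt X : X \in gt -> exists2 Y, Y \in gt & map_mx iE Y = p *m map_mx iE X *m invmx p.
  by move=> hX; exists (f X); have [] := pE _ hX.
have hH0 : H0 E k \in gt := H0_gt sqt hsqrtu hE hconj hiE natr0 k.
have pH0 : p *m map_mx iE (H0 E k) = map_mx iE (H0 E k) *m p.
  by have [_] := pE _ hH0; rewrite fH0 => {2}->; rewrite mulmxKV.
have [g [h [ug uh pB piB]]] := block_form unip p_gt pH0.
have /VplusP[_ hB2] : up B \in Vplus pi conj k by apply/(up_Vplus sqt hsqrtu hE hconj).
have [Ygt YE] := pE _ hB; rewrite fY in Ygt YE.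
have /(VplusE sqt hsqrtu hE hconj)[b [_ _ bE]] : Y \in Vplus pi conj k.
  by apply/VplusP; split=> //; rewrite -fY -{1}fH0 -fbr // hB2 linearZ.
exists (flat b); rewrite -bE; split=> //; rewrite bE in Ygt YE.
exact: (conj_up unip p_gt pH0 ug uh pB piB hB Ygt YE).
Qed.

End OrbitsOfG.
Lemma det_mxdiag (R : comNzRingType) m (p_ : 'I_m -> nat) (V_ : forall i, 'M[R]_(p_ i)) :
  \det (\mxdiag_i V_ i) = \prod_i \det (V_ i).
Proof.
elim: m p_ V_ => [|m IH] p_ V_.
  have e : (\sum_(i < 0) p_ i = 0)%N by exact: big_ord0.
  by rewrite [RHS]big_ord0; move: (\mxdiag__ _); rewrite e => M; exact: det_mx00.
rewrite mxdiag_recl [RHS]big_ord_recl/= -IH.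
by case: _ / mxsize_recl; rewrite ?castmx_id det_ublock.
Qed.

(** * Invariants of the orbits *)

Section Invariants.
Variables (F : fieldType) (pi u : F).
Hypothesis sqt : square_theory pi u.
Variables (E : fieldExtType F) (sqrtu : E).
Hypotheses (hsqrtu : sqrtu ^+ 2 = u%:A) (hE : <<1%AS; sqrtu>>%VS = {:E}%VS).
Variable conj : {lrmorphism E -> E}.
Hypothesis hconj : conj sqrtu = - sqrtu.
Variable k : nat.

Local Notation R := ('M[E]_2).
Local Notation n := (\sum_(i < k.+1) 2)%N.
Local Notation J := (Jmx E pi k).
Local Notation Sp := (Splus pi conj).
Local Notation quat := (quat pi conj).
Local Notation qmat := (qmat pi conj).
Local Notation bsim := (bsim pi conj).
Local Notation gsim := (@gsim F pi E conj k).
Local Notation cl := (cl pi u).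
Local Notation ntype := (ntype pi u).

Lemma gsim_trans (B C D : 'M[E]_n) : gsim B C -> gsim C D -> gsim B D.
Proof.
move=> [e [g [e0 ug qg ->]]] [e' [g' [e0' ug' qg' ->]]].
exists (e' * e), (g' *m g); split; rewrite ?mulf_neq0 ?unitmx_mul ?ug' //.
  by rewrite map_mxM mulmxA qg' -(mulmxA g' J) qg mulmxA.
by rewrite algM trmx_mul -scalemxAr -scalemxAl scalerA !mulmxA.
Qed.

Lemma bsim_gsim b b' : bsim b b' -> gsim (flat b) (flat b').
Proof.
move=> [g [h [qg qh gh hg <-]]]; exists 1, (flat g); split.
- exact: oner_neq0.
- by have [] : flat g \in unitmx /\ flat h \in unitmx
    by apply: mulmx1_unit; rewrite -flatM gh flat1.
- exact/(quat_flat sqt hsqrtu hE hconj).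
by rewrite !scale1r -flat_adj -!flatM.
Qed.

Lemma gsim_rank (B C : 'M[E]_n) : gsim B C -> \rank C = \rank B.
Proof.
move=> [e [g [e0 ug _ ->]]]; rewrite mxrank_scale_nz ?alg_eq0 //.
rewrite mxrankMfree ?row_free_unit ?unitmx_tr //.
have fg : row_full g by rewrite row_full_unit.
by rewrite (eqmxMfull _ fg).
Qed.

Lemma rank_flat_dg (d : 'I_k.+1 -> R) : (forall i, Sp (d i)) ->
  (\rank (flat (dg d)) + 2 * ntype d None = 2 * k.+1)%N.
Proof.
move=> Sd; rewrite flat_dg rank_mxdiag /ntype big_distrr -big_split /=.
transitivity (\sum_(i < k.+1) 2)%N; last by rewrite sum_nat_const card_ord mulnC.
apply: eq_bigr => i _.
rewrite (cl_None sqt hsqrtu hE hconj) //; have [->|d0] := eqVneq; first by rewrite mxrank0.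
rewrite muln0 addn0; apply/eqP; rewrite -[_ == _]/(row_free _) row_free_unit.
by apply: (skew_unit sqt hsqrtu hE hconj) d0; case: (Sd i).
Qed.

Lemma det_quat_flat (g : 'M[E]_n) : J *m map_mx conj g = g *m J -> exists a, \det g = a%:A.
Proof.
move=> /(congr1 determinant); rewrite !det_mulmx det_map_mx mulrC => dE.
apply: (conj_fixed sqt hsqrtu hE hconj); apply: mulIf dE.
have := congr1 determinant (Jmx_sqr sqt hsqrtu hE hconj k).
rewrite det_mulmx det_scalar => h; apply/eqP => dJ; move/eqP: h.
by rewrite dJ mul0r eq_sym expf_eq0 alg_eq0 (negPf (sqt_pi0 sqt)) andbF.
Qed.

Let pad (M : R) : R := if M == 0 then 1%:M else M.

(* Replacing the zero blocks by identity blocks gives a discriminant for degenerate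
   forms: the similitude restricts to the nonzero blocks. *)
Lemma gsim_det (d d' : 'I_k.+1 -> R) : (forall i, (d i == 0) = (d' i == 0)) ->
  gsim (flat (dg d)) (flat (dg d')) ->
  exists f : F, \prod_i \det (pad (d' i)) = (f ^+ 2)%:A * \prod_i \det (pad (d i)).
Proof.
move=> zz [e [g0 [e0 _]]]; rewrite -(unflatK g0); move: (unflat g0) => g.
move=> /(quat_flat sqt hsqrtu hE hconj) qg E1.
have {}E1 : dg d' = dg (fun _ => (e%:A)%:M) *m (g *m dg d *m adj g).
  apply: flat_inj; rewrite E1 -flat_adj -!flatM [RHS]flatM -mul_scalar_mx.
  by congr (_ *m _); rewrite flat_dg mxdiagZ.
(* The matrix a is the corner of g on the indices of nonzero blocks and the identity elsewhere.
   Since the entries g_it with d_t = 0 drop out of the product, this corner relates the two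
   nondegenerate parts. *)
pose a : 'M[R]_k.+1 := \matrix_(i, j)
  if (d i == 0) || (d j == 0) then (i == j)%:R else g i j.
have qa : qmat a.
  move=> i j; rewrite mxE; case: ifP => // _; case: eqP => _.
    exact: (quat1 sqt hsqrtu hE hconj).
  exact: (quat0 sqt hsqrtu hE hconj).
pose w i : R := if d i == 0 then 1%:M else (e%:A)%:M.
have E2 : dg (fun i => pad (d' i)) = dg w *m (a *m dg (fun i => pad (d i)) *m adj a).
  apply/matrixP => i j; rewrite mul_dgE dgE [in RHS]mxE.
  have -> : \sum_t (a *m dg (fun i => pad (d i))) i t * adj a t j
      = \sum_t a i t *m pad (d t) *m (a j t)^T.
    by apply: eq_bigr => t _; rewrite mulmx_dgE adjE.
  rewrite /w /pad -zz; have [di|di] := boolP (d i == 0).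
    rewrite (bigD1 i) //= big1 ?addr0 => [|t ti].
      rewrite !mxE di !orbT /= eqxx !mul1mx eq_sym; case: eqP => _ /=.
        by rewrite trmx1.
      by rewrite trmx0.
    by rewrite mxE di /= eq_sym (negPf ti) mul0mx mul0mx.
  have [dj|dj] := boolP (d j == 0).
    have ij : i != j by apply: contraNneq di => ->.
    rewrite (bigD1 j) //= big1 ?addr0 => [|t tj].
      by rewrite mxE dj orbT (negPf ij) !mul0mx mulmx0.
    by rewrite [a j t]mxE dj /= [j == t]eq_sym (negPf tj) trmx0 mulmx0.
  have := congr1 (fun A : 'M[R]_k.+1 => A i j) E1; rewrite mul_dgE dgE mxE => ->.
  congr (_ *m _); apply: eq_bigr => t _; rewrite mulmx_dgE adjE !mxE.
  rewrite (negPf di) (negPf dj) /=; case: eqP => // dt0.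
  have it : i != t by apply: contraNneq di => ->; apply/eqP.
  by rewrite dt0 (negPf it) -[_ * _]/(_ *m _) mulmx0 !mul0mx.
have [da dE] := det_quat_flat (iffRL (quat_flat sqt hsqrtu hE hconj a) qa).
have [v vE] : exists v : F, \prod_i \det (w i) = (v ^+ 2)%:A.
  pose v := \prod_(i < k.+1) (if d i == 0 then 1 else e); exists v.
  rewrite algX /v; have -> : (\prod_(i < k.+1) (if d i == 0 then 1 else e))%:A
     = \prod_(i < k.+1) (if d i == 0 then 1 else e)%:A :> E.
    exact: (rmorph_prod (in_alg E)).
  rewrite -prodrXl; apply: eq_bigr => i _; rewrite /w.
  by case: ifP => _; rewrite ?det1 ?det_scalar // scale1r expr1n.
have := congr1 (fun A => \det (flat A)) E2.
rewrite !flatM flat_adj !det_mulmx det_tr dE !flat_dg !det_mxdiag vE => ->.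
by exists (v * da); rewrite !(algX, algM); ring.
Qed.

(** The determinant of a padded block modulo squares: 1 for a zero block, the opposite of [sq_rep]
    otherwise. *)
Let sgn t : F := (-1) ^+ (t != None) * pi ^+ ((t == Some 1%R) + (t == Some 2%:R))
  * u ^+ (t == Some (2%:R : 'I_3)).

Lemma det_pad M : Sp M -> exists2 x, x != 0 & \det (pad M) = (sgn (cl M) * x ^+ 2)%:A.
Proof.
move=> SM; case E1 : (cl M) => [l|].
  have [c c0 dE] := cl_class sqt hsqrtu hE hconj E1; exists c => //.
  have M0 : M != 0 by rewrite -(cl_None sqt hsqrtu hE hconj) // E1.
  rewrite /pad (negPf M0) -[LHS]opprK dE -algN; congr (_%:A).
  have e : (((0 : 'I_3) == 1) = false) * (((0 : 'I_3) == 2%:R) = false)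
    * (((1 : 'I_3) == 2%:R) = false) * (((2%:R : 'I_3) == 1) = false) by [].
  rewrite /sgn !(inj_eq Some_inj) /=; case: (ord3P l) => ->;
    rewrite ?eqxx !e !(sq_repE sqt hsqrtu hE hconj) /=; ring.
exists 1; first exact: oner_neq0.
have /eqP : cl M = None by []; rewrite (cl_None sqt hsqrtu hE hconj) // /pad => ->.
by rewrite det1 /sgn /= expr1n !mulr1 scale1r.
Qed.

Lemma det_pads d : (forall i, Sp (d i)) -> exists2 x, x != 0 &
  \prod_(i < k.+1) \det (pad (d i)) = ((-1) ^+ (\sum_i (cl (d i) != None))
    * (pi ^+ (ntype d (Some 1%R) + ntype d (Some 2%:R)) * u ^+ ntype d (Some 2%:R)) * x ^+ 2)%:A.
Proof.
move=> Sd; have H i : exists x, x != 0 /\ \det (pad (d i)) = (sgn (cl (d i)) * x ^+ 2)%:A.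
  by have [x] := det_pad (Sd i); exists x.
have {H}[x xE] := choice H.
exists (\prod_i x i); first by apply/prodf_neq0 => i _; case: (xE i).
transitivity (\prod_i (sgn (cl (d i)) * x i ^+ 2)%:A : E).
  by apply: eq_bigr => i _; case: (xE i).
rewrite -(rmorph_prod (in_alg E)) /=; congr (_%:A).
rewrite big_split prodrXl /sgn !big_split !prodrXr /=; congr (_ * _).
by rewrite -mulrA /ntype -[in RHS]big_split.
Qed.

(** The parity of the valuation gives the parity of a + b; after cancelling pi, the fact that u is
    not a square gives that of b. *)
Lemma parity_of_class a b a' b' x : x != 0 ->
  pi ^+ (a + b) * u ^+ b * x ^+ 2 = pi ^+ (a' + b') * u ^+ b' ->
  odd a = odd a' /\ odd b = odd b'.
Proof.
move=> x0 E1; have pi0 := sqt_pi0 sqt; have u0 : u != 0.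
  by apply: contraNneq (sqt_u sqt 0) => ->; rewrite expr0n.
have red (z : F) m : z ^+ m = z ^+ odd m * (z ^+ m./2) ^+ 2.
  by rewrite -exprM -exprD muln2 odd_double_half.
have uev c y : y != 0 -> even_class u (u ^+ c * y ^+ 2).
  move=> y0; rewrite red -mulrA -exprMn mulrC.
  apply: even_classM; first by rewrite mulf_neq0 ?expf_neq0.
  case: (odd c); last exact: even_class1.
  by exists 1; [exact: oner_neq0 | right; ring].
have uX c y : y != 0 -> u ^+ odd c * y ^+ 2 != 0.
  by move=> y0; rewrite mulf_neq0 ?expf_neq0.
move: E1; rewrite (red pi (a + b)%N) (red pi (a' + b')%N) (red u b) (red u b').
set s := pi ^+ _./2; set t := pi ^+ _./2; set v := u ^+ _./2; set w := u ^+ _./2 => E1.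
have [s0 t0 v0 w0] : [/\ s != 0, t != 0, v != 0 & w != 0] by split; apply: expf_neq0.
have E2 : pi ^+ odd (a + b) * (u ^+ odd b * (s * v * x) ^+ 2)
    = pi ^+ odd (a' + b') * (u ^+ odd b' * (t * w) ^+ 2).
  by transitivity (pi ^+ odd (a + b) * s ^+ 2 * (u ^+ odd b * v ^+ 2) * x ^+ 2);
    [ring | rewrite E1; ring].
have y0 : s * v * x != 0 by rewrite !mulf_neq0.
have y0' : t * w != 0 by rewrite mulf_neq0.
have ev1 := uev (odd b) _ y0; have ev2 := uev (odd b') _ y0'.
have par : odd (a + b) = odd (a' + b').
  case: (odd (a + b)) (odd (a' + b')) E2 => [] [] //; rewrite expr0 expr1 mul1r => E2.
    by case: (sqt_pi sqt ev1); rewrite E2.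
  by case: (sqt_pi sqt ev2); rewrite -E2.
move: E2; rewrite par => /(mulfI (expf_neq0 _ pi0)) E2.
have usq (z z' : F) : z != 0 -> u * z ^+ 2 <> z' ^+ 2.
  move=> z0 E3; have := sqt_u sqt (z' / z); rewrite expr_div_n -E3.
  by rewrite mulfK ?eqxx // expf_neq0.
have ob : odd b = odd b'.
  case: (odd b) (odd b') E2 => [] [] //; rewrite expr0 expr1 mul1r => E2.
    by case: (usq _ _ y0 E2).
  by case: (usq _ _ y0' (esym E2)).
by move: par; rewrite !oddD ob => /addIb.
Qed.

Lemma det_types (c d : 'I_k.+1 -> R) (f : F) : (forall i, Sp (c i)) -> (forall i, Sp (d i)) ->
  (forall i, (c i == 0) = (d i == 0)) ->
  \prod_i \det (pad (d i)) = (f ^+ 2)%:A * \prod_i \det (pad (c i)) ->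
  forall l, l != 0 -> odd (ntype c (Some l)) = odd (ntype d (Some l)).
Proof.
move=> Sc Sd zz fE; have [x x0 xE] := det_pads Sc; have [y y0 yE] := det_pads Sd.
move: fE; rewrite xE yE -algM => /alg_inj.
(* Both forms have the same number of nonzero blocks, so the two discriminants carry the same sign
   e, removed by e^2 = 1. *)
have -> : (\sum_i (cl (c i) != None) = \sum_i (cl (d i) != None))%N.
  by apply: eq_bigr => i _; rewrite !(cl_None sqt hsqrtu hE hconj) // zz.
set e := _ ^+ _; have ee : e * e = 1 by rewrite -expr2 -exprM mulnC exprM sqrrN !expr1n.
have gen (q q' t : F) : e * q' * t = f ^+ 2 * (e * q * x ^+ 2) ->
    e * e * q' * t = e * e * q * (f * x) ^+ 2.
  by move=> h'; transitivity (e * (e * q' * t)); [ring | rewrite h'; ring].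
move=> E1; have E2 : pi ^+ (ntype c (Some 1%R) + ntype c (Some 2%:R))
    * u ^+ ntype c (Some 2%:R) * (f * x / y) ^+ 2
  = pi ^+ (ntype d (Some 1%R) + ntype d (Some 2%:R)) * u ^+ ntype d (Some 2%:R).
  have : e * e * (pi ^+ (ntype d (Some 1%R) + ntype d (Some 2%:R))
     * u ^+ ntype d (Some 2%:R)) * y ^+ 2 = e * e *
     (pi ^+ (ntype c (Some 1%R) + ntype c (Some 2%:R)) * u ^+ ntype c (Some 2%:R)) * (f * x) ^+ 2.
    exact: gen E1.
  rewrite ee !mul1r => E3; rewrite expr_div_n mulrA -E3 mulfK // expf_neq0 //.
have u0 : u != 0 by apply: contraNneq (sqt_u sqt 0) => ->; rewrite expr0n.
have z0 : f * x / y != 0.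
  apply: contraTneq isT => z0; move/eqP: E2; rewrite z0 expr0n mulr0 eq_sym mulf_eq0.
  rewrite !expf_eq0 (negPf (sqt_pi0 sqt)) andbF /=.
  by rewrite (negPf u0) andbF.
have [o1 o2] := parity_of_class z0 E2.
by move=> l; case: (ord3P l) => ->.
Qed.

Lemma gsim_types (d d' : 'I_k.+1 -> R) : (forall i, Sp (d i)) -> (forall i, Sp (d' i)) ->
  gsim (flat (dg d)) (flat (dg d')) -> ntype d None = ntype d' None /\
  forall l, l != 0 -> odd (ntype d (Some l)) = odd (ntype d' (Some l)).
Proof.
move=> Sd Sd' h; have N : ntype d None = ntype d' None.
  have := rank_flat_dg Sd; have := rank_flat_dg Sd'; rewrite (gsim_rank h); lia.
split=> //.
have NE (c : 'I_k.+1 -> R) : (forall i, Sp (c i)) ->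
    (\sum_i (c i == 0%R) = ntype c None)%N /\ (\sum_i (c i == 0%R) + \sum_i (c i != 0%R) = k.+1)%N.
  move=> Sc; split; first by apply: eq_bigr => i _; rewrite (cl_None sqt hsqrtu hE hconj).
  rewrite -big_split -[RHS]card_ord -sum1_card; apply: eq_bigr => i _ /=.
  by case: eqP.
(* [gsim_det] requires the zero blocks to sit at the same places, so d is permuted first. *)
have [s sE] : exists s : 'S_k.+1, forall i, (d (s i) == 0) = (d' i == 0).
  apply: (perm_of_fibers (f := fun i => d i == 0) (g := fun i => d' i == 0)) => t.
  have [N1 N2] := NE d Sd; have [N1' N2'] := NE d' Sd'.
  have T (c : 'I_k.+1 -> R) : (\sum_i ((c i == 0%R) == t) =
      if t then \sum_i (c i == 0%R) else \sum_i (c i != 0%R))%N.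
    by case: t; apply: eq_bigr => i _; case: (c i == 0%R).
  by rewrite !T; case: t {T}; lia.
have tE t : ntype (fun i => d (s i)) t = ntype d t.
  by rewrite /ntype [RHS](reindex_inj (@perm_inj _ s)).
have Sds i : Sp (d (s i)) by [].
have [f fE] : exists f : F, \prod_i \det (pad (d' i))
    = (f ^+ 2)%:A * \prod_i \det (pad (d (s i))).
  apply: gsim_det => //; apply: gsim_trans h; apply/bsim_gsim.
  apply: (bsim_sym sqt hsqrtu hE hconj).
  exact: (bsim_dg_perm sqt hsqrtu hE hconj).
have o := det_types Sds Sd' sE fE.
by move=> l l0; rewrite -tE o.
Qed.

End Invariants.
(** * Classification of the orbits *)

Section Classification.
Variables (F : fieldType) (pi u : F).
Hypothesis sqt : square_theory pi u.
Variables (E : fieldExtType F) (sqrtu : E).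
Hypotheses (hsqrtu : sqrtu ^+ 2 = u%:A) (hE : <<1%AS; sqrtu>>%VS = {:E}%VS).
Variable conj : {lrmorphism E -> E}.
Hypothesis hconj : conj sqrtu = - sqrtu.
Variables (K : closedFieldType) (iota : {rmorphism F -> K}).
Hypothesis natr0 : forall m, (0 < m)%N -> m%:R != 0 :> F.
Variable k : nat.

Local Notation R := ('M[E]_2).
Local Notation n := (\sum_(i < k.+1) 2)%N.
Local Notation mx := (rmx E (n + n)).
Local Notation Sp := (Splus pi conj).
Local Notation smat := (smat pi conj).
Local Notation bsim := (bsim pi conj).
Local Notation cl := (cl pi u).
Local Notation ntype := (ntype pi u).
Local Notation Vp := (Vplus pi conj k).
Local Notation same := (same_orbit (G pi conj k iota)).
Local Notation same0 := (same_orbit (G0 pi conj k)).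
Local Notation dup d := (up (F := F) (k := k) (flat (dg d))).

Let VE := VplusE sqt hsqrtu hE hconj.

(** Here G and G^0 are seen to have the same orbits on V^+: an element of G induces a similitude,
    similar diagonal forms have the same types, and equal types give conjugacy under G^0. *)
Lemma same_bsim b b' : smat b -> adj b = b -> smat b' -> adj b' = b' ->
  same (up (F := F) (k := k) (flat b)) (up (flat b')) <-> bsim b b'.
Proof.
move=> hb bb hb' bb'; have natK m : (0 < m)%N -> m%:R != 0 :> K.
  by move=> m0; rewrite -(rmorph_nat iota) fmorph_eq0 natr0.
have [iE hiE] := extend_embedding sqt hsqrtu hE hconj iota.
split=> [h|/(G0_orbit sqt hsqrtu hE hconj b' hb bb)[f hf fE]]; last first.
  by exists f => //; apply: (G0_sub_G sqt hsqrtu hE hconj hiE natK).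
have bgt : up (flat b) \in gt pi conj k.
  apply/(up_gt sqt hsqrtu hE hconj); rewrite -flat_adj bb; split=> //.
  exact/(skew_flat sqt hsqrtu hE hconj).
have [_ [/(up_inj sqt hsqrtu hE hconj) <- _ gs]] := G_orbit_gsim sqt hsqrtu hE hconj hiE natK bgt h.
have [d Sd bd] := bsim_diag sqt hsqrtu hE hconj hb bb.
have [d' Sd' bd'] := bsim_diag sqt hsqrtu hE hconj hb' bb'.
have tr := @bsim_trans F pi u sqt E sqrtu hsqrtu hE conj hconj k.+1.
have sy := @bsim_sym F pi u sqt E sqrtu hsqrtu hE conj hconj k.+1.
apply: (tr _ _ _ bd); apply: (tr _ _ _ _ (sy _ _ bd')).
have bg := @bsim_gsim F pi u sqt E sqrtu hsqrtu hE conj hconj k.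
have gtr := @gsim_trans F pi u sqt E sqrtu hsqrtu hE conj hconj k.
have [N o] := gsim_types sqt hsqrtu hE hconj Sd Sd'
  (gtr _ _ _ (gtr _ _ _ (bg _ _ (sy _ _ bd)) gs) (bg _ _ bd')).
exact: (bsim_types sqt hsqrtu hE hconj).
Qed.

Lemma same_Vplus X Y : X \in Vp -> same X Y -> Y \in Vp.
Proof.
move=> /VplusP[Xgt X2] [f [[[fL fbr] fe] f0] <-].
have hH0 : H0 E k \in gt pi conj k.
  have natK m : (0 < m)%N -> m%:R != 0 :> K.
    by move=> m0; rewrite -(rmorph_nat iota) fmorph_eq0 natr0.
  have [iE hiE] := extend_embedding sqt hsqrtu hE hconj iota.
  exact: (H0_gt sqt hsqrtu hE hconj hiE natK).
apply/VplusP; split; first by rewrite -fL memv_img.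
by rewrite -{1}f0 -fbr // X2 linearZ.
Qed.

(** Reflexivity, and below symmetry and transitivity, are inherited from [bsim] rather than from a
    group structure on G. *)
Lemma same_refl X : X \in Vp -> same X X.
Proof.
move=> /VE[b [hb bb ->]]; apply/same_bsim => //.
exact: (bsim_refl sqt hsqrtu hE hconj).
Qed.

Lemma same_sym X Y : X \in Vp -> same X Y -> same Y X.
Proof.
move=> hX h; have /VE[b' [hb' bb' YE]] := same_Vplus hX h.
have /VE[b [hb bb XE]] := hX; move: h; rewrite XE YE.
move=> /same_bsim -/(_ hb bb hb' bb') h; apply/same_bsim => //.
exact: (bsim_sym sqt hsqrtu hE hconj).
Qed.

Lemma same_trans X Y Z : X \in Vp -> same X Y -> same Y Z -> same X Z.
Proof.
move=> hX h h'; have hY := same_Vplus hX h; have hZ := same_Vplus hY h'.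
have [/VE[b [hb bb XE]] /VE[b' [hb' bb' YE]] /VE[b2 [hb2 bb2 ZE]]] := And3 hX hY hZ.
move: h h'; rewrite XE YE ZE => /same_bsim -/(_ hb bb hb' bb') h.
move=> /same_bsim -/(_ hb' bb' hb2 bb2) h'; apply/same_bsim => //.
exact: (bsim_trans sqt hsqrtu hE hconj) h h'.
Qed.

Lemma same0_same X Y : same0 X Y -> same X Y.
Proof.
have natK m : (0 < m)%N -> m%:R != 0 :> K.
  by move=> m0; rewrite -(rmorph_nat iota) fmorph_eq0 natr0.
have [iE hiE] := extend_embedding sqt hsqrtu hE hconj iota.
by move=> [f hf fE]; exists f => //; apply: (G0_sub_G sqt hsqrtu hE hconj hiE natK).
Qed.

Lemma dg_forms (d : 'I_k.+1 -> R) : (forall i, Sp (d i)) -> smat (dg d) /\ adj (dg d) = dg d.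
Proof.
move=> Sd; split=> [i j|].
  rewrite dgE; case: eqP => _; first by case: (Sd i).
  exact: (skew0 sqt hsqrtu hE hconj).
by rewrite adj_dg; apply/matrixP => i j; rewrite !dgE; case: (Sd i) => ->.
Qed.

Lemma dup_Vplus d : (forall i, Sp (d i)) -> dup d \in Vp.
Proof. by move=> /dg_forms[sd ad]; apply/VE; exists (dg d). Qed.

(** A complete invariant of the orbit; the parity of the number of blocks of class 1 follows, since
    there are k + 1 blocks in all. *)
Definition signature (d : 'I_k.+1 -> R) : nat * bool * bool :=
  (ntype d None, odd (ntype d (Some 1%R)), odd (ntype d (Some 2%:R))).

Lemma signature_eq d d' : signature d = signature d' <-> (ntype d None = ntype d' None /\
  forall l, l != 0 -> odd (ntype d (Some l)) = odd (ntype d' (Some l))).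
Proof using Type.
split=> [[N o1 o2]|[N o]]; first by split=> // l; case: (ord3P l) => ->.
by rewrite /signature N !o.
Qed.

Lemma same_signature d d' : (forall i, Sp (d i)) -> (forall i, Sp (d' i)) ->
  same (dup d) (dup d') <-> signature d = signature d'.
Proof.
move=> Sd Sd'; have [sd ad] := dg_forms Sd; have [sd' ad'] := dg_forms Sd'.
split=> [/same_bsim -/(_ sd ad sd' ad')|/signature_eq[N o]].
  move=> /(bsim_gsim sqt hsqrtu hE hconj)/(gsim_types sqt hsqrtu hE hconj Sd Sd').
  by move=> /signature_eq.
by apply/same_bsim => //; apply: (bsim_types sqt hsqrtu hE hconj).
Qed.

Lemma signature_same0 d d' : (forall i, Sp (d i)) -> (forall i, Sp (d' i)) ->
  signature d = signature d' -> same0 (dup d) (dup d').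
Proof.
move=> Sd Sd' /signature_eq[N o]; have [sd ad] := dg_forms Sd.
apply/(G0_orbit sqt hsqrtu hE hconj) => //.
exact: (bsim_types sqt hsqrtu hE hconj).
Qed.

Definition has_signature X s :=
  exists d, [/\ forall i, Sp (d i), same X (dup d) & signature d = s].

Lemma has_signature_dup d : (forall i, Sp (d i)) -> has_signature (dup d) (signature d).
Proof. by move=> Sd; exists d; split=> //; apply/same_refl/dup_Vplus. Qed.

Lemma Vplus_signature X : X \in Vp -> exists s, has_signature X s.
Proof.
move=> /VE[b [hb bb ->]]; have [d Sd bd] := bsim_diag sqt hsqrtu hE hconj hb bb.
exists (signature d), d; split=> //; apply/same_bsim => //; by have [] := dg_forms Sd.
Qed.

Lemma same_has_signature X Y s t : X \in Vp -> Y \in Vp ->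
  has_signature X s -> has_signature Y t -> same X Y <-> s = t.
Proof.
move=> hX hY [d [Sd Xd <-]] [d' [Sd' Yd' <-]].
have V := dup_Vplus Sd; have V' := dup_Vplus Sd'; split=> [h|/same_signature h].
  apply/same_signature => //; apply: same_trans (same_sym hX Xd) _ => //.
  exact: same_trans h Yd'.
by apply: same_trans Xd (same_trans V (h Sd Sd') (same_sym hY Yd')).
Qed.

Lemma ntype_rev (d : 'I_k.+1 -> R) t : ntype (fun i => d (rev_ord i)) t = ntype d t.
Proof. by rewrite /ntype [RHS](reindex_inj rev_ord_inj). Qed.

Lemma sum_dup I (r : seq I) (D : I -> 'I_k.+1 -> R) :
  \sum_(j <- r) (dup (D j) : mx) = dup (fun i => \sum_(j <- r) D j i).
Proof.
elim: r => [|j r IH].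
  rewrite big_nil; apply/esym; rewrite (_ : dg _ = 0) ?flat0 ?block_mx0 //.
    by rewrite /up block_mx0.
  by apply/matrixP => a b; rewrite dgE mxE big_nil if_same.
rewrite big_cons IH /up.
transitivity (block_mx 0 (flat (dg (D j))) 0 0
  + block_mx 0 (flat (dg (fun i => \sum_(j <- r) D j i))) 0 0 : 'M[E]_(n + n)); first by [].
rewrite add_block_mx !addr0; congr block_mx.
have -> : dg (fun i => \sum_(t <- j :: r) D t i) = dg (D j) + dg (fun i => \sum_(j <- r) D j i).
  by apply/matrixP => a b; rewrite [RHS]mxE !dgE big_cons; case: eqP; rewrite ?addr0.
by apply/matrixP => a b; rewrite !mxE.
Qed.

Lemma emb_dup (j : 'I_k.+1) (M : R) :
  (emb j M : mx) = dup (fun i => if i == rev_ord j then M else 0).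
Proof using Type. by rewrite /emb /up flat_dg. Qed.

Lemma emb0 (j : 'I_k.+1) : emb j 0 = 0 :> mx.
Proof using Type.
rewrite emb_dup (_ : dg _ = 0); last by apply/matrixP => a b; rewrite dgE mxE !if_same.
by rewrite flat0 /up block_mx0.
Qed.

Lemma sum_emb (M : 'I_k.+1 -> R) :
  \sum_j (emb j (M j) : mx) = dup (fun i => M (rev_ord i)).
Proof.
rewrite (eq_bigr (fun j => dup (fun i => if i == rev_ord j then M j else 0) : mx)).
  rewrite sum_dup; congr (up (flat _)); apply/matrixP => a b; rewrite !dgE.
  case: eqP => // _; rewrite (bigD1 (rev_ord a)) //= rev_ordK eqxx big1 ?addr0 // => j ja.
  case: eqP => // aj; by rewrite aj rev_ordK eqxx in ja.
by move=> j _; rewrite emb_dup.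
Qed.

Lemma glambda_emb (X : 'I_k.+1 -> mx) : (forall j, glambda pi conj j (X j) /\ X j != 0) ->
  exists M : 'I_k.+1 -> R, [/\ forall j, Sp (M j), forall j, M j != 0 & forall j, X j = emb j (M
    j)].
Proof.
move=> hX; have H j : exists M, Sp M /\ X j = emb j M.
  by have [[M SM <-] _] := hX j; exists M.
have [M ME] := choice H; exists M; split=> j; try by case: (ME j).
have [_] := hX j; apply: contraNneq => M0; have [_ ->] := ME j.
by rewrite M0 emb0.
Qed.

Lemma nl_ntype (M : 'I_k.+1 -> R) l (X : 'I_k.+1 -> mx) : (forall j, X j = emb j (M j)) ->
  nl 0 (sq_rep pi u l) X = ntype M (Some l).
Proof.
move=> XE; rewrite /nl /ntype -sum1_card big_mkcond; apply: eq_bigr => j _ /=.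
rewrite inE /= XE /delta embK.
have -> : `[< square_class (- \det (M j)) (sq_rep pi u l) >] = (cl (M j) == Some l).
  apply/asboolP/eqP => [|/(cl_class sqt hsqrtu hE hconj)//].
  exact: (cl_Some sqt hsqrtu hE hconj).
by case: eqP.
Qed.

Lemma diagonal_orbits (X X' : 'I_k.+1 -> mx) :
  (forall j, glambda pi conj j (X j) /\ X j != 0) ->
  (forall j, glambda pi conj j (X' j) /\ X' j != 0) ->
  [<-> same (\sum_j X j) (\sum_j X' j);
       forall l : 'I_3, nl 0 (sq_rep pi u l) X = nl 0 (sq_rep pi u l) X' %[mod 2];
       same0 (\sum_j X j) (\sum_j X' j)].
Proof.
move=> /glambda_emb[M [SM M0 XE]] /glambda_emb[M' [SM' M0' XE']].
have XS : \sum_j X j = dup (fun i => M (rev_ord i)).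
  by rewrite -sum_emb; apply: eq_bigr => j _.
have XS' : \sum_j X' j = dup (fun i => M' (rev_ord i)).
  by rewrite -sum_emb; apply: eq_bigr => j _.
rewrite XS XS'.
have NN (L : 'I_k.+1 -> R) : (forall j, Sp (L j)) -> (forall j, L j != 0) -> ntype L None = 0%N.
  move=> SL L0; rewrite /ntype big1 // => j _.
  by rewrite (cl_None sqt hsqrtu hE hconj) // (negPf (L0 j)).
have sigE : signature (fun i => M (rev_ord i)) = signature (fun i => M' (rev_ord i))
    <-> forall l : 'I_3, nl 0 (sq_rep pi u l) X = nl 0 (sq_rep pi u l) X' %[mod 2].
  split=> [/signature_eq[_ o] l|h]; last first.
    apply/signature_eq; rewrite !ntype_rev !NN //; split=> // l _.
    by have := h l; rewrite !ntype_rev !modn2 (nl_ntype l XE) (nl_ntype l XE'); do 2!case: odd.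
  rewrite !modn2 (nl_ntype l XE) (nl_ntype l XE'); congr nat_of_bool.
  have o' t : t != 0 -> odd (ntype M (Some t)) = odd (ntype M' (Some t)).
    by move=> t0; have := o t t0; rewrite !ntype_rev.
  have [->|/o'//] := eqVneq l 0.
  have := ntype_sum sqt hsqrtu hE hconj M; have := ntype_sum sqt hsqrtu hE hconj M'.
  rewrite !NN // !add0n => e1 e2; have := congr1 odd (etrans e2 (esym e1)).
  rewrite !oddD (o' 1) // (o' 2%:R) //.
  by do 4!case: odd.
tfae.
- by move=> /same_signature h; apply/sigE/h.
- by move=> /sigE h; apply: signature_same0.
- exact: same0_same.
Qed.

End Classification.

(** * Representatives of the orbits *)

Lemma sum_nth_count (T : eqType) (x0 t : T) (s : seq T) :
  (\sum_(j < size s) (nth x0 s j == t) = count_mem t s)%N.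
Proof.
rewrite -sum1_count [RHS]big_mkcond (big_nth x0) big_mkord.
by apply: eq_bigr => i _ /=; case: eqP.
Qed.

Section OrbitRepresentatives.
Variables (F : fieldType) (pi u : F).
Hypothesis sqt : square_theory pi u.
Variables (E : fieldExtType F) (sqrtu : E).
Hypotheses (hsqrtu : sqrtu ^+ 2 = u%:A) (hE : <<1%AS; sqrtu>>%VS = {:E}%VS).
Variable conj : {lrmorphism E -> E}.
Hypothesis hconj : conj sqrtu = - sqrtu.
Variables (K : closedFieldType) (iota : {rmorphism F -> K}).
Hypothesis natr0 : forall m, (0 < m)%N -> m%:R != 0 :> F.
Variable k : nat.

Local Notation R := ('M[E]_2).
Local Notation n := (\sum_(i < k.+1) 2)%N.
Local Notation mx := (rmx E (n + n)).
Local Notation Sp := (Splus pi conj).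
Local Notation cl := (cl pi u).
Local Notation Vp := (Vplus pi conj k).
Local Notation same := (same_orbit (G pi conj k iota)).
Local Notation has_signature := (@has_signature F pi u E conj K iota k).
Local Notation dup d := (up (F := F) (k := k) (flat (dg d))).

Variable X0 : 'I_3 -> mx.
Hypothesis hX0 : forall l, glambda pi conj (ord0 : 'I_k.+1) (X0 l) /\
  square_class (delta (ord0 : 'I_k.+1) (X0 l)) (sq_rep pi u l).

Let M l : R := coef ord0 (X0 l).

Let X0E l : [/\ Sp (M l), X0 l = emb ord0 (M l) & cl (M l) = Some l].
Proof.
have [[N SN NE] dX] := hX0 l; have ME : M l = N by rewrite /M -NE embK.
rewrite ME; split=> //; move: dX; rewrite /delta -/(M l) ME.
exact: (cl_Some sqt hsqrtu hE hconj).
Qed.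

Let block (t : option 'I_3) : R := if t is Some l then M l else 0.

Let block_Sp t : Sp (block t).
Proof.
case: t => [l|] /=; first by case: (X0E l).
by split; [rewrite trmx0 | exact: (skew0 sqt hsqrtu hE hconj)].
Qed.

Let block_cl t : cl (block t) = t.
Proof.
case: t => [l|] /=; first by case: (X0E l).
by apply/eqP; rewrite (cl_None sqt hsqrtu hE hconj) //; apply: (block_Sp None).
Qed.

Let of_types (s : seq (option 'I_3)) : mx := \sum_(j < k.+1) emb j (block (nth None s j)).

Definition type_signature (s : seq (option 'I_3)) : nat * bool * bool :=
  (count_mem None s, odd (count_mem (Some 1%R) s), odd (count_mem (Some 2%:R) s)).

Let of_types_signature s : size s = k.+1 -> has_signature (of_types s) (type_signature s).
Proof.
move=> sz; rewrite /of_types (sum_emb sqt hsqrtu hE hconj iota natr0 (fun j => block (nth None s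
  j))).
have -> : type_signature s = signature pi u (fun i : 'I_k.+1 => block (nth None s (rev_ord i))).
  rewrite /signature !(ntype_rev sqt hsqrtu hE hconj iota natr0 (fun i => block (nth None s i))).
  have c t : ntype pi u (fun i : 'I_k.+1 => block (nth None s i)) t = count_mem t s.
    by rewrite -(sum_nth_count None) sz; apply: eq_bigr => i _; rewrite block_cl.
  by rewrite !c.
by apply: (has_signature_dup sqt hsqrtu hE hconj) => // i; apply: block_Sp.
Qed.

Let gammaE (j : 'I_k.+1) l : gamma0 j (X0 l) = emb j (M l).
Proof. by []. Qed.

Let l1E : inord 0 = 0 :> 'I_3. Proof. by apply: val_inj; rewrite /= inordK. Qed.
Let l2E : inord 1 = 1 :> 'I_3. Proof. by apply: val_inj; rewrite /= inordK. Qed.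
Let l3E : inord 2 = 2%:R :> 'I_3. Proof. by apply: val_inj; rewrite /= inordK. Qed.

Let rank1_types l : X0 l = of_types (Some l :: nseq k None).
Proof.
rewrite /of_types [RHS]big_ord_recl /= [X in _ = _ + X]big1 => [|i _]; first by rewrite addr0;
  case: (X0E l).
by rewrite nth_nseq if_same emb0.
Qed.

Let rep_sum_types m l : (m < k)%N ->
  rep_sum X0 m l = of_types (nseq m None ++ nseq (k - m) (Some 0) ++ [:: Some l]).
Proof.
move=> mk; rewrite /of_types /rep_sum l1E [RHS](bigD1 ord_max) //= addrC; congr (_ + _); last first.
  by rewrite gammaE !nth_cat !size_nseq ltnNge (ltnW mk) /= ltnn subnn.
rewrite [LHS]big_mkcond [RHS]big_mkcond; apply: eq_bigr => j _.
rewrite -val_eqE /= gammaE; have := ltn_ord j; rewrite ltnS leq_eqVlt.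
case: (eqVneq (j : nat) k) => [->|jk] /=; first by rewrite ltnn andbF.
move=> jk'; rewrite jk' andbT !nth_cat !nth_nseq !size_nseq.
case: (leqP m j) => mj; last by rewrite emb0.
by rewrite (ltn_sub2r mk jk').
Qed.

Let rep_sum'_types m : (m < k)%N ->
  rep_sum' X0 m = of_types (nseq m None ++ nseq (k.-1 - m) (Some 0) ++ [:: Some 1; Some 2%:R]).
Proof.
move=> mk; have k0 : (0 < k)%N by lia.
have kE : (inord k.-1 : 'I_k.+1) = k.-1 :> nat by rewrite inordK //; lia.
have km : (inord k.-1 : 'I_k.+1) != ord_max by rewrite -val_eqE /= kE; apply/eqP; lia.
rewrite /of_types /rep_sum' l1E l2E l3E [RHS](bigD1 ord_max) //= [X in _ = _ + X](bigD1 (inord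
  k.-1)) //=.
rewrite [RHS]addrA [RHS]addrC [RHS]addrA addrAC; congr (_ + _ + _).
- rewrite [LHS]big_mkcond [RHS]big_mkcond; apply: eq_bigr => j _.
  rewrite -!val_eqE /= kE gammaE; have := ltn_ord j; rewrite ltnS => jk.
  case: ifP => [/andP[mj jk1]|H].
    have -> /= : (j != k :> nat) && (j != k.-1 :> nat) by apply/andP; split; apply/eqP; lia.
    rewrite !nth_cat !nth_nseq !size_nseq ltnNge mj /=.
    by have -> : (j - m < k.-1 - m)%N by lia.
  case: ifP => // /andP[/eqP j1 /eqP j2].
  have jm : (j < m)%N by move/negbT: H; rewrite negb_and -ltnNge -leqNgt => /orP[//|]; lia.
  by rewrite nth_cat size_nseq jm nth_nseq jm emb0.
- rewrite gammaE kE !nth_cat !size_nseq (_ : (k.-1 < m)%N = false); last by apply/negbTE; lia.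
  by rewrite ltnn subnn.
rewrite gammaE !nth_cat !size_nseq (_ : (k < m)%N = false); last by apply/negbTE; lia.
rewrite (_ : (k - m < k.-1 - m)%N = false); last by apply/negbTE; lia.
by have -> : (k - m - (k.-1 - m) = 1)%N by lia.
Qed.

Let lab (a b : bool) : 'I_3 := if a then 1 else if b then 2%:R else 0.

(** The listed element with signature s. Two odd parities need two nonzero blocks, which is the
    purpose of [rep_sum']. *)
Definition rep_of (s : nat * bool * bool) : mx :=
  let: (m, a, b) := s in
  if m == k then X0 (lab a b) else if a && b then rep_sum' X0 m else rep_sum X0 m (lab a b).

Let parities : seq (bool * bool) :=
  [:: (false, false); (true, false); (false, true); (true, true)].

Definition rank1_signatures : seq (nat * bool * bool) :=
  [:: (k, false, false); (k, true, false); (k, false, true)].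

Definition signatures : seq (nat * bool * bool) :=
  rank1_signatures ++ [seq (m, ab.1, ab.2) | m <- seq.iota 0 k, ab <- parities].

Definition open_signatures : seq (nat * bool * bool) :=
  if k == 0%N then rank1_signatures else [seq (0%N, ab.1, ab.2) | ab <- parities].

Let reps_from_map m : (m < k)%N -> reps_from X0 m = [seq rep_of (m, ab.1, ab.2) | ab <- parities].
Proof. by move=> mk; rewrite /= (ltn_eqF mk) /= /reps_from l1E l2E l3E. Qed.

Let rank1_map : reps_rank1 X0 = map rep_of rank1_signatures.
Proof. by rewrite /= eqxx /reps_rank1 l1E l2E l3E. Qed.

Lemma reps_map : reps X0 = map rep_of signatures.
Proof.
rewrite /reps rank1_map map_cat; congr (_ ++ _); rewrite map_flatten -map_comp.
congr flatten; apply/eq_in_map => m; rewrite mem_iota add0n => /andP[_ mk] /=.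
by rewrite reps_from_map.
Qed.

Lemma open_reps_map : open_reps X0 = map rep_of open_signatures.
Proof.
rewrite /open_reps /open_signatures; case: ifP => k0; first exact: rank1_map.
by rewrite reps_from_map ?lt0n ?k0 // -map_comp.
Qed.

(** With k zero blocks a single block remains, so the two parities cannot both be odd; with fewer
    zero blocks there is no restriction. *)
Lemma mem_signatures m a b :
  ((m, a, b) \in signatures) = (m < k)%N || (m == k) && ~~ (a && b).
Proof.
rewrite mem_cat orbC; congr (_ || _); last by rewrite !inE !xpair_eqE; case: a b => [] [];
  rewrite ?andbF ?andbT ?orbF.
apply/allpairsP/idP => [[[m' [a' b']]] /= [+ _ [-> _ _]]|mk].
  by rewrite mem_iota add0n => /andP[].
by exists (m, (a, b)); split; rewrite ?mem_iota //; case: a b => [] [].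
Qed.

Lemma mem_open_signatures m a b :
  ((m, a, b) \in open_signatures) = ((m, a, b) \in signatures) && (m == 0%N).
Proof.
rewrite mem_signatures /open_signatures; case: ifP => [/eqP k0|k0].
  rewrite k0 ltn0 /rank1_signatures !inE !xpair_eqE k0.
  by case: eqP => //= _; case: a b => [] [].
case: (eqVneq m 0%N) => [->|m0]; rewrite ?andbF ?andbT.
  by rewrite lt0n k0 /=; case: a b => [] [].
by apply/negbTE/mapP => -[ab _ [mE _ _]]; rewrite mE eqxx in m0.
Qed.

Lemma rep_of_signature s : s \in signatures -> has_signature (rep_of s) s.
Proof.
case: s => [[m a] b]; rewrite mem_signatures => /orP[mk|/andP[/eqP -> ab]].
  have ek : (Some (0 : 'I_3) == Some 1) = false by [].
  rewrite /rep_of (ltn_eqF mk); case: ifP => [/andP[-> ->]|ab].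
    rewrite rep_sum'_types //; set s := (_ ++ _).
    have -> : (m, true, true) = type_signature s.
      by rewrite /type_signature /s !count_cat !count_nseq /= ?mul0n ?addn0 ?add0n ?mul1n.
    by apply: of_types_signature; rewrite /s !size_cat !size_nseq /=; lia.
  rewrite rep_sum_types //; set s := (_ ++ _).
  have -> : (m, a, b) = type_signature s.
    rewrite /type_signature /s !count_cat !count_nseq /= ?mul0n ?addn0 ?add0n ?mul1n.
    by move: ab; rewrite /lab; clear s; case: a b => [] [].
  by apply: of_types_signature; rewrite /s !size_cat !size_nseq /=; lia.
rewrite /rep_of eqxx rank1_types; set s := (_ :: _).
have -> : (k, a, b) = type_signature s.
  rewrite /type_signature /s /= !count_nseq /= !mul0n !addn0 mul1n.
  by move: ab; rewrite /lab; clear s; case: a b => [] [].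
by apply: of_types_signature; rewrite /s /= size_nseq.
Qed.

Let hsigs := @same_has_signature F pi u sqt E sqrtu hsqrtu hE conj hconj K iota natr0 k.

Lemma zero_signature : has_signature 0 (k.+1, false, false).
Proof.
have SZ (i : 'I_k.+1) : Sp (0 : R).
  by split; [rewrite trmx0 | exact: (skew0 sqt hsqrtu hE hconj)].
have := has_signature_dup sqt hsqrtu hE hconj iota natr0 SZ.
rewrite (_ : dup (fun=> 0) = 0 :> mx); last first.
  rewrite (_ : dg _ = 0) ?flat0 /up ?block_mx0 //.
  by apply/matrixP => a b; rewrite dgE mxE !if_same.
congr has_signature; rewrite /signature /ntype.
have c0 : cl (0 : R) = None by apply/eqP; rewrite (cl_None sqt hsqrtu hE hconj) ?eqxx //;
  apply: (SZ ord0).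
have e0 : (\sum_(i < k.+1) (cl (0 : R) == None) = k.+1)%N.
  by rewrite c0 sum_nat_const card_ord muln1.
by rewrite e0 c0 !big1.
Qed.

Lemma nonzero_signature X s : X \in Vp -> X != 0 -> has_signature X s -> s \in signatures.
Proof.
move=> hX nX [d [Sd Xd <-]]; rewrite /signature mem_signatures.
have := ntype_sum sqt hsqrtu hE hconj d.
have N0 : ntype pi u d None != k.+1.
  apply: contraNneq nX => N.
  have z := ntype_sum sqt hsqrtu hE hconj d.
  have sz : signature pi u d = (k.+1, false, false).
    have -> : signature pi u d = (ntype pi u d None, odd (ntype pi u d (Some 1%R)),
      odd (ntype pi u d (Some 2%:R))) by [].
    by rewrite N;
      have [-> ->] : ntype pi u d (Some 1%R) = 0%N /\ ntype pi u d (Some 2%:R) = 0%N by lia.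
  have h : has_signature X (k.+1, false, false) by rewrite -sz; exists d.
  (* X would lie in the orbit of 0, which is {0} because elements of G are linear. *)
  have [_ /(_ erefl)] := hsigs hX (mem0v _) h zero_signature.
  move=> /(same_sym sqt hsqrtu hE hconj natr0 hX)[f _ <-].
  by rewrite linear0.
move: N0; set N := ntype _ _ _ None; set a := ntype _ _ _ (Some 1%R).
set b := ntype _ _ _ (Some 2%:R) => N0 sum.
case: ltnP => //= kN; apply/andP; split; first by apply/eqP; lia.
by apply/negP => /andP[/odd_gt0 a0 /odd_gt0 b0]; lia.
Qed.

Lemma rep_of_Vplus s : s \in signatures -> rep_of s \in Vp.
Proof.
have emb_V (j : 'I_k.+1) l : emb j (M l) \in Vp.
  rewrite emb_dup //; apply: (dup_Vplus sqt hsqrtu hE hconj iota natr0) => i.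
  by case: ifP => _; [case: (X0E l) | exact: (block_Sp None)].
case: s => [[m a] b] _; rewrite /rep_of; case: ifP => _; first by case: (X0E (lab a b)) => _ -> _.
case: ifP => _; last by rewrite memvD ?memv_suml // => *; apply: emb_V.
by rewrite !memvD ?memv_suml // => *; apply: emb_V.
Qed.

Lemma signatures_uniq : uniq signatures.
Proof.
rewrite cat_uniq allpairs_uniq ?iota_uniq // => [|[m [a b]] [m' [a' b']] _ _ [-> -> ->] //].
rewrite andbT /rank1_signatures; apply/andP; split.
  by rewrite /= !inE !xpair_eqE !eqxx.
apply/hasPn => s /allpairsP[[m ab] /= [+ _ ->]]; rewrite mem_iota add0n => /andP[_ mk].
by rewrite !inE !xpair_eqE (ltn_eqF mk).
Qed.

Lemma reps_nonzero_orbit_reps : nonzero_orbit_reps (G pi conj k iota) Vp (reps X0).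
Proof.
rewrite reps_map; split=> [X /mapP[s hs ->]|i j|X hX nX].
- have V := rep_of_Vplus hs; split=> //; apply: contraTneq (hs) => r0.
  have := rep_of_signature hs; rewrite r0 => h0.
  have [/(_ (same_refl sqt hsqrtu hE hconj iota natr0 (mem0v _)))] :=
    hsigs (mem0v _) (mem0v _) h0 zero_signature.
  by move=> -> _; rewrite mem_signatures ltnNge leqnSn /= gtn_eqF.
- rewrite size_map => hi hj; rewrite !(nth_map (0%N, false, false)) // => h.
  have si := mem_nth (0%N, false, false) hi; have sj := mem_nth (0%N, false, false) hj.
  have [/(_ h)/eqP + _] := hsigs (rep_of_Vplus si) (rep_of_Vplus sj)
    (rep_of_signature si) (rep_of_signature sj).
  by rewrite nth_uniq ?signatures_uniq // => /eqP.
have [s hs] := Vplus_signature sqt hsqrtu hE hconj iota natr0 hX.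
have ss := nonzero_signature hX nX hs; exists (rep_of s); first exact: map_f.
by apply/(hsigs (rep_of_Vplus ss) hX (rep_of_signature ss) hs).
Qed.

Lemma open_reps_signature X s : X \in Vp -> has_signature X s ->
  (exists2 Y, Y \in open_reps X0 & same Y X) <-> s.1.1 = 0%N.
Proof.
move=> hX hs; rewrite open_reps_map; split=> [[_ /mapP[[[m a] b] ht ->]] h|s0].
  move: ht; rewrite mem_open_signatures => /andP[ht /eqP m0].
  by have [/(_ h) <- _] := hsigs (rep_of_Vplus ht) hX (rep_of_signature ht) hs.
have ss : s \in signatures.
  apply: (nonzero_signature hX _ hs); apply/eqP => X00; rewrite X00 in hs.
  have [/(_ (same_refl sqt hsqrtu hE hconj iota natr0 (mem0v _))) sE _] :=
    hsigs (mem0v _) (mem0v _) hs zero_signature.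
  by rewrite sE in s0.
exists (rep_of s); last exact/(hsigs (rep_of_Vplus ss) hX (rep_of_signature ss) hs).
apply: map_f; move: ss s0; case: s {hs} => [[m a] b] ss /= m0.
by rewrite mem_open_signatures ss m0.
Qed.

End OrbitRepresentatives.
(** * Open orbits *)

Section Topology.
Variables (p : nat) (Qp : fieldType) (abs : Qp -> rat).
Hypotheses (hp : prime p) (hQp : is_Qp p abs).
Variables (F : fieldExtType Qp) (pi : F).
Hypothesis hpi : uniformizer abs pi.
Local Notation O := (@integer Qp abs F).
Hypothesis unit2 : @integer_unit Qp abs F 2.
Variable u : F.
Hypotheses (hu : integer_unit abs u) (hu2 : forall x, x ^+ 2 != u).
Variables (E : fieldExtType F) (sqrtu : E).
Hypotheses (hsqrtu : sqrtu ^+ 2 = u%:A) (hE : <<1%AS; sqrtu>>%VS = {:E}%VS).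
Variable conj : {lrmorphism E -> E}.
Hypothesis hconj : conj sqrtu = - sqrtu.
Variables (K : closedFieldType) (iota : {rmorphism F -> K}).
Variable k : nat.

Local Notation R := ('M[E]_2).
Local Notation n := (\sum_(i < k.+1) 2)%N.
Local Notation mx := (rmx E (n + n)).
Local Notation J := (Jmx E pi k).
Local Notation Sp := (Splus pi conj).
Local Notation bsim := (bsim pi conj).
Local Notation ntype := (ntype pi u).
Local Notation Vp := (Vplus pi conj k).
Local Notation same := (same_orbit (G pi conj k iota)).
Local Notation has_signature := (@has_signature F pi u E conj K iota k).
Local Notation dup d := (up (F := F) (k := k) (flat (dg d))).

Let sqt : square_theory pi u := local_square_theory hp hQp hpi unit2 hu hu2.
Let natr0 := @char0_natr_neq0 p Qp abs hp hQp F pi hpi.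
Let pi0 : pi != 0 := sqt_pi0 sqt.
Let Oadd := @integer_add p Qp abs hp hQp F.
Let Omul := @integer_mul p Qp abs hp hQp F.
Let Oopp := @integer_opp p Qp abs hp hQp F.
Let O0 := integer0 hp hQp F.
Let O1 := integer1 hp hQp F.
Let OpiX m : O (pi ^+ m).
Proof. exact/(integerX hp hQp)/(uniformizer_integer hp hQp hpi). Qed.
Let Ou : O u := unit_integer hu.

Lemma integer_scale_pi (x : F) : exists M, forall m, (M <= m)%N -> O (pi ^+ m * x).
Proof.
have [->|x0] := eqVneq x 0; first by exists 0%N => m _; rewrite mulr0.
have [z [v uv ->]] := uniformizer_decomposition hp hQp hpi x0.
have Ov := unit_integer uv; exists `|z|%N => m zm; rewrite mulrA; apply: Omul => //.
have [q ->] : exists q : nat, pi ^+ m * pi ^ z = pi ^+ q.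
  have [q qE] : exists q : nat, m%:Z + z = q%:Z by exists `|(m%:Z + z)%R|%N; lia.
  by exists q; rewrite -[pi ^+ m]/(pi ^ m%:Z) -expfzDr // qE.
exact: OpiX.
Qed.

(** The order O + O [sqrtu] of E, in which entries and determinants are estimated. *)
Definition quad_integer (x : E) := exists a b : F, [/\ O a, O b & x = a%:A + b%:A * sqrtu].
Local Notation OE := quad_integer.

Lemma OE_add x y : OE x -> OE y -> OE (x + y).
Proof.
move=> [a [b [Oa Ob ->]]] [c [d [Oc Od ->]]]; exists (a + c), (b + d).
by split; [exact: Oadd | exact: Oadd | rewrite !algD; ring].
Qed.

Lemma OE_mul x y : OE x -> OE y -> OE (x * y).
Proof.
move=> [a [b [Oa Ob ->]]] [c [d [Oc Od ->]]]; exists (a * c + u * (b * d)), (a * d + b * c).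
split; [by apply: Oadd; do ?apply: Omul | by apply: Oadd; apply: Omul |].
by rewrite !(algD, algM) -hsqrtu; ring.
Qed.

Lemma OE_alg a : O a -> OE a%:A.
Proof. by exists a, 0; split; rewrite // scale0r mul0r addr0. Qed.

Lemma alg_OE (a : F) : OE a%:A -> O a.
Proof.
move=> [c [d [Oc Od]]]; have -> : a%:A = a%:A + 0%:A * sqrtu by rewrite scale0r mul0r addr0.
by move=> /(quad_coords_inj sqt hsqrtu hE hconj)[->].
Qed.

Lemma OE1 : OE 1. Proof. by rewrite -(scale1r 1); apply: OE_alg. Qed.
Lemma OE0 : OE 0. Proof. by rewrite -(scale0r 1); apply: OE_alg. Qed.
Lemma OE_opp x : OE x -> OE (- x).
Proof.
move=> hx; rewrite -mulN1r; apply: OE_mul hx.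
by rewrite -(scale1r 1) -algN; apply/OE_alg/Oopp.
Qed.

Lemma OE_scale (x : E) : exists M, forall m, (M <= m)%N -> OE ((pi ^+ m)%:A * x).
Proof.
have [a [b ->]] := quad_coords sqt hsqrtu hE hconj x.
have [M hM] := integer_scale_pi a; have [N hN] := integer_scale_pi b.
exists (maxn M N) => m; rewrite geq_max => /andP[Mm Nm].
exists (pi ^+ m * a), (pi ^+ m * b); split; [exact: hM | exact: hN |].
by rewrite !algM; ring.
Qed.

Lemma scale_family (I : finType) (V : Type) (f : I -> V) (P : nat -> V -> Prop) :
  (forall x, exists M, forall m, (M <= m)%N -> P m x) ->
  exists M, forall i m, (M <= m)%N -> P m (f i).
Proof.
move=> H; have [M hM] := choice (fun i => H (f i)).
exists (\max_i M i) => i m Mm; apply: hM; apply: leq_trans Mm.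
exact: (leq_bigmax i).
Qed.

(** By the Leibniz formula the determinant is a polynomial in the entries with integral
    coefficients, so congruences modulo t pass to it. *)
Lemma det_close m (t : E) (A A' : 'M[E]_m) : OE t -> (forall i j, OE (A i j)) ->
  (forall i j, exists2 z, OE z & A' i j = A i j + t * z) ->
  exists2 z, OE z & \det A' = \det A + t * z.
Proof.
move=> Ot OA AA'; pose close x y := OE x /\ exists2 z, OE z & y = x + t * z.
suff : close (\det A) (\det A') by case.
have closeM x x' y y' : close x x' -> close y y' -> close (x * y) (x' * y').
  move=> [Ox [z Oz ->]] [Oy [z' Oz' ->]]; split; first exact: OE_mul.
  exists (x * z' + z * y + t * (z * z')); last by ring.
  by do !apply: OE_add; do ?apply: OE_mul => //; apply: OE_mul.
have close_refl x : OE x -> close x x.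
  by move=> Ox; split=> //; exists 0; [exact: OE0 | rewrite mulr0 addr0].
apply: (big_rec2 close) => [|s x y _ [Ox [z Oz ->]]]; first exact/close_refl/OE0.
have [Oy [z' Oz' yE]] : close ((-1) ^+ s * \prod_i A i (s i)) ((-1) ^+ s * \prod_i A' i (s i)).
  apply: (closeM).
    apply: close_refl; case: (s : bool); rewrite ?expr1 ?expr0; last exact: OE1.
    exact/OE_opp/OE1.
  apply: (big_rec2 close) => [|i x' y' _ h]; first exact/close_refl/OE1.
  by apply: (closeM _ _ _ _ _ h); split.
split; first exact: OE_add.
by exists (z' + z); [exact: OE_add | rewrite yE mulrDr addrACA].
Qed.

Lemma det_skew_flat (B : 'M[E]_n) : J *m map_mx conj B = B *m J^T -> exists a, \det B = a%:A.
Proof.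
move=> /(congr1 determinant); rewrite !det_mulmx det_map_mx det_tr mulrC => dE.
apply: (conj_fixed sqt hsqrtu hE hconj); apply: mulIf dE.
have := congr1 determinant (Jmx_sqr sqt hsqrtu hE hconj k).
rewrite det_mulmx det_scalar => h; apply/eqP => dJ; move/eqP: h.
by rewrite dJ mul0r eq_sym expf_eq0 alg_eq0 (negPf pi0) andbF.
Qed.

Lemma bsim_det (b b' : 'M[R]_k.+1) : bsim b b' ->
  exists2 a, a != 0 & \det (flat b') = (a ^+ 2)%:A * \det (flat b).
Proof.
move=> [g [h [qg qh gh hg <-]]].
have [a aE] := det_quat_flat sqt hsqrtu hE hconj (iffRL (quat_flat sqt hsqrtu hE hconj g) qg).
have [ug _] : flat g \in unitmx /\ flat h \in unitmx.
  by apply: mulmx1_unit; rewrite -flatM gh flat1.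
exists a; last by rewrite !flatM flat_adj !det_mulmx det_tr aE algX; ring.
by move: ug; rewrite unitmxE aE unitfE alg_eq0.
Qed.

Lemma det_flat_dg (d : 'I_k.+1 -> R) : \det (flat (dg d)) = \prod_i \det (d i).
Proof. by rewrite flat_dg det_mxdiag. Qed.

Lemma det_flat_dg_neq0 (d : 'I_k.+1 -> R) : (forall i, Sp (d i)) ->
  (\det (flat (dg d)) != 0) = (ntype d None == 0%N).
Proof.
move=> Sd; rewrite det_flat_dg; apply/prodf_neq0/eqP => [h|N i _].
  rewrite /ntype big1 // => i _; rewrite (cl_None sqt hsqrtu hE hconj) //.
  have [d0|] := eqVneq (d i) 0 => //.
  by have := h i isT; rewrite d0 det_mx2 !mxE mul0r subrr eqxx.
have : cl pi u (d i) != None.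
  by move/eqP: N; rewrite /ntype sum_nat_eq0 => /forallP/(_ i)/=; case: (_ == None).
rewrite (cl_None sqt hsqrtu hE hconj) // => di.
have := skew_unit sqt hsqrtu hE hconj (M := d i); rewrite unitmxE unitfE; apply=> //.
by case: (Sd i).
Qed.

Let VE := VplusE sqt hsqrtu hE hconj.

Lemma Vplus_block X : X \in Vp -> exists b d, [/\ X = up (flat b), bsim b (dg d),
  forall i, Sp (d i), same X (dup d) & J *m map_mx conj (flat b) = flat b *m J^T].
Proof.
move=> /VE[b [hb bb ->]]; have [d Sd bd] := bsim_diag sqt hsqrtu hE hconj hb bb.
exists b, d; split=> //; last exact/(skew_flat sqt hsqrtu hE hconj).
by apply/(same_bsim sqt hsqrtu hE hconj iota natr0) => //;
  have [] := dg_forms sqt hsqrtu hE hconj iota natr0 Sd.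
Qed.

Let hsigs := @same_has_signature F pi u sqt E sqrtu hsqrtu hE conj hconj K iota natr0 k.

(** Without zero blocks the signature reduces to the two parities, and the discriminant modulo
    squares determines them. *)
Lemma same_of_det X Y (f : F) : X \in Vp -> Y \in Vp -> \det (ursubmx X) != 0 -> f != 0 ->
  \det (ursubmx Y) = (f ^+ 2)%:A * \det (ursubmx X) -> same X Y.
Proof.
move=> hX hY; have [b [d [XE bd Sd Xd _]]] := Vplus_block hX.
have [b' [d' [YE bd' Sd' Yd' _]]] := Vplus_block hY.
have -> : ursubmx X = flat b by rewrite XE /up block_mxKur.
have -> : ursubmx Y = flat b' by rewrite YE /up block_mxKur.
move=> b0 f0 dE.
have [a a0 aE] := bsim_det bd; have [a' a0' aE'] := bsim_det bd'.
have nd : \det (flat (dg d)) != 0 by rewrite aE mulf_neq0 // alg_eq0 expf_neq0.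
have nd' : \det (flat (dg d')) != 0.
  by rewrite aE' dE !mulf_neq0 // alg_eq0 expf_neq0.
have nz (c : 'I_k.+1 -> R) i : \det (flat (dg c)) != 0 -> (c i == 0) = false.
  rewrite det_flat_dg => /prodf_neq0/(_ i isT); apply: contraNF => /eqP ->.
  by rewrite det_mx2 !mxE mul0r subrr.
apply/(hsigs hX hY (ex_intro _ d (And3 Sd Xd erefl)) (ex_intro _ d' (And3 Sd' Yd' erefl))).
apply/signature_eq; rewrite (det_flat_dg_neq0 Sd) in nd; rewrite (det_flat_dg_neq0 Sd') in nd'.
split; first by rewrite (eqP nd) (eqP nd').
rewrite -(det_flat_dg_neq0 Sd) in nd; rewrite -(det_flat_dg_neq0 Sd') in nd'.
apply: (det_types (f := a' * f / a) sqt hsqrtu hE hconj Sd Sd') => [i|].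
  by rewrite !nz.
rewrite (eq_bigr (fun i => \det (d' i))) => [|i _]; last by rewrite nz.
rewrite [in RHS](eq_bigr (fun i => \det (d i))) => [|i _]; last by rewrite nz.
rewrite -!det_flat_dg aE aE' dE !mulrA -!algM; congr (_ %:A * _).
by field.
Qed.

(* For Y close to Z one has det Y = det Z (1 + pi y) with y integral, and 1 + pi y is a square. *)
Lemma open_orbit X : X \in Vp -> \det (ursubmx X) != 0 ->
  open_in abs pi Vp (orbit_of (G pi conj k iota) X).
Proof.
move=> hX dX; have Vorb Z : same X Z -> Z \in Vp.
  exact: (same_Vplus sqt hsqrtu hE hconj natr0 hX).
split=> [Y /= h|Z XZ]; first exact: Vorb.
have hZ := Vorb _ XZ; have [b [d [ZE bd Sd Zd qb]]] := Vplus_block hZ.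
have dZ : \det (ursubmx Z) != 0.
  have [b1 [d1 [XE bd1 Sd1 Xd1 _]]] := Vplus_block hX.
  have /signature_eq[N _] : signature pi u d1 = signature pi u d.
    by apply/(hsigs hX hZ (ex_intro _ d1 (And3 Sd1 Xd1 erefl))
      (ex_intro _ d (And3 Sd Zd erefl))); exact: XZ.
  have [a a0 aE] := bsim_det bd; have [a1 a10 aE1] := bsim_det bd1.
  have : \det (flat (dg d)) != 0.
    rewrite det_flat_dg_neq0 // -N -det_flat_dg_neq0 // aE1 mulf_neq0 //.
      by rewrite alg_eq0 expf_neq0.
    by move: dX; rewrite XE /up block_mxKur.
  by rewrite aE mulf_eq0 negb_or ZE /up block_mxKur => /andP[].
pose v i : mx := (vbasis Vp)`_i.
have [M0 hM0] := scale_family (fun t : 'I_(\dim Vp) * ('I_n * 'I_n) =>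
  ursubmx (v t.1) t.2.1 t.2.2) OE_scale.
have [M1 hM1] := scale_family (fun t : 'I_n * 'I_n => ursubmx Z t.1 t.2) OE_scale.
have [M2 hM2] := OE_scale (\det (ursubmx Z))^-1.
(* M0 clears the denominators of the basis of V^+, M1 those of the entries of Z, once for each of
   the n rows of the determinant, and M2 those of 1 / det Z; the last 1 leaves the factor pi in 1 +
   pi y. *)
pose c := (M1 * n + M2 + 1)%N; exists (M0 + c)%N => Y hY YZ.
have [y yE] : exists y : 'I_(\dim Vp) -> F, forall i, O (y i) /\
    coord (vbasis Vp) i (Y - Z) = pi ^+ (M0 + c) * y i.
  have H i : exists y, O y /\ coord (vbasis Vp) i (Y - Z) = pi ^+ (M0 + c) * y.
    by have [y Oy yE] := YZ i; exists y.
  by have [y yE] := choice H; exists y.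
have YE i j : exists2 z, OE z & ursubmx Y i j = ursubmx Z i j + (pi ^+ c)%:A * z.
  have : Y = Z + \sum_(t < \dim Vp) (pi ^+ (M0 + c) * y t) *: v t.
    rewrite -[LHS](subrK Z) addrC; congr (_ + _).
    rewrite [LHS](coord_vbasis (memvB hY hZ)); apply: eq_bigr => t _.
    by have [_ ->] := yE t.
  move=> /(congr1 (fun A : 'M[E]_(n + n) => ursubmx A i j)) H.
  exists (\sum_(t < \dim Vp) (y t)%:A * ((pi ^+ M0)%:A * ursubmx (v t) i j)).
    apply: (big_ind OE) => [||t _]; [exact: OE0 | exact: OE_add |].
    apply: OE_mul; first by apply: OE_alg; have [] := yE t.
    exact: (hM0 (t, (i, j))).
  rewrite H !mxE; congr (_ + _).
  rewrite summxE mulr_sumr; apply: eq_bigr => t _.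
  by rewrite rmx_scaleE !mxE !(algM, algX) exprD; ring.
have [z Oz zE] : exists2 z, OE z & \det ((pi ^+ M1)%:A *: ursubmx Y)
    = \det ((pi ^+ M1)%:A *: ursubmx Z) + (pi ^+ c)%:A * z.
  apply: det_close => [|i j|i j]; first exact/OE_alg.
    by rewrite mxE; apply: (hM1 (i, j)).
  have [z Oz zE] := YE i j; exists ((pi ^+ M1)%:A * z).
    by apply: OE_mul => //; apply: OE_alg.
  by rewrite mxE [in RHS]mxE zE; ring.
have P0 : (pi%:A : E) != 0 by rewrite alg_eq0.
have dYE : \det (ursubmx Y) = \det (ursubmx Z) * (1 + pi%:A *
    ((pi ^+ M2)%:A * (\det (ursubmx Z))^-1 * z)).
  have PX : ((pi%:A : E) ^+ M1) ^+ n != 0 by rewrite !expf_neq0.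
  apply: (mulfI PX); move: zE; rewrite !detZ !algX => ->.
  have gen (t D r q w : E) : D != 0 -> t * D + t * r * q * w = t * (D * (1 + q * (r * D^-1 * w))).
    by move=> D0; field.
  by rewrite /c !exprD exprM expr1; apply: gen.
have [b' [d' [YE' _ _ _ qb']]] := Vplus_block hY.
have [eZ eZE] : exists a, \det (ursubmx Z) = a%:A.
  by rewrite ZE /up block_mxKur; apply: det_skew_flat.
have [eY eYE] : exists a, \det (ursubmx Y) = a%:A.
  by rewrite YE' /up block_mxKur; apply: det_skew_flat.
have eZ0 : eZ != 0 by rewrite -(alg_eq0 E) -eZE.
pose r := (eY / eZ - 1) / pi.
have Or : O r.
  apply: alg_OE; have -> : r%:A = (pi ^+ M2)%:A * (\det (ursubmx Z))^-1 * z.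
    apply: (mulfI P0); apply: (addrI 1); apply: (mulfI dZ); rewrite -dYE eYE eZE.
    have -> : eZ%:A * (1 + pi%:A * r%:A) = (eZ * (1 + pi * r))%:A :> E.
      by rewrite !(algM, algD) scale1r.
    congr (_%:A).
    by rewrite /r; field; rewrite pi0.
  by apply: OE_mul => //; apply: hM2.
have [s s0 sE] := one_pi_square hp hQp hpi unit2 hu hu2 Or.
apply: (same_trans sqt hsqrtu hE hconj natr0 hX XZ).
apply: (same_of_det hZ hY dZ s0); rewrite eYE eZE -algM; congr (_%:A).
by rewrite -sE /r; field; rewrite pi0.
Qed.

(* A zero block may be replaced by an arbitrarily small nonzero one. *)
Lemma not_open_orbit X s : X \in Vp -> has_signature X s -> s.1.1 != 0%N ->
  ~ open_in abs pi Vp (orbit_of (G pi conj k iota) X).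
Proof.
move=> hX [d [Sd Xd <-]] /= N0 [_ op].
have [i0 d0] : exists i0, d i0 = 0.
  apply: contrapT => H; case/eqP: N0; rewrite /ntype big1 // => i _.
  rewrite (cl_None sqt hsqrtu hE hconj) //; case: eqP => // di.
  by case: H; exists i.
have [N hN] := op _ Xd.
have [S SS cS] := class_exists sqt hsqrtu hE hconj 0.
have S0 := square_class_neq0 sqt hsqrtu hE hconj cS.
have SpZ (a : F) (T : R) : Sp T -> Sp (a%:A *: T).
  move=> [TT JT]; split; first by rewrite linearZ /= TT.
  by rewrite map_mxZ /= conj_alg -scalemxAr -scalemxAl JT.
pose W : mx := dup (fun i => if i == i0 then S else 0).
have SW i : Sp (if i == i0 then S else 0).
  by case: ifP => // _; split; [rewrite trmx0 | exact: (skew0 sqt hsqrtu hE hconj)].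
have VW : W \in Vp := dup_Vplus sqt hsqrtu hE hconj iota natr0 SW.
have [M hM] := scale_family (fun i : 'I_(\dim Vp) => coord (vbasis Vp) i W) integer_scale_pi.
(* M makes the coordinates of pi^M W integral, so a W lies in the neighbourhood of exponent N. *)
pose a := pi ^+ (N + M); pose d' i : R := if i == i0 then a%:A *: S else d i.
have Sd' i : Sp (d' i) by rewrite /d'; case: ifP => _ //; apply: SpZ.
have Y : (dup d : mx) + a *: W = dup d'.
  transitivity (block_mx 0 (flat (dg d)) 0 0 + a%:A *: block_mx 0
    (flat (dg (fun i => if i == i0 then S else 0))) 0 0 : 'M[E]_(n + n)); first by [].
  rewrite scale_block_mx add_block_mx !scaler0 !addr0; congr block_mx.
  apply/matrixP => x y; rewrite !mxE /d'; case: eqP => _; last by rewrite !mxE mulr0 addr0.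
  by case: eqP => [->|_]; rewrite ?d0 !mxE ?add0r // mulr0 addr0.
have VY : dup d' \in Vp := dup_Vplus sqt hsqrtu hE hconj iota natr0 Sd'.
have Vd : dup d \in Vp := dup_Vplus sqt hsqrtu hE hconj iota natr0 Sd.
have : same X (dup d').
  apply: hN => // i; rewrite -Y addrC addKr linearZ /=.
  by exists (pi ^+ M * coord (vbasis Vp) i W); [exact: hM | rewrite /a exprD mulrA].
move=> XY; have := same_trans sqt hsqrtu hE hconj natr0 Vd
  (same_sym sqt hsqrtu hE hconj natr0 hX Xd) XY.
move=> /(same_signature sqt hsqrtu hE hconj iota natr0 Sd Sd')[+ _ _].
rewrite /ntype (bigD1 i0) //= [in RHS](bigD1 i0) //=.
have -> : (\sum_(i < k.+1 | i != i0) (cl pi u (d' i) == None)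
  = \sum_(i < k.+1 | i != i0) (cl pi u (d i) == None))%N.
  by apply: eq_bigr => i /negPf ii0; rewrite /d' ii0.
rewrite !(cl_None sqt hsqrtu hE hconj) // d0 eqxx /d' eqxx scaler_eq0 (negPf S0).
by rewrite alg_eq0 /a expf_eq0 (negPf pi0) andbF => /addIn.
Qed.

Lemma open_orbit_signature X s : X \in Vp -> has_signature X s ->
  open_in abs pi Vp (orbit_of (G pi conj k iota) X) <-> s.1.1 = 0%N.
Proof.
move=> hX hs; split=> [h|s0].
  by apply/eqP/negPn/negP => s0; apply: not_open_orbit hs s0 h.
have [b [d [XE bd Sd Xd _]]] := Vplus_block hX; apply: open_orbit => //.
have [/(_ (same_refl sqt hsqrtu hE hconj iota natr0 hX)) sE _] :=
  hsigs hX hX hs (ex_intro _ d (And3 Sd Xd erefl)).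
have [a a0 aE] := bsim_det bd; rewrite XE /up block_mxKur.
have : \det (flat (dg d)) != 0 by rewrite det_flat_dg_neq0 //; move: s0; rewrite sE => /= ->.
by rewrite aE mulf_eq0 negb_or => /andP[].
Qed.

End Topology.

(** * Counting the orbits *)

Local Open Scope classical_set_scope.
Local Open Scope ring_scope.

Lemma card_orbit_list (F : fieldType) (V : vectType F) (H : set 'End(V)) (s : seq V) :
  (forall i j, (i < size s)%N -> (j < size s)%N ->
     orbit_of H s`_i = orbit_of H s`_j -> i = j) ->
  ([set orbit_of H Y | Y in [set` s]] #= `I_(size s))%card.
Proof.
move=> inj; have -> : [set orbit_of H Y | Y in [set` s]]
    = (fun i => orbit_of H s`_i) @` `I_(size s).
  apply/seteqP; split=> [_ [Y /= Ys <-]|_ [i /= si <-]].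
    by exists (index Y s); rewrite /= ?index_mem ?nth_index.
  by exists s`_i => //=; apply: mem_nth.
by apply: inj_card_eq => i j /set_mem /= si /set_mem /= sj; apply: inj.
Qed.

Section Counting.
Variables (p : nat) (Qp : fieldType) (abs : Qp -> rat).
Hypotheses (hp : prime p) (hQp : is_Qp p abs).
Variables (F : fieldExtType Qp) (pi : F).
Hypothesis hpi : uniformizer abs pi.
Hypothesis unit2 : @integer_unit Qp abs F 2.
Variable u : F.
Hypotheses (hu : integer_unit abs u) (hu2 : forall x, x ^+ 2 != u).
Variables (E : fieldExtType F) (sqrtu : E).
Hypotheses (hsqrtu : sqrtu ^+ 2 = u%:A) (hE : <<1%AS; sqrtu>>%VS = {:E}%VS).
Variable conj : {lrmorphism E -> E}.
Hypothesis hconj : conj sqrtu = - sqrtu.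
Variables (K : closedFieldType) (iota : {rmorphism F -> K}).
Variable k : nat.

Local Notation n := (\sum_(i < k.+1) 2)%N.
Local Notation mx := (rmx E (n + n)).
Local Notation Vp := (Vplus pi conj k).
Local Notation G := (G pi conj k iota).
Local Notation same := (same_orbit G).

Let sqt : square_theory pi u := local_square_theory hp hQp hpi unit2 hu hu2.
Let natr0 := @char0_natr_neq0 p Qp abs hp hQp F pi hpi.
Let trans := @same_trans F pi u sqt E sqrtu hsqrtu hE conj hconj K iota natr0 k.
Let sym := @same_sym F pi u sqt E sqrtu hsqrtu hE conj hconj K iota natr0 k.
Let refl := @same_refl F pi u sqt E sqrtu hsqrtu hE conj hconj K iota natr0 k.

Lemma orbit_eq X Y : X \in Vp -> Y \in Vp -> orbit_of G X = orbit_of G Y <-> same X Y.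
Proof.
move=> hX hY; split=> [XY|h]; first by rewrite /same_orbit XY; apply: refl.
apply/seteqP; split=> Z /= h'; first exact: (trans hY (sym hX h) h').
exact: (trans hX h h').
Qed.

Lemma base_representatives : exists X0 : 'I_3 -> mx, forall l,
  glambda pi conj (ord0 : 'I_k.+1) (X0 l) /\
  square_class (delta (ord0 : 'I_k.+1) (X0 l)) (sq_rep pi u l).
Proof.
have H l : exists M, Splus pi conj M /\ square_class (- \det M) (sq_rep pi u l).
  by have [M] := class_exists sqt hsqrtu hE hconj l; exists M.
have [M hM] := choice H; exists (fun l => emb ord0 (M l)) => l; have [SM cM] := hM l.
by split; [exists (M l) | rewrite /delta embK].
Qed.

Section WithRepresentatives.
Variable X0 : 'I_3 -> mx.
Hypothesis hX0 : forall l, glambda pi conj (ord0 : 'I_k.+1) (X0 l) /\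
  square_class (delta (ord0 : 'I_k.+1) (X0 l)) (sq_rep pi u l).

Let repsP : nonzero_orbit_reps G Vp (reps X0) :=
  reps_nonzero_orbit_reps sqt hsqrtu hE hconj iota natr0 hX0.

Lemma size_reps : size (reps X0) = (3 + 4 * k)%N.
Proof.
rewrite size_cat; congr (_ + _)%N; rewrite size_flatten /shape -map_comp.
by rewrite (@eq_map _ _ _ (fun=> 4%N)) // sumnE big_map big_const_seq count_predT size_iota
  iter_addn_0.
Qed.

Lemma open_orbit_reps X : X \in Vp -> open_in abs pi Vp (orbit_of G X) <->
  exists2 Y, Y \in open_reps X0 & same Y X.
Proof.
move=> hX; have [s hs] := Vplus_signature sqt hsqrtu hE hconj iota natr0 hX.
have h1 := open_orbit_signature hp hQp hpi unit2 hu hu2 hsqrtu hE hconj hX hs.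
have h2 := open_reps_signature sqt hsqrtu hE hconj natr0 hX0 hX hs.
by split=> [/h1/h2|/h2/h1].
Qed.

Lemma open_reps_sub Y : Y \in open_reps X0 -> Y \in reps X0.
Proof.
rewrite /open_reps /reps mem_cat; case: ifP => [_ -> //|k0 hY].
apply/orP; right; apply/flatten_mapP; exists 0%N => //.
by rewrite mem_iota lt0n k0.
Qed.

(** The zero orbit is added to the 3 + 4k nonzero ones. *)
Lemma card_orbits : (orbits G Vp #= `I_(4 * k.+1))%card.
Proof.
have [r1 r2 r3] := repsP; have sz := size_reps.
move: (reps X0) r1 r2 r3 sz => r r1 r2 r3 sz; pose s := 0 :: r.
have Vs X : X \in s -> X \in Vp.
  by rewrite inE => /predU1P[->|/r1[]//]; apply: mem0v.
have zero X : X \in r -> ~ same 0 X.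
  by move=> /r1[_ X0'] [f _ fX]; rewrite -fX linear0 eqxx in X0'.
have -> : orbits G Vp = [set orbit_of G Y | Y in [set` s]].
  apply/seteqP; split=> [_ [X /= hX <-]|_ [Y /= Ys <-]]; last by exists Y => //=; apply: Vs.
  have [->|nX] := eqVneq X 0; first by exists 0 => //=; rewrite inE eqxx.
  have [Y Ys YX] := r3 X hX nX; have hY : Y \in s by rewrite inE Ys orbT.
  by exists Y => //=; apply/orbit_eq => //; apply: Vs.
have -> : (4 * k.+1)%N = size s by rewrite /= sz; lia.
apply: card_orbit_list => i j si sj /(orbit_eq (Vs _ (mem_nth 0 si)) (Vs _ (mem_nth 0 sj))).
case: i j si sj => [|i] [|j] //= si sj h.
- by case: (zero _ (mem_nth 0 sj) h).
- by case: (zero _ (mem_nth 0 si)); apply: sym h; apply/Vs; rewrite inE mem_nth ?orbT.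
by congr _.+1; apply: r2.
Qed.

Lemma card_open_orbits : ([set U | orbits G Vp U /\ open_in abs pi Vp U]
  #= `I_(if k == 0%N then 3 else 4))%card.
Proof.
have [r1 r2 r3] := repsP.
have Vo Y : Y \in open_reps X0 -> Y \in Vp by move=> /open_reps_sub/r1[].
have -> : [set U | orbits G Vp U /\ open_in abs pi Vp U]
    = [set orbit_of G Y | Y in [set` open_reps X0]].
  apply/seteqP; split=> [_ /= [[X /= hX <-] /(open_orbit_reps hX)[Y hY YX]]|_ [Y /= hY <-]].
    by exists Y => //=; apply/orbit_eq => //; apply: Vo.
  split; first by exists Y => //=; apply: Vo.
  by apply/open_orbit_reps; [apply: Vo | exists Y => //; apply/refl/Vo].
have -> : (if k == 0%N then 3 else 4)%N = size (open_reps X0).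
  by rewrite /open_reps; case: ifP.
apply: card_orbit_list => i j si sj.
move=> /(orbit_eq (Vo _ (mem_nth 0 si)) (Vo _ (mem_nth 0 sj))).
(* The list [open_reps] is a segment of [reps], starting at 0 if k = 0 and after the three elements
   of rank one otherwise, so it inherits the absence of repetitions. *)
have [c cE] : exists c, forall i, (i < size (open_reps X0))%N ->
    (c + i < size (reps X0))%N /\ (open_reps X0)`_i = (reps X0)`_(c + i).
  rewrite /open_reps size_reps; case: ifP => k0.
    exists 0%N => t /= t3; split; first by rewrite add0n; lia.
    by rewrite add0n /reps nth_cat t3.
  exists 3%N => t t4; split; first by move: t4 => /=; lia.
  have flat1 (x : seq mx) ss : flatten (x :: ss) = x ++ flatten ss by [].
  transitivity (flatten [seq reps_from X0 m | m <- seq.iota 0 k])`_t; last by [].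
  have -> : seq.iota 0 k = 0%N :: seq.iota 1 k.-1 by rewrite -{1}(prednK (n := k)) // lt0n k0.
  by rewrite map_cons flat1 nth_cat t4.
have [li ei] := cE i si; have [lj ej] := cE j sj.
by rewrite ei ej => /(r2 _ _ li lj)/addnI.
Qed.

End WithRepresentatives.
End Counting.

Theorem theorem3p9p8
  (p : nat) (hp : prime p)
  (Qp : fieldType) (abs : Qp -> rat) (hQp : is_Qp p abs)
  (F : fieldExtType Qp) (hF : ~ max_ideal abs (2 : F))
  (pi : F) (hpi : uniformizer abs pi)
  (u : F) (hu : integer_unit abs u) (hu2 : forall x : F, x ^+ 2 != u)
  (E : fieldExtType F) (sqrtu : E) (hsqrtu : sqrtu ^+ 2 = u%:A)
  (hE : <<1%AS; sqrtu>>%VS = {:E}%VS)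
  (conj : {lrmorphism E -> E}) (hconj : conj sqrtu = - sqrtu)
  (Fbar : closedFieldType) (iota : {rmorphism F -> Fbar})
  (hFbar : forall x : Fbar, algebraicOver iota x)
  (k : nat) :
  (forall X X' : 'I_k.+1 -> rmx E _,
     (forall j, glambda pi conj j (X j) /\ X j != 0) ->
     (forall j, glambda pi conj j (X' j) /\ X' j != 0) ->
     [<-> same_orbit (G pi conj k iota) (\sum_j X j) (\sum_j X' j);
          forall l : 'I_3, nl 0 (sq_rep pi u l) X
                           = nl 0 (sq_rep pi u l) X' %[mod 2];
          same_orbit (G0 pi conj k) (\sum_j X j) (\sum_j X' j)])
  /\
  ((orbits (G pi conj k iota) (Vplus pi conj k) #= `I_(4 * k.+1))%card /\
   ([set O | orbits (G pi conj k iota) (Vplus pi conj k) O /\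
             open_in abs pi (Vplus pi conj k) O]
      #= `I_(if k == 0%N then 3 else 4))%card)
  /\
  (forall X0 : 'I_3 -> rmx E _,
     (forall l, glambda pi conj (ord0 : 'I_k.+1) (X0 l) /\
                square_class (delta (ord0 : 'I_k.+1) (X0 l)) (sq_rep pi u l)) ->
     nonzero_orbit_reps (G pi conj k iota) (Vplus pi conj k) (reps X0) /\
     forall X, X \in Vplus pi conj k ->
       (open_in abs pi (Vplus pi conj k) (orbit_of (G pi conj k iota) X) <->
        exists2 Y, Y \in open_reps X0 &
                   same_orbit (G pi conj k iota) Y X)).
Proof.
(* Odd residual characteristic means that the integer 2 is not in the maximal ideal, hence is a
   unit. *)
have unit2 : integer_unit abs (2 : F).
  by apply: contrapT => h; apply: hF; split=> //; apply: (integer_nat hp hQp F 2).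
have sqt := local_square_theory hp hQp hpi unit2 hu hu2.
have natr0 := @char0_natr_neq0 p Qp abs hp hQp F pi hpi.
have [X0 hX0] := base_representatives hp hQp hpi unit2 hu hu2 hsqrtu hE hconj iota k.
split; first exact: (diagonal_orbits sqt hsqrtu hE hconj).
split; first split.
- exact: (card_orbits hp hQp hpi unit2 hu hu2 hsqrtu hE hconj iota hX0).
- exact: (card_open_orbits hp hQp hpi unit2 hu hu2 hsqrtu hE hconj iota hX0).
move=> Y0 hY0; split.
  exact: (reps_nonzero_orbit_reps sqt hsqrtu hE hconj iota natr0 hY0).
exact: (open_orbit_reps hp hQp hpi unit2 hu hu2 hsqrtu hE hconj iota hY0).
Qed.
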